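(* Let $N\ge3$ and let $\Omega$ be a cone in $\mathbb{R}^N$. Assume $s_1,s_2\in(0,2)$, $s_1\neq s_2$, $\lambda,\mu\in(0,+\infty)$, $\kappa>0$, $\alpha>1$, $\beta>1$, $\alpha+\beta=2^*(s_2)$. Let $\varepsilon\in(0,s_2)$ and let one of the following hold: (i) $\lambda>\mu$ and either $1<\beta<2$, or $\beta=2$ and $\kappa>\eta_{1,\varepsilon}$; (ii) $\lambda=\mu$ and either $\min\{\alpha,\beta\}<2$, or $\min\{\alpha,\beta\}=2$ and $\kappa>\eta_{1,\varepsilon}=\eta_{2,\varepsilon}$; (iii) $\lambda<\mu$ and either $1<\alpha<2$, or $\alpha=2$ and $\kappa>\eta_{2,\varepsilon}$. Then $c_\varepsilon=\tilde c_\varepsilon$, and any positive ground state solution of the system $$-\Delta u-\lambda\frac{|u|^{2^*(s_1)-2}u}{|x|^{s_1}}=\kappa\alpha\,a_\varepsilon(x)|u|^{\alpha-2}u|v|^\beta,\qquad -\Delta v-\mu\frac{|v|^{2^*(s_1)-2}v}{|x|^{s_1}}=\kappa\beta\,a_\varepsilon(x)|u|^{\alpha}|v|^{\beta-2}v\quad\text{in }\Omega,\quad (u,v)\in D_0^{1,2}(\Omega)\times D_0^{1,2}(\Omega),$$ is a mountain pass solution.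
   Context: $2^*(s):=\frac{2(N-s)}{N-2}$. A cone in $\mathbb{R}^N$ is an open domain $\Omega$ with Lipschitz boundary such that $tx\in\Omega$ for every $t>0$, $x\in\Omega$. $D_0^{1,2}(\Omega)$ is the completion of $C_c^\infty(\Omega)$ in the norm $\|u\|=(\int_\Omega|\nabla u|^2dx)^{1/2}$; $\mathcal{D}:=D_0^{1,2}(\Omega)\times D_0^{1,2}(\Omega)$. The weight is $a_\varepsilon(x)=|x|^{-(s_2-\varepsilon)}$ for $|x|<1$ and $a_\varepsilon(x)=|x|^{-(s_2+\varepsilon)}$ for $|x|\ge1$. The energy functional is $$\Phi_\varepsilon(u,v)=\frac12(\|u\|^2+\|v\|^2)-\frac1{2^*(s_1)}\int_\Omega\Big(\lambda\frac{|u|^{2^*(s_1)}}{|x|^{s_1}}+\mu\frac{|v|^{2^*(s_1)}}{|x|^{s_1}}\Big)dx-\kappa\int_\Omega a_\varepsilon(x)|u|^\alpha|v|^\beta dx,$$ $\mathcal{N}_\varepsilon=\{(u,v)\in\mathcal{D}\setminus\{(0,0)\}:\langle\Phi_\varepsilon'(u,v),(u,v)\rangle=0\}$, $c_\varepsilon:=\inf_{\mathcal{N}_\varepsilon}\Phi_\varepsilon$, and $$\tilde c_\varepsilon:=\inf_{\gamma\in\Gamma_\varepsilon}\max_{t\in[0,1]}\Phi_\varepsilon(\gamma(t)),\qquad \Gamma_\varepsilon:=\{\gamma\in C([0,1],\mathcal{D}):\gamma(0)=(0,0),\ \Phi_\varepsilon(\gamma(1))<0\}.$$ A ground state solution is a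 critical point $(u,v)\ne(0,0)$ of $\Phi_\varepsilon$ with $\Phi_\varepsilon(u,v)=c_\varepsilon$; positive means both components are $>0$ in $\Omega$. A mountain pass solution is a critical point of $\Phi_\varepsilon$ at the level $\tilde c_\varepsilon$ lying on a path $\gamma\in\Gamma_\varepsilon$ along which $\max_t\Phi_\varepsilon(\gamma(t))=\tilde c_\varepsilon$ is attained at that point. $\mu_{s_1}(\Omega):=\inf\{\|u\|^2/(\int_\Omega|u|^{2^*(s_1)}|x|^{-s_1}dx)^{2/2^*(s_1)}:u\in D_0^{1,2}(\Omega)\setminus\{0\}\}$. $U$ is a ground state (least energy) solution of $-\Delta u=\mu_{s_1}(\Omega)\,u^{2^*(s_1)-1}/|x|^{s_1}$ in $\Omega$, $u=0$ on $\partial\Omega$; for $\tau>0$, $U_\tau:=(\mu_{s_1}(\Omega)/\tau)^{\frac1{2^*(s_1)-2}}U$. Further $$\eta_{1,\varepsilon}:=\inf\Big\{\|v\|^2:v\in D_0^{1,2}(\Omega),\int_\Omega a_\varepsilon|U_\lambda|^{2^*(s_2)-2}|v|^2dx=1\Big\},\quad \eta_{2,\varepsilon}:=\inf\Big\{\|u\|^2:u\in D_0^{1,2}(\Omega),\int_\Omega a_\varepsilon|U_\mu|^{2^*(s_2)-2}|u|^2dx=1\Big\}.$$ *)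

(* Defs.v *)
From HB Require Import structures.
From mathcomp Require Import all_boot all_order all_algebra.
From mathcomp Require Import all_classical all_reals all_analysis.

Set Implicit Arguments.
Unset Strict Implicit.
Unset Printing Implicit Defensive.
Import Order.TTheory GRing.Theory Num.Theory.
Import numFieldNormedType.Exports.
Local Open Scope classical_set_scope.
Local Open Scope ring_scope.

Fact rV_display : measure_display. Proof. exact. Qed.

Section measurable_rV.
Context {R : realType}.

Definition rV_coord n (i : 'I_n) (x : 'rV[R]_n) : R := x 0 i.

(* product sigma-algebra, i.e. the Borel sigma-algebra of R^n *)
Definition rV_measurable n : set (set 'rV[R]_n) := g_sigma_preimage (@rV_coord n).

Let rV_set0 n : @rV_measurable n set0.
Proof. exact: sigma_algebra0. Qed.

Let rV_setC n A : @rV_measurable n A -> @rV_measurable n (~` A).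
Proof. exact: sigma_algebraC. Qed.

Let rV_bigcup n (F : (set 'rV[R]_n)^nat) :
  (forall i, rV_measurable (F i)) -> rV_measurable (\bigcup_i F i).
Proof. exact: sigma_algebra_bigcup. Qed.

HB.instance Definition _ n := @isMeasurable.Build rV_display 'rV[R]_n
  (@rV_measurable n) (@rV_set0 n) (@rV_setC n) (@rV_bigcup n).

Lemma measurable_rV_coord n (i : 'I_n) :
  measurable_fun [set: 'rV[R]_n] (fun x : 'rV[R]_n => x 0 i).
Proof.
move=> _ Y mY; rewrite setTI; apply: sub_sigma_algebra => /=.
rewrite -bigcup_seq/=; exists i => /=; first by rewrite mem_index_enum.
by exists Y => //; rewrite setTI.
Qed.

Lemma measurable_fun_rVP d (T : measurableType d) n (f : T -> 'rV[R]_n) :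
  (forall i, measurable_fun [set: T] (fun t => f t 0 i)) ->
  measurable_fun [set: T] f.
Proof.
move=> mf.
suff : g_sigma_preimage (fun i => @rV_coord n i \o f) `<=` measurable.
  rewrite g_sigma_preimage_comp => prefS.
  by move=> _ A mA; apply: prefS; exists A.
apply: smallest_sub; first exact: sigma_algebra_measurable.
rewrite -bigcup_seq; apply: bigcup_sub => i _ A [B mB <-].
exact: mf.
Qed.

Definition rV_cons n (p : R * 'rV[R]_n) : 'rV[R]_(n.+1) :=
  row_mx (p.1%:M : 'rV[R]_1) p.2.

Lemma rV_consE n (p : R * 'rV[R]_n) i :
  rV_cons p 0 i = if unlift ord0 i is Some j then p.2 0 j else p.1.
Proof.
rewrite /rV_cons; case: unliftP => [j ->|->].
  have -> : lift ord0 j = rshift 1 j by exact: val_inj.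
  exact: row_mxEr.
have -> : ord0 = lshift n (ord0 : 'I_1) by exact: val_inj.
by rewrite (row_mxEl (p.1%:M : 'rV[R]_1)) mxE eqxx.
Qed.

Lemma measurable_rV_cons n : measurable_fun [set: R * 'rV[R]_n] (@rV_cons n).
Proof.
apply: measurable_fun_rVP => i.
under eq_fun do rewrite rV_consE.
case: unliftP => [j _|_]; last exact: measurable_fst.
exact: (measurableT_comp (measurable_rV_coord j) measurable_snd).
Qed.

Definition rV_uncons n (x : 'rV[R]_n.+1) : R * 'rV[R]_n :=
  (x 0 ord0, \row_j x 0 (lift ord0 j)).

Lemma measurable_rV_uncons n : measurable_fun [set: 'rV[R]_n.+1] (@rV_uncons n).
Proof.
apply/measurable_fun_pairP; split; first exact: measurable_rV_coord.
apply: measurable_fun_rVP => i; rewrite /comp/=.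
under eq_fun do rewrite mxE.
exact: measurable_rV_coord.
Qed.

Lemma rV_consK n : cancel (@rV_cons n) (@rV_uncons n).
Proof.
move=> [x v]; rewrite /rV_uncons rV_consE unlift_none; congr pair.
by apply/rowP => j; rewrite mxE rV_consE liftK.
Qed.

End measurable_rV.

Section lebesgue_rV.
Context {R : realType}.

Section step.
Variables (n : nat) (mu : {sigma_finite_measure set 'rV[R]_n -> \bar R}).

Definition lebesgue_rV_step : set 'rV[R]_n.+1 -> \bar R :=
  pushforward (@lebesgue_measure R \x mu)%E (@rV_cons R n).

Let step0 : lebesgue_rV_step set0 = 0%E.
Proof. by rewrite /lebesgue_rV_step /pushforward preimage_set0 measure0. Qed.

Let step_ge0 A : (0 <= lebesgue_rV_step A)%E.
Proof. by rewrite /lebesgue_rV_step /pushforward measure_ge0. Qed.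

Let step_sigma_additive : semi_sigma_additive lebesgue_rV_step.
Proof.
move=> F mF tF mUF; rewrite /lebesgue_rV_step /pushforward preimage_bigcup.
have mcons A : measurable A -> measurable (@rV_cons R n @^-1` A).
  by move=> mA; rewrite -[X in measurable X]setTI; exact: measurable_rV_cons.
apply: measure_semi_sigma_additive.
- by move=> k; exact: mcons.
- apply/trivIsetP => /= i j _ _ ij; rewrite -preimage_setI.
  by move/trivIsetP : tF => /(_ _ _ _ _ ij) ->//; rewrite preimage_set0.
- by rewrite -preimage_bigcup; exact: mcons.
Qed.

HB.instance Definition _ := isMeasure.Build _ _ _ lebesgue_rV_step
  step0 step_ge0 step_sigma_additive.

Let step_sigma_finite : sigma_finite setT lebesgue_rV_step.
Proof.
have /sigma_finiteP[F [FT ndF Foo]] := sigma_finiteT (@lebesgue_measure R).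
have /sigma_finiteP[G [GT ndG Goo]] := sigma_finiteT mu.
exists (fun k => @rV_uncons R n @^-1` (F k `*` G k)).
  rewrite -preimage_bigcup -[LHS](preimage_setT (@rV_uncons R n)).
  congr (_ @^-1` _); rewrite -setXTT FT GT predeqE => -[x y]; split.
    move=> [/= [i _ Fx] [k _ Gy]]; exists (maxn i k) => //; split.
    - by move: x Fx; exact/subsetPset/ndF/leq_maxl.
    - by move: y Gy; exact/subsetPset/ndG/leq_maxr.
  by move=> [i _ []/= ? ?]; split; exists i.
move=> k; have [mF Fk] := Foo k; have [mG Gk] := Goo k; split.
  rewrite -[X in measurable X]setTI; apply: measurable_rV_uncons => //.
  exact: measurableX.
rewrite /lebesgue_rV_step /pushforward -comp_preimage.
rewrite (_ : _ \o _ = id); last by apply/funext => p; exact: rV_consK.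
by rewrite preimage_id product_measure1E// lte_mul_pinfty// ge0_fin_numE.
Qed.

HB.instance Definition _ :=
  Measure_isSigmaFinite.Build _ _ _ lebesgue_rV_step step_sigma_finite.

End step.

(* Lebesgue measure on R^n: the point mass for n = 0, and the image of
   dx \x (Lebesgue measure on R^n) for n.+1. *)
Fixpoint lebesgue_rV n : {sigma_finite_measure set 'rV[R]_n -> \bar R} :=
  if n is m.+1 then lebesgue_rV_step (lebesgue_rV m) else \d_(0 : 'rV[R]_0).

Lemma lebesgue_rV_box n (A : 'I_n -> set R) :
  (forall i, measurable (A i)) ->
  lebesgue_rV n [set x | forall i, A i (x 0 i)] =
  (\prod_(i < n) lebesgue_measure (A i))%E.
Proof.
elim: n A => [|n IH] A mA.
  rewrite big_ord0/= diracE mem_set//; by case.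
pose B := \bigcap_(i in [set: 'I_n])
  ((fun x : 'rV[R]_n => x 0 i) @^-1` A (lift ord0 i)).
have mB : measurable B.
  apply: fin_bigcap_measurable => // i _; rewrite -[X in measurable X]setTI.
  exact: measurable_rV_coord.
have BE : [set x : 'rV[R]_n | forall i : 'I_n, A (lift ord0 i) (x 0 i)] = B.
  by apply/seteqP; split => x/= H i; [move=> _|]; exact: H.
have {}IH : lebesgue_rV n B =
    (\prod_(i < n) lebesgue_measure (A (lift ord0 i)))%E.
  by rewrite -BE; exact: (IH (fun i => A (lift ord0 i)) (fun i => mA _)).
rewrite big_ord_recl -[X in (_ * X)%E]IH -(product_measure1E _ _ _ mB)//.
rewrite /= /lebesgue_rV_step /pushforward -BE; congr (_ _).
apply/seteqP; split => -[x v]/=.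
  move=> H; split; first by have := H ord0; rewrite rV_consE unlift_none.
  by move=> i; have := H (lift ord0 i); rewrite rV_consE liftK.
move=> [H0 H] i; rewrite rV_consE; case: unliftP => [j ->|->] //.
exact: mA.
Qed.

End lebesgue_rV.


Section euclidean.
Context {R : realType} {N : nat}.
Implicit Types (x y : 'rV[R]_N) (Omega : set 'rV[R]_N) (phi : 'rV[R]_N -> R).

Definition dotv x y : R := \sum_(i < N) x 0 i * y 0 i.

(* Euclidean norm; the library norm `|x| on 'rV[R]_N is the sup norm. *)
Definition enorm x : R := Num.sqrt (dotv x x).

(* Near each boundary point z, Omega is the region strictly above the graph of
   a Lipschitz function over the hyperplane orthogonal to a unit vector e; g is
   only evaluated on the projection x - <x,e> e of x to that hyperplane. *)
Definition lipschitz_boundary Omega :=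
  forall z, (closure Omega `\` Omega) z ->
  exists (e : 'rV[R]_N) (g : 'rV[R]_N -> R),
    [/\ dotv e e = 1, lipschitz g &
        \forall x \near z, Omega x <-> g (x - dotv x e *: e) < dotv x e].

Definition is_cone Omega :=
  [/\ open Omega, connected Omega, Omega !=set0, lipschitz_boundary Omega &
      forall t x, 0 < t -> Omega x -> Omega (t *: x)].

Definition partial (i : 'I_N) phi : 'rV[R]_N -> R :=
  fun x => 'D_(delta_mx 0 i) phi x.

Definition egrad phi x : 'rV[R]_N := \row_(i < N) partial i phi x.

Definition smooth phi := forall s : seq 'I_N,
  let f := foldr partial phi s in
  continuous f /\ forall i x, derivable f x (delta_mx 0 i).

Definition test_function Omega phi :=
  [/\ smooth phi, compact (closure [set x | phi x != 0]) &
      closure [set x | phi x != 0] `<=` Omega].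

End euclidean.

(* 2^*(s) in dimension N *)
Definition crit_exp {R : realType} (N : nat) (s : R) : R :=
  2 * (N%:R - s) / (N%:R - 2).

Section D012.
Context {R : realType} {N : nat}.
Variable Omega : set 'rV[R]_N.

Local Notation leb := (@lebesgue_rV R N).

(* An element of D_0^{1,2}(Omega) is represented by a pair w = (u, G): its
   realization w.1 = u as a function and its gradient w.2 = G. *)
Definition D12fun : Type := (('rV[R]_N -> R) * ('rV[R]_N -> 'rV[R]_N))%type.

(* The completion of the test functions for the norm |grad phi|_2. A Cauchy
   sequence is stored through the L^2 limit G of its gradients and its limit u
   as a function: by the Sobolev inequality (N >= 3) it converges in L^{2^*},
   hence a.e. along a subsequence, so that u exists and is determined a.e. by
   the class of the sequence. Only values on Omega matter, and pairs at
   distance dnorm2 (w - w') = 0 represent the same element. *)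
Definition D012 : set D12fun := [set w : D12fun |
  [/\ measurable_fun Omega w.1, measurable_fun Omega w.2 &
      exists phi : nat -> 'rV[R]_N -> R,
        [/\ forall n, test_function Omega (phi n),
            {ae leb, forall x, Omega x -> phi n x @[n --> \oo] --> w.1 x} &
            (\int[leb]_(x in Omega) (enorm (egrad (phi n) x - w.2 x) ^+ 2)%:E)%E
              @[n --> \oo] --> 0%E]]].

Definition dnorm2 (w : D12fun) : R := \int[leb]_(x in Omega) (enorm (w.2 x) ^+ 2).

Definition D12pair : Type := (D12fun * D12fun)%type.

Definition DxD : set D12pair := [set z | D012 z.1 /\ D012 z.2].

Definition pnorm (z : D12pair) : R := Num.sqrt (dnorm2 z.1 + dnorm2 z.2).

Section variational.
Variable F : D12pair -> R.

Definition is_frechet_derivative (z : D12pair) (L : D12pair -> R) :=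
  [/\ forall (a : R) h k, DxD h -> DxD k -> L (a *: h + k) = a * L h + L k,
      exists C : R, forall h, DxD h -> `|L h| <= C * pnorm h &
      forall e : R, 0 < e -> exists2 d : R, 0 < d & forall h, DxD h ->
        pnorm h < d -> `|F (z + h) - F z - L h| <= e * pnorm h].

Definition critical_point (z : D12pair) :=
  DxD z /\ is_frechet_derivative z (fun=> 0).

Definition nehari : set D12pair := [set z | [/\ DxD z, pnorm z != 0 &
  exists2 L, is_frechet_derivative z L & L z = 0]].

Definition nehari_level : \bar R := ereal_inf [set (F z)%:E | z in nehari].

Definition mp_paths : set (R -> D12pair) := [set gamma |
  [/\ forall t, t \in `[0, 1] -> DxD (gamma t),
      forall t, t \in `[0, 1] -> forall e : R, 0 < e ->
        exists2 d : R, 0 < d & forall t', t' \in `[0, 1] ->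
          `|t' - t| < d -> pnorm (gamma t' - gamma t) < e,
      pnorm (gamma 0) = 0 & F (gamma 1) < 0]].

(* This is the maximum of F along gamma when F is continuous on DxD. *)
Definition path_max (gamma : R -> D12pair) : \bar R :=
  ereal_sup [set (F (gamma t))%:E | t in `[0, 1]].

Definition mp_level : \bar R :=
  ereal_inf [set path_max gamma | gamma in mp_paths].

Definition ground_state (z : D12pair) :=
  [/\ critical_point z, pnorm z != 0 & (F z)%:E = nehari_level].

Definition mountain_pass_solution (z : D12pair) :=
  [/\ critical_point z, (F z)%:E = mp_level &
      exists2 gamma, mp_paths gamma &
        path_max gamma = mp_level /\ exists2 t, t \in `[0, 1] & gamma t = z].

End variational.

Definition positive_pair (z : D12pair) :=
  {ae leb, forall x, Omega x -> 0 < z.1.1 x /\ 0 < z.2.1 x}.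

Definition weight (s eps : R) (x : 'rV[R]_N) : R :=
  if enorm x < 1 then enorm x `^ (- (s - eps)) else enorm x `^ (- (s + eps)).

Definition Phi (s1 s2 lambda mu kappa alpha beta eps : R) (z : D12pair) : R :=
  2^-1 * (dnorm2 z.1 + dnorm2 z.2)
  - (crit_exp N s1)^-1 * \int[leb]_(x in Omega)
      (lambda * (`|z.1.1 x| `^ crit_exp N s1 / enorm x `^ s1)
       + mu * (`|z.2.1 x| `^ crit_exp N s1 / enorm x `^ s1))
  - kappa * \int[leb]_(x in Omega)
      (weight s2 eps x * `|z.1.1 x| `^ alpha * `|z.2.1 x| `^ beta).

Definition hs_integral (s : R) (u : D12fun) : R :=
  \int[leb]_(x in Omega) (`|u.1 x| `^ crit_exp N s / enorm x `^ s).

Definition hs_const (s : R) : R :=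
  inf [set dnorm2 u / hs_integral s u `^ (2 / crit_exp N s) |
       u in [set u | D012 u /\ dnorm2 u != 0]].

(* Weak solutions; the real power u^{2^*(s)-1} in the equation is that of a
   positive function. *)
Definition limit_solution (s : R) (u : D12fun) :=
  [/\ D012 u, {ae leb, forall x, Omega x -> 0 < u.1 x} &
      forall h, D012 h ->
        \int[leb]_(x in Omega) dotv (u.2 x) (h.2 x) =
        hs_const s * \int[leb]_(x in Omega)
          (u.1 x `^ (crit_exp N s - 1) / enorm x `^ s * h.1 x)].

Definition limit_energy (s : R) (u : D12fun) : R :=
  2^-1 * dnorm2 u - hs_const s / crit_exp N s * hs_integral s u.

Definition limit_ground_state (s : R) (u : D12fun) :=
  limit_solution s u /\
  forall w, limit_solution s w -> limit_energy s u <= limit_energy s w.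

Definition rescaled (s : R) (U : D12fun) (tau : R) : D12fun :=
  (hs_const s / tau) `^ (1 / (crit_exp N s - 2)) *: U.

(* eta_{1,eps} for V = U_lambda, eta_{2,eps} for V = U_mu *)
Definition eta (s eps : R) (V : D12fun) : \bar R :=
  ereal_inf [set (dnorm2 v)%:E | v in [set v | D012 v /\
    \int[leb]_(x in Omega)
      (weight s eps x * `|V.1 x| `^ (crit_exp N s - 2) * `|v.1 x| ^+ 2) = 1]].

End D012.

(* Main.v *)
Require Import Defs.
From mathcomp Require Import all_boot all_order all_algebra.
From mathcomp Require Import all_classical all_reals all_analysis.
From mathcomp Require Import measurable_realfun ring lra.

(** Let [F] be the functional and [K z] the value at [z] of its derivative at
    [z], so that the Nehari set is [K = 0] without the origin.  On a ray,
    [F (t z) = A t^2 / 2 - B t^p / p - kappa C t^q], where [A] is the energy of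
    [z], [B] and [C] are the two nonlinear integrals, [p = 2^*(s_1)] and
    [q = 2^*(s_2)], and [K z = A - B - kappa q C].

    Both [p] and [q] exceed 2, and this makes the two levels equal.  If [z] is
    in the Nehari set, [F] is maximal at [t = 1] on the ray through [z] and it
    is negative far away: the ray is an admissible path with maximum [F z]
    ([nehari_ray]), so the mountain pass level is at most the Nehari level.
    Conversely, [K] is positive near the origin, because [B] and [C] are bounded
    by powers of the energy with exponents larger than 1 ([K_pos_near0]), and
    [F < 0] forces [K < 0] ([F_neg_K]): by the intermediate value theorem each
    admissible path meets the Nehari set ([path_meets_nehari]), so the Nehari
    level is at most the mountain pass level.  A ground state is a point of the
    Nehari set at that level, and the path through it is its ray.

    This argument needs the bounds of [B] and [C], and the differentiability of
    both, which makes [F] and [K] continuous on paths and identifies the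
    derivative along rays.

    The bounds are the inequality of Hardy and Sobolev ([hardy_sobolev]); the
    weight [a_eps] is at most [|x|^-s_2].  For functions with bounded support it
    is interpolated by Hölder's inequality between Sobolev's and Hardy's
    ([sobolev], [hardy]).  Sobolev's inequality is that of Gagliardo and
    Nirenberg applied to a power of the function; the latter is proved by
    induction on the dimension, by slices ([gagliardo_nirenberg_step]).  Hardy's
    inequality is an integration by parts.  The passage to the completion is
    Fatou's lemma.

    Differentiability ([frechet_nemytskii]) holds for integrals of
    [W * f (u, v)] as soon as the weight [W] satisfies such an inequality and
    [f] is bounded, together with its derivatives and its first order Taylor
    remainder, by powers of the right degrees ([c1_growth]).  These pointwise
    bounds follow from the convexity of [|x|^a] alone ([powR_remainder]). *)

Set Implicit Arguments.
Unset Strict Implicit.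
Unset Printing Implicit Defensive.
Import Order.TTheory GRing.Theory Num.Theory.
Import numFieldNormedType.Exports.
Local Open Scope classical_set_scope.
Local Open Scope ring_scope.

(** * Real powers *)

Section powers.
Context {R : realType}.
Implicit Types (a b h k x y t q al be ta : R).

Lemma gt0_powRD x r s : 0 < x -> x `^ (r + s) = x `^ r * x `^ s.
Proof. by move=> x0; rewrite powRD// (gt_eqF x0) implybT. Qed.

Lemma pos_powRD x r s : 0 < r + s -> x `^ (r + s) = x `^ r * x `^ s.
Proof. by move=> rs; rewrite powRD// (gt_eqF rs). Qed.

Lemma le_powRl x y r : 0 <= r -> 0 <= x -> x <= y -> x `^ r <= y `^ r.
Proof.
by move=> r0 x0 xy; apply: ge0_ler_powR => //; rewrite nnegrE// (le_trans x0).
Qed.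

Lemma powRVK x r : 0 <= x -> r != 0 -> (x `^ r) `^ r^-1 = x.
Proof. by move=> x0 r0; rewrite -powRrM divff// powRr1. Qed.

Lemma powRV x r : 0 < x -> (x^-1) `^ r = (x `^ r)^-1.
Proof. by move=> x0; rewrite -powR_inv1 ?(ltW x0)// -powRrM mulN1r powRN. Qed.

Lemma young_powR x y t : 0 <= x -> 0 <= y -> 0 < t < 1 ->
  x `^ t * y `^ (1 - t) <= t * x + (1 - t) * y.
Proof.
move=> x0 y0 /andP[t0 t1].
have t0' : 0 < 1 - t by rewrite subr_gt0.
have := @conjugate_powR R (x `^ t) (y `^ (1 - t)) t^-1 (1 - t)^-1
  (powR_ge0 _ _) (powR_ge0 _ _).
rewrite !invr_gt0 !invrK => /(_ t0 t0'); rewrite subrKC => /(_ erefl).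
by rewrite !powRVK ?gt_eqF// [_ * t]mulrC [_ * (1 - t)]mulrC.
Qed.

(** By concavity, [z^a] is at least [z / (x + y)] times [(x + y)^a] for
    [z] between 0 and [x + y]; add this for [z = x] and [z = y]. *)
Lemma powR_subadd x y a : 0 <= x -> 0 <= y -> 0 < a <= 1 ->
  (x + y) `^ a <= x `^ a + y `^ a.
Proof.
move=> x0 y0 /andP[a0 a1].
have [s0|] := ltP 0 (x + y); last first.
  move=> xy; have -> : x + y = 0 by apply/eqP; rewrite eq_le xy addr_ge0.
  by rewrite powR0 ?gt_eqF// addr_ge0// powR_ge0.
have key z : 0 <= z -> z <= x + y -> (x + y) `^ a * (z / (x + y)) <= z `^ a.
  rewrite le_eqVlt => /predU1P[<- _|z0 zs].
    by rewrite mul0r mulr0 powR_ge0.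
  have zE : z = (x + y) * (z / (x + y)) by field; rewrite gt_eqF.
  have zs0 : 0 <= z / (x + y) by rewrite divr_ge0// ltW.
  rewrite [in leRHS]zE powRM// ?(ltW s0)//.
  rewrite ler_wpM2l ?powR_ge0//; apply: ger1_powR => //.
  by rewrite divr_gt0//= ler_pdivrMr// mul1r.
have := lerD (key x x0 _) (key y y0 _).
rewrite lerDl lerDr => /(_ y0 x0); apply: le_trans.
by rewrite -mulrDr -mulrDl divff ?gt_eqF// mulr1.
Qed.

(** The derivative of [|x|^a] is [a * spow (a - 1) x]. *)
Definition spow a x : R := Num.sg x * `|x| `^ a.

Lemma spowN a x : spow a (- x) = - spow a x.
Proof. by rewrite /spow sgrN normrN mulNr. Qed.

Lemma ge0_spow a x : 0 < a -> 0 <= x -> spow a x = x `^ a.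
Proof.
move=> a0; rewrite /spow le_eqVlt => /predU1P[<-|x0].
  by rewrite sgr0 mul0r powR0// gt_eqF.
by rewrite gtr0_sg// mul1r gtr0_norm.
Qed.

Lemma normr_spow a x : 0 < a -> `|spow a x| = `|x| `^ a.
Proof.
move=> a0; have [x0|/ltW x0] := leP 0 x.
  by rewrite ge0_spow// ger0_norm ?powR_ge0// ger0_norm.
have xN : 0 <= - x by rewrite oppr_ge0.
rewrite -[x in LHS]opprK spowN (ge0_spow a0 xN) normrN ger0_norm ?powR_ge0//.
by rewrite (ler0_norm x0).
Qed.

Lemma spowMx a x : 1 < a -> spow (a - 1) x * x = `|x| `^ a.
Proof.
move=> a1; rewrite -(@mulr_powRB1 _ `|x| a)// ?(lt_trans _ a1)//.
by rewrite /spow -mulrA mulrCA -normrEsg mulrC.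
Qed.

(** Convexity of [|x|^a]: after expansion, this is Young's inequality for the
    product of [spow (a - 1) x] and [y]. *)
Lemma powR_subgradient a x y : 1 < a ->
  `|x| `^ a + a * spow (a - 1) x * (y - x) <= `|y| `^ a.
Proof.
move=> a1; have a0 : 0 < a by rewrite (lt_trans _ a1).
rewrite mulrBr -(mulrA a _ x) spowMx//.
have := @young_powR (`|y| `^ a) (`|x| `^ a) a^-1 (powR_ge0 _ _) (powR_ge0 _ _).
rewrite invr_gt0 a0 invf_lt1// => /(_ a1); rewrite powRVK ?gt_eqF// -powRrM.
have -> : a * (1 - a^-1) = a - 1 by field; rewrite gt_eqF.
rewrite -normr_spow ?subr_gt0// -normrM mulrC => H.
have {H} := le_trans (ler_norm _) H.
rewrite -(ler_pM2l a0) mulrDr !mulrA divff ?gt_eqF// mul1r => H.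
rewrite mulrBr mulr1 divff ?gt_eqF// mulrBl mul1r in H.
lra.
Qed.

(** For [a <= 1] the function is Hölder continuous of exponent [a], for
    [1 < a] it is locally Lipschitz.  Since [|x - y| <= |x| + |y|], the exponent
    of the difference can be lowered to [ta] if the missing degree is put on
    [|x| + |y|]. *)
Lemma spow_hoelder a ta x y : 0 < ta <= 1 -> ta <= a ->
  `|spow a x - spow a y| <=
    2 * (a + 1) * `|x - y| `^ ta * (`|x| + `|y|) `^ (a - ta).
Proof.
move=> /andP[ta0 ta1] taa.
have a0 : 0 < a by rewrite (lt_le_trans ta0).
(* [X >= Y] are the two absolute values, [D] is the distance, and [e] is the
   product of the signs: either [e = 1], or the signs differ and [D = X + Y]. *)
suff same (X Y D e : R) : 0 <= Y -> Y <= X -> X - Y <= D -> D <= X + Y ->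
    `|e| <= 1 -> (e = 1 \/ D = X + Y) ->
    `|X `^ a - e * Y `^ a| <= 2 * (a + 1) * D `^ ta * (X + Y) `^ (a - ta).
  wlog yx : x y / `|y| <= `|x|.
    have [h|/ltW h] := leP `|y| `|x|; first exact.
    by move=> /(_ _ _ h); rewrite distrC [`|y - x|]distrC [`|y| + _]addrC.
  wlog x0 : x y yx / 0 <= x.
    have [h|/ltW h] := leP 0 x; first exact.
    move=> /(_ (- x) (- y)); rewrite !normrN !spowN oppr_ge0 => /(_ yx h).
    by rewrite -!opprD !normrN.
  have [y0|/ltW y0] := leP 0 y.
    move: yx; rewrite (ger0_norm x0) (ger0_norm y0) => yx.
    have := same x y (x - y) 1 y0 yx (lexx _).
    have xy0 : 0 <= x - y by rewrite subr_ge0.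
    rewrite mul1r !ge0_spow// (ger0_norm xy0); apply.
    - by rewrite lerD2l; lra.
    - by rewrite normr1.
    - by left.
  have yN : 0 <= - y by rewrite oppr_ge0.
  have := same x (- y) (x - y) (-1) yN.
  have -> : spow a y = - spow a (- y) by rewrite spowN opprK.
  rewrite (ge0_spow a0 x0) (ge0_spow a0 yN) mulN1r.
  move: yx; rewrite (ger0_norm x0) (ler0_norm y0) => yx.
  have xy0 : 0 <= x - y by rewrite subr_ge0 (le_trans y0).
  rewrite (ger0_norm xy0); apply => //.
  - lra.
  - by rewrite normrN normr1.
  - by right.
move=> Y0 YX XYD DXY e1 eD.
have X0 : 0 <= X by rewrite (le_trans Y0).
have D0 : 0 <= D by rewrite (le_trans _ XYD)// subr_ge0.
have [S0|S0] := ltP 0 (X + Y); last first.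
  have XE : X = 0 by lra. have YE : Y = 0 by lra.
  rewrite XE YE powR0 ?gt_eqF// mulr0 subrr normr0 !mulr_ge0 ?powR_ge0//.
  by rewrite addr_ge0// ltW.
have c0 : 0 <= D `^ ta * (X + Y) `^ (a - ta) by rewrite mulr_ge0// powR_ge0.
suff H : `|X `^ a - e * Y `^ a| <= Num.max 2 (2 * a) * (D `^ ta * (X + Y) `^ (a - ta)).
  rewrite -(mulrA (2 * _)) (le_trans H)// ler_wpM2r// ge_max; apply/andP; split; lra.
have [a1|a1] := leP a 1.
  have DE : D `^ a <= D `^ ta * (X + Y) `^ (a - ta).
    have -> : D `^ a = D `^ ta * D `^ (a - ta).
      by rewrite -powRD subrKC// (gt_eqF a0).
    by rewrite ler_wpM2l ?powR_ge0// le_powRl// subr_ge0.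
  suff : `|X `^ a - e * Y `^ a| <= 2 * D `^ a.
    move=> /le_trans; apply; rewrite (@le_trans _ _ (2 * (D `^ ta * (X + Y) `^ (a - ta))))//.
      by rewrite ler_pM2l.
    by rewrite ler_wpM2r// le_max lexx.
  case: eD => [->|DE'].
    rewrite mul1r ger0_norm ?subr_ge0 ?le_powRl// ?(ltW a0)//.
    have := @powR_subadd Y (X - Y) a Y0; rewrite subr_ge0 subrKC a0 a1 => /(_ YX isT).
    have : (X - Y) `^ a <= D `^ a by rewrite le_powRl// ?(ltW a0)// subr_ge0.
    have := powR_ge0 D a; lra.
  rewrite (le_trans (ler_normB _ _))// normrM !(ger0_norm (powR_ge0 _ _)).
  have : X `^ a <= D `^ a by rewrite le_powRl// ?(ltW a0)// DE' lerDl.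
  have YD : Y `^ a <= D `^ a by rewrite le_powRl// ?(ltW a0)// DE' lerDr.
  have : `|e| * Y `^ a <= 1 * Y `^ a by rewrite ler_wpM2r// powR_ge0.
  lra.
have DE : D * (X + Y) `^ (a - 1) <= D `^ ta * (X + Y) `^ (a - ta).
  have -> : (X + Y) `^ (a - ta) = (X + Y) `^ (1 - ta) * (X + Y) `^ (a - 1).
    by rewrite -gt0_powRD//; congr (_ `^ _); ring.
  rewrite mulrA ler_wpM2r ?powR_ge0//.
  have {1}-> : D = D `^ ta * D `^ (1 - ta).
    by rewrite -powRD subrKC ?powRr1// oner_eq0.
  by rewrite ler_wpM2l ?powR_ge0// le_powRl// subr_ge0.
suff : `|X `^ a - e * Y `^ a| <= 2 * a * (D * (X + Y) `^ (a - 1)).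
  move=> /le_trans; apply.
  rewrite (@le_trans _ _ (2 * a * (D `^ ta * (X + Y) `^ (a - ta))))//.
    by rewrite ler_pM2l// mulr_gt0.
  by rewrite ler_wpM2r// le_max lexx orbT.
have X1 : X `^ (a - 1) <= (X + Y) `^ (a - 1).
  by rewrite le_powRl ?lerDl// subr_ge0 ltW.
case: eD => [->|DE'].
  rewrite mul1r ger0_norm ?subr_ge0 ?le_powRl// ?(ltW a0)//.
  have := @powR_subgradient a X Y a1.
  rewrite ge0_spow ?subr_gt0// !ger0_norm// => H.
  have : X `^ (a - 1) * (X - Y) <= (X + Y) `^ (a - 1) * D.
    by rewrite ler_pM// ?powR_ge0 ?subr_ge0.
  rewrite -(ler_pM2l a0) => H2.
  have : 0 <= a * (D * (X + Y) `^ (a - 1)) by rewrite !mulr_ge0 ?powR_ge0// ltW.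
  lra.
rewrite (le_trans (ler_normB _ _))// normrM !(ger0_norm (powR_ge0 _ _)).
have : `|e| * Y `^ a <= 1 * Y `^ a by rewrite ler_wpM2r// powR_ge0.
rewrite DE' mulr_powRB1 ?(ltW S0)//.
have : X `^ a <= (X + Y) `^ a by rewrite le_powRl// ?(ltW a0)// lerDl.
have : Y `^ a <= (X + Y) `^ a by rewrite le_powRl// ?(ltW a0)// lerDr.
have : 0 <= (a - 1) * (X + Y) `^ a by rewrite mulr_ge0 ?powR_ge0// subr_ge0 ltW.
lra.
Qed.

(** By convexity at [x] and at [x + h], the remainder lies between 0 and [h]
    times the increment of the derivative, which is Hölder continuous. *)
Lemma powR_remainder a ta x h : 1 < a -> 0 < ta <= 1 -> ta <= a - 1 ->
  `| `|x + h| `^ a - `|x| `^ a - a * spow (a - 1) x * h| <=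
    2 * a * a * `|h| `^ (1 + ta) * (2 * `|x| + `|h|) `^ (a - 1 - ta).
Proof.
move=> a1 ta01 taa; have a0 : 0 < a by rewrite (lt_trans _ a1).
have ta0 : 0 < ta by case/andP: ta01.
set y := x + h; have hE : h = y - x by rewrite /y addrC addKr.
have L := powR_subgradient x y a1; have U := powR_subgradient y x a1.
have := spow_hoelder y x ta01 taa; rewrite -hE subrK => H.
have yxh : `|y| + `|x| <= 2 * `|x| + `|h|.
  by have := ler_normD x h; rewrite -/y; lra.
have H2 : (`|y| + `|x|) `^ (a - 1 - ta) <= (2 * `|x| + `|h|) `^ (a - 1 - ta).
  by rewrite le_powRl ?subr_ge0 ?addr_ge0.
have -> : `|h| `^ (1 + ta) = `|h| * `|h| `^ ta.
  by rewrite powRD ?powRr1// gt_eqF// addr_gt0.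
rewrite ger0_norm; last by rewrite hE; lra.
apply: (@le_trans _ _ (a * (`|spow (a - 1) y - spow (a - 1) x| * `|h|))).
  apply: (@le_trans _ _ (a * ((spow (a - 1) y - spow (a - 1) x) * h))).
    by rewrite hE; lra.
  by rewrite ler_pM2l// -normrM ler_norm.
have H3 := ler_wpM2l (mulr_ge0 (mulr_ge0 (ler0n _ 2) (ltW a0)) (powR_ge0 `|h| ta)) H2.
have := ler_wpM2l (ltW a0) (ler_wpM2r (normr_ge0 h) (le_trans H H3)).
lra.
Qed.

(** By convexity, the increment lies between the two values of the derivative
    at the end points, times [h]. *)
Lemma powR_increment a x h : 1 < a ->
  `| `|x + h| `^ a - `|x| `^ a| <= a * `|h| * (`|x| + `|h|) `^ (a - 1).
Proof.
move=> a1; have a0 : 0 < a by rewrite (lt_trans _ a1).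
have b0 : 0 < a - 1 by rewrite subr_gt0.
set y := x + h; have hE : h = y - x by rewrite /y addrC addKr.
have L := powR_subgradient x y a1; have U := powR_subgradient y x a1.
have K z : `|z| <= `|x| + `|h| ->
    `|a * spow (a - 1) z * h| <= a * `|h| * (`|x| + `|h|) `^ (a - 1).
  move=> zxh; rewrite (normrM _ h) (normrM a) (gtr0_norm a0) normr_spow// mulrAC.
  by rewrite ler_wpM2l ?mulr_ge0 ?(ltW a0)// le_powRl// ltW.
have xx : `|x| <= `|x| + `|h| by rewrite lerDl.
have /ler_normlP[Kx1 Kx2] := K x xx.
have /ler_normlP[Ky1 Ky2] := K y (ler_normD _ _).
have LE : y - x = h by rewrite hE. have UE : x - y = - h by rewrite hE opprB.
rewrite LE in L; rewrite UE in U.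
by apply/ler_normlP; split; lra.
Qed.

End powers.

(** * Functions of two variables with power growth *)

Section growth.
Context {R : realType}.
Implicit Types (a b h k x y t q al be ta : R).

(** The bounds satisfied by a homogeneous function [f] of degree [q] whose
    partial derivatives [d1] and [d2] are Hölder continuous of exponent [ta] on
    the unit sphere.  The remainder is bounded by a product of two powers of
    total degree [q]: after integration against a weight, Hölder's inequality
    then gives the power [1 + ta] of the size of the increment. *)
Definition c1_growth q (f d1 d2 : R -> R -> R) := exists ta C,
  [/\ [/\ 0 < ta <= 1, ta <= q - 1 & 0 <= C],
      [/\ measurable_fun setT (fun z : R * R => f z.1 z.2),
          measurable_fun setT (fun z : R * R => d1 z.1 z.2) &
          measurable_fun setT (fun z : R * R => d2 z.1 z.2)],
      forall x y, `|f x y| <= C * (`|x| + `|y|) `^ q,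
      forall x y, `|d1 x y| <= C * (`|x| + `|y|) `^ (q - 1) /\
                  `|d2 x y| <= C * (`|x| + `|y|) `^ (q - 1) &
      forall x y h k,
        `|f (x + h) (y + k) - f x y - (d1 x y * h + d2 x y * k)| <=
        C * ((`|h| + `|k|) `^ (1 + ta) *
             (`|x| + `|y| + (`|h| + `|k|)) `^ (q - 1 - ta))].

Lemma measurable_norm_powR a :
  measurable_fun setT (fun x : R => `|x| `^ a).
Proof.
by apply: (measurableT_comp (measurable_powR a)); exact: normr_measurable.
Qed.

Lemma measurable_spow a : measurable_fun setT (@spow R a).
Proof.
have -> : @spow R a = (fun x => x * `|x| `^ (a - 1)).
  apply/funext => x; rewrite /spow; have [->|x0] := eqVneq x 0.
    by rewrite sgr0 !mul0r.
  rewrite (_ : `|x| `^ a = `|x| * `|x| `^ (a - 1)); first by rewrite mulrA -numEsg.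
  rewrite -[X in X * _ `^ _]powRr1// -gt0_powRD ?normr_gt0//.
  by congr (_ `^ _); ring.
by apply: measurable_funM => //; exact: measurable_norm_powR.
Qed.

Lemma remainder_scaled a ta x h S : 1 < a -> 0 < ta <= 1 -> ta <= a - 1 ->
  2 * `|x| + `|h| <= 2 * S ->
  `| `|x + h| `^ a - `|x| `^ a - a * spow (a - 1) x * h| <=
    2 * a * a * 2 `^ (a - 1 - ta) * (`|h| `^ (1 + ta) * S `^ (a - 1 - ta)).
Proof.
move=> a1 ta01 taa hS; rewrite (le_trans (powR_remainder x h a1 ta01 taa))//.
have S0 : 0 <= S by have := normr_ge0 x; have := normr_ge0 h; lra.
have a0 : 0 <= a - 1 - ta by rewrite subr_ge0.
have an0 : 0 <= a by rewrite ltW// (lt_trans _ a1).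
have c0 : 0 <= 2 * a * a * `|h| `^ (1 + ta) by rewrite !mulr_ge0 ?powR_ge0.
have xh0 : 0 <= 2 * `|x| + `|h| by rewrite addr_ge0 ?mulr_ge0.
have := ler_wpM2l c0 (le_powRl a0 xh0 hS).
by rewrite powRM//; lra.
Qed.

Lemma c1_growth_sum p lambda mu : 1 < p -> 0 <= lambda -> 0 <= mu ->
  c1_growth p (fun x y => lambda * `|x| `^ p + mu * `|y| `^ p)
    (fun x y => lambda * (p * spow (p - 1) x))
    (fun x y => mu * (p * spow (p - 1) y)).
Proof.
move=> p1 l0 m0; pose ta := Num.min 1 (p - 1).
have p0 : 0 < p by rewrite (lt_trans _ p1).
have ta01 : 0 < ta <= 1 by rewrite lt_min ltr01 subr_gt0 p1 ge_min lexx.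
have tap : ta <= p - 1 by rewrite ge_min lexx orbT.
pose K := 2 * p * p * 2 `^ (p - 1 - ta).
have K0 : 0 <= K by rewrite !mulr_ge0 ?powR_ge0// ltW.
pose C := (lambda + mu) * (1 + p + K).
have lm0 : 0 <= lambda + mu by rewrite addr_ge0.
have pn0 := ltW p0.
exists ta, C; split.
- by split => //; rewrite mulr_ge0 ?addr_ge0.
- split.
  + apply: measurable_funD; apply: measurable_funM => //.
      exact: (measurableT_comp (measurable_norm_powR p) measurable_fst).
    exact: (measurableT_comp (measurable_norm_powR p) measurable_snd).
  + do 2 apply: measurable_funM => //.
    exact: (measurableT_comp (measurable_spow (p - 1)) measurable_fst).
  + do 2 apply: measurable_funM => //.
    exact: (measurableT_comp (measurable_spow (p - 1)) measurable_snd).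
- move=> x y; rewrite ger0_norm ?addr_ge0 ?mulr_ge0 ?powR_ge0//.
  apply: (@le_trans _ _ ((lambda + mu) * (`|x| + `|y|) `^ p)).
    by rewrite mulrDl lerD// ler_wpM2l// le_powRl// ?lerDl ?lerDr.
  rewrite ler_wpM2r ?powR_ge0// ler_peMr// -addrA lerDl addr_ge0//.
- have H (l z w : R) : 0 <= l -> l <= lambda + mu -> `|z| <= w ->
      `|l * (p * spow (p - 1) z)| <= C * w `^ (p - 1).
    move=> l0' llm zw; rewrite normrM (ger0_norm l0') /C -mulrA.
    apply: ler_pM => //; rewrite normrM (ger0_norm pn0) normr_spow ?subr_gt0//.
    apply: ler_pM => //.
      by rewrite addrAC lerDr addr_ge0.
    by rewrite le_powRl// subr_ge0 ltW.
  by move=> x y; split; apply: H; rewrite ?lerDl ?lerDr.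
- move=> x y h k; set S := `|x| + `|y| + _.
  have S0 : 0 <= S by rewrite !addr_ge0.
  have H (z w : R) : 2 * `|z| + `|w| <= 2 * S -> `|w| <= `|h| + `|k| ->
     `| `|z + w| `^ p - `|z| `^ p - p * spow (p - 1) z * w| <=
     K * ((`|h| + `|k|) `^ (1 + ta) * S `^ (p - 1 - ta)).
    move=> zw whk; rewrite (le_trans (remainder_scaled p1 ta01 tap zw))//.
    rewrite ler_wpM2l// ler_wpM2r ?powR_ge0// le_powRl//.
    by rewrite addr_ge0//; case/andP: ta01 => /ltW.
  have Hx : 2 * `|x| + `|h| <= 2 * S.
    by rewrite /S; have := normr_ge0 y; have := normr_ge0 h; have := normr_ge0 k; lra.
  have Hy : 2 * `|y| + `|k| <= 2 * S.
    by rewrite /S; have := normr_ge0 x; have := normr_ge0 h; have := normr_ge0 k; lra.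
  have Hh : `|h| <= `|h| + `|k| by rewrite lerDl.
  have Hk : `|k| <= `|h| + `|k| by rewrite lerDr.
  set E := _ * S `^ _ in H *.
  have E0 : 0 <= E by rewrite mulr_ge0 ?powR_ge0.
  rewrite [X in `|X|](_ : _ =
      lambda * (`|x + h| `^ p - `|x| `^ p - p * spow (p - 1) x * h)
      + mu * (`|y + k| `^ p - `|y| `^ p - p * spow (p - 1) y * k)); last by ring.
  rewrite (le_trans (ler_normD _ _))// !(normrM lambda) !(normrM mu).
  rewrite (ger0_norm l0) (ger0_norm m0).
  have := ler_wpM2l l0 (H _ _ Hx Hh); have := ler_wpM2l m0 (H _ _ Hy Hk).
  have : 0 <= (lambda + mu) * ((1 + p) * E).
    by apply: mulr_ge0 => //; apply: mulr_ge0 => //; lra.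
  by rewrite /C; lra.
Qed.

(** The remainder of the product is the sum of the two remainders, each
    times the other factor, and of the product of the two increments; the last
    term is quadratic, and [ta] is at most 1. *)
Lemma c1_growth_prod al be : 1 < al -> 1 < be ->
  c1_growth (al + be) (fun x y => `|x| `^ al * `|y| `^ be)
    (fun x y => al * spow (al - 1) x * `|y| `^ be)
    (fun x y => `|x| `^ al * (be * spow (be - 1) y)).
Proof.
move=> al1 be1; pose ta := Num.min 1 (Num.min (al - 1) (be - 1)).
have al0 : 0 < al by rewrite (lt_trans _ al1).
have be0 : 0 < be by rewrite (lt_trans _ be1).
have [aln ben] := (ltW al0, ltW be0).
have ta01 : 0 < ta <= 1.
  by rewrite !lt_min ltr01 !subr_gt0 al1 be1 ge_min lexx.
have ta0 : 0 < ta by case/andP: ta01.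
have ta1 : ta <= 1 by case/andP: ta01.
have taal : ta <= al - 1 by rewrite !ge_min lexx !orbT.
have tabe : ta <= be - 1 by rewrite !ge_min lexx !orbT.
pose Ka := 2 * al * al * 2 `^ (al - 1 - ta).
pose Kb := 2 * be * be * 2 `^ (be - 1 - ta).
have Ka0 : 0 <= Ka by rewrite !mulr_ge0 ?powR_ge0.
have Kb0 : 0 <= Kb by rewrite !mulr_ge0 ?powR_ge0.
pose C := 1 + al + be + (Ka + Kb + al * be).
have C0 : 0 <= C by rewrite !addr_ge0 ?mulr_ge0.
exists ta, C; split.
- by split => //; lra.
- split.
  + apply: measurable_funM.
      exact: (measurableT_comp (measurable_norm_powR al) measurable_fst).
    exact: (measurableT_comp (measurable_norm_powR be) measurable_snd).
  + apply: measurable_funM; first apply: measurable_funM => //.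
      exact: (measurableT_comp (measurable_spow (al - 1)) measurable_fst).
    exact: (measurableT_comp (measurable_norm_powR be) measurable_snd).
  + apply: measurable_funM; last apply: measurable_funM => //.
      exact: (measurableT_comp (measurable_norm_powR al) measurable_fst).
    exact: (measurableT_comp (measurable_spow (be - 1)) measurable_snd).
- move=> x y; rewrite ger0_norm ?mulr_ge0 ?powR_ge0//.
  apply: (@le_trans _ _ ((`|x| + `|y|) `^ (al + be))).
    rewrite pos_powRD; last by lra.
    by rewrite ler_pM ?powR_ge0// le_powRl// ?lerDl ?lerDr.
  by rewrite ler_peMl ?powR_ge0// /C; have := mulr_ge0 aln ben; lra.
- move=> x y; split.
  + rewrite normrM (ger0_norm (powR_ge0 _ _)) normrM (ger0_norm aln).
    rewrite normr_spow ?subr_gt0// -mulrA.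
    apply: ler_pM => //; [by rewrite /C; have := mulr_ge0 aln ben; lra|].
    have -> : al + be - 1 = (al - 1) + be by ring.
    rewrite (pos_powRD _ (r := al - 1)); last by lra.
    by rewrite ler_pM ?powR_ge0// le_powRl// ?lerDl ?lerDr// subr_ge0 ltW.
  + rewrite mulrCA (normrM be) (normrM (_ `^ _)) (ger0_norm ben).
    rewrite (ger0_norm (powR_ge0 _ _)).
    rewrite normr_spow ?subr_gt0//.
    apply: ler_pM => //; [by rewrite /C; have := mulr_ge0 aln ben; lra|].
    have -> : al + be - 1 = al + (be - 1) by ring.
    rewrite (pos_powRD _ (r := al)); last by lra.
    by rewrite ler_pM ?powR_ge0// le_powRl// ?lerDl ?lerDr// subr_ge0 ltW.
move=> x y h k; set H := `|h| + `|k|; set S := `|x| + `|y| + H.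
have [hx0 hy0 hh0 hk0] : [/\ 0 <= `|x|, 0 <= `|y|, 0 <= `|h| & 0 <= `|k|] by [].
have H0 : 0 <= H by rewrite addr_ge0.
have S0 : 0 <= S by rewrite !addr_ge0.
have HS : H <= S by rewrite /S; lra.
have b1 : 0 <= 1 + ta by lra.
set E := H `^ (1 + ta) * S `^ _.
have E0 : 0 <= E by rewrite mulr_ge0 ?powR_ge0.
have E1 : H `^ (1 + ta) * S `^ (al - 1 - ta) * S `^ be = E.
  rewrite /E -mulrA -pos_powRD; first by congr (_ * _ `^ _); ring.
  by lra.
have E2 : H `^ (1 + ta) * S `^ (be - 1 - ta) * S `^ al = E.
  rewrite /E -mulrA -pos_powRD; first by congr (_ * _ `^ _); ring.
  by lra.
have T1 : `|( `|x + h| `^ al - `|x| `^ al - al * spow (al - 1) x * h) * `|y| `^ be|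
    <= Ka * E.
  rewrite normrM (ger0_norm (powR_ge0 _ _)) -E1 mulrA.
  rewrite ler_pM ?powR_ge0//; last by rewrite le_powRl// /S /H; lra.
  rewrite (le_trans (@remainder_scaled _ _ _ _ S al1 ta01 taal _))//.
    by rewrite /S /H; lra.
  rewrite ler_wpM2l// ler_wpM2r ?powR_ge0// le_powRl// /H; lra.
have T2 : `| `|x| `^ al * (`|y + k| `^ be - `|y| `^ be - be * spow (be - 1) y * k)|
    <= Kb * E.
  rewrite mulrC normrM (ger0_norm (powR_ge0 _ _)) -E2 mulrA.
  rewrite ler_pM ?powR_ge0//; last by rewrite le_powRl// /S /H; lra.
  rewrite (le_trans (@remainder_scaled _ _ _ _ S be1 ta01 tabe _))//.
    by rewrite /S /H; lra.
  rewrite ler_wpM2l// ler_wpM2r ?powR_ge0// le_powRl// /H; lra.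
have T3 : `|( `|x + h| `^ al - `|x| `^ al) * (`|y + k| `^ be - `|y| `^ be)|
    <= al * be * E.
  rewrite normrM.
  apply: (@le_trans _ _ ((al * H * S `^ (al - 1)) * (be * H * S `^ (be - 1)))).
    apply: ler_pM => //.
      rewrite (le_trans (powR_increment _ _ al1))// ler_pM ?mulr_ge0 ?powR_ge0//.
        by rewrite ler_wpM2l// /H; lra.
      by rewrite le_powRl// /S /H; lra.
    rewrite (le_trans (powR_increment _ _ be1))// ler_pM ?mulr_ge0 ?powR_ge0//.
      by rewrite ler_wpM2l// /H; lra.
    by rewrite le_powRl// /S /H; lra.
  rewrite [leLHS](_ : _ = al * be * (H * H * (S `^ (al - 1) * S `^ (be - 1)))); last by ring.
  rewrite ler_wpM2l ?mulr_ge0//.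
  have -> : H * H = H `^ (1 + ta) * H `^ (1 - ta).
    rewrite -pos_powRD; last by lra.
    by rewrite -expr2 -powR_mulrn//; congr (_ `^ _); ring.
  rewrite -mulrA /E ler_wpM2l ?powR_ge0//.
  rewrite (@le_trans _ _ (S `^ (1 - ta) * (S `^ (al - 1) * S `^ (be - 1))))//.
    by rewrite ler_wpM2r ?mulr_ge0 ?powR_ge0// le_powRl// subr_ge0.
  rewrite -pos_powRD; last by lra.
  rewrite -pos_powRD; last by lra.
  by rewrite le_eqVlt; apply/orP; left; apply/eqP; congr (_ `^ _); ring.
rewrite [X in `|X|](_ : _ =
   (`|x + h| `^ al - `|x| `^ al - al * spow (al - 1) x * h) * `|y| `^ be +
   `|x| `^ al * (`|y + k| `^ be - `|y| `^ be - be * spow (be - 1) y * k) +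
   (`|x + h| `^ al - `|x| `^ al) * (`|y + k| `^ be - `|y| `^ be)); last by ring.
rewrite (le_trans (ler_normD _ _))//.
have := ler_normD ((`|x + h| `^ al - `|x| `^ al - al * spow (al - 1) x * h) * `|y| `^ be)
   (`|x| `^ al * (`|y + k| `^ be - `|y| `^ be - be * spow (be - 1) y * k)).
have : 0 <= (1 + al + be) * E by apply: mulr_ge0 => //; lra.
by rewrite /C; lra.
Qed.

End growth.

(** * Hölder's inequality *)

Section hoelder.
Context d (T : measurableType d) {R : realType}.
Variable nu : {measure set T -> \bar R}.

(** Bounds [a] and [b] in place of the integrals avoid extended real powers.
    If both are positive, integrate Young's inequality for [f / a] and [g / b];
    otherwise use positive bounds and let the product of their powers tend to
    0. *)
Lemma integral_hoelder (D : set T) (f g : T -> R) (t a b : R) :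
  measurable D -> measurable_fun D f -> measurable_fun D g ->
  (forall x, D x -> 0 <= f x) -> (forall x, D x -> 0 <= g x) ->
  0 < t < 1 -> 0 <= a -> 0 <= b ->
  (\int[nu]_(x in D) (f x)%:E <= a%:E)%E ->
  (\int[nu]_(x in D) (g x)%:E <= b%:E)%E ->
  (\int[nu]_(x in D) (f x `^ t * g x `^ (1 - t))%:E
     <= (a `^ t * b `^ (1 - t))%:E)%E.
Proof.
move=> mD mf mg f0 g0 t01 a0 b0 fa gb.
have /andP[t0 t1] := t01.
have s0 : 0 < 1 - t by rewrite subr_gt0.
have pos (A B : R) : 0 < A -> 0 < B -> a <= A -> b <= B ->
    (\int[nu]_(x in D) (f x `^ t * g x `^ (1 - t))%:E
     <= (A `^ t * B `^ (1 - t))%:E)%E.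
  move=> A0 B0 aA bB.
  pose K := A `^ t * B `^ (1 - t).
  have K0 : 0 <= K by rewrite mulr_ge0 ?powR_ge0.
  have mpow (h : T -> R) r : measurable_fun D h -> measurable_fun D (fun x => h x `^ r).
    by move=> mh; apply: (measurableT_comp (measurable_powR r)).
  apply: (@le_trans _ _ (\int[nu]_(x in D) (K * t / A * f x + K * (1 - t) / B * g x)%:E)%E).
    apply: ge0_le_integral => //.
    - by move=> x Dx; rewrite lee_fin mulr_ge0 ?powR_ge0.
    - by apply/measurable_EFinP; apply: measurable_funM; exact: mpow.
    - apply/measurable_EFinP; apply: measurable_funD; exact: measurable_funM.
    - move=> x Dx; rewrite lee_fin.
      have := @young_powR R (f x / A) (g x / B) t.
      rewrite !divr_ge0 ?f0 ?g0 ?(ltW A0) ?(ltW B0)// => /(_ isT isT t01).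
      move=> /(ler_wpM2l K0).
      rewrite !powRM ?f0 ?g0 ?invr_ge0 ?(ltW A0) ?(ltW B0)//.
      rewrite !powRV//.
      have An0 : A `^ t != 0 by rewrite gt_eqF// powR_gt0.
      have Bn0 : B `^ (1 - t) != 0 by rewrite gt_eqF// powR_gt0.
      set u := f x `^ t; set v := g x `^ _.
      rewrite [X in X <= _ -> _](_ : _ = u * v); last by rewrite /K; field; rewrite ?An0 ?Bn0.
      by move=> /le_trans; apply; rewrite le_eqVlt; apply/orP; left; apply/eqP; ring.
  have c1 : 0 <= K * t / A by rewrite divr_ge0 ?(ltW A0)// mulr_ge0// ltW.
  have c2 : 0 <= K * (1 - t) / B by rewrite divr_ge0 ?(ltW B0)// mulr_ge0// ltW.
  under eq_integral do rewrite EFinD !EFinM.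
  have mf' : measurable_fun D (EFin \o f) by exact/measurable_EFinP.
  have mg' : measurable_fun D (EFin \o g) by exact/measurable_EFinP.
  rewrite ge0_integralD//.
  - rewrite !ge0_integralZl_EFin//.
    apply: (@le_trans _ _ ((K * t / A)%:E * A%:E + (K * (1 - t) / B)%:E * B%:E)%E).
      apply: leeD; apply: lee_wpmul2l; rewrite ?lee_fin//.
        by rewrite (le_trans fa)// lee_fin.
      by rewrite (le_trans gb)// lee_fin.
    rewrite -!EFinM -EFinD lee_fin !divfK ?gt_eqF//.
    by rewrite /K; lra.
  - by move=> x Dx; rewrite -EFinM lee_fin mulr_ge0// f0.
  - exact: measurable_funeM.
  - by move=> x Dx; rewrite -EFinM lee_fin mulr_ge0// g0.
  - exact: measurable_funeM.
(* If [a] or [b] is 0, a bound [A] is chosen so that the right-hand side is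
   any given [e > 0]. *)
have small (B s e : R) : 0 < B -> 0 < s -> 0 < e ->
    exists2 A, 0 < A & A `^ s * B = e.
  move=> B0 s_0 e0; exists ((e / B) `^ s^-1); first by rewrite powR_gt0 ?divr_gt0.
  rewrite -powRrM mulVf ?gt_eqF// powRr1 ?divfK ?gt_eqF//.
  by rewrite divr_ge0 ?ltW.
have [az|an0] := eqVneq a 0.
  rewrite az powR0 ?gt_eqF// mul0r; apply/lee_addgt0Pr => e e0; rewrite add0e.
  have [|A A0 <-] := small ((b + 1) `^ (1 - t)) t e _ t0 e0.
    by rewrite powR_gt0// ltr_wpDl.
  apply: pos => //; first by rewrite ltr_wpDl.
  - by rewrite az ltW.
  - by rewrite lerDl.
have [bz|bn0] := eqVneq b 0.
  rewrite bz [X in _ * X]powR0 ?gt_eqF// mulr0.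
  apply/lee_addgt0Pr => e e0; rewrite add0e.
  have [|A A0 <-] := small ((a + 1) `^ t) (1 - t) e _ s0 e0.
    by rewrite powR_gt0// ltr_wpDl.
  rewrite mulrC; apply: pos => //; first by rewrite ltr_wpDl.
  - by rewrite lerDl.
  - by rewrite bz ltW.
by apply: pos => //; rewrite lt_def ?an0 ?bn0.
Qed.

End hoelder.

(** * Topology, measurability and iterated integrals on R^n *)

Section rV_topology.
Context {R : realType}.

Lemma rV_coord_le n (x : 'rV[R]_n) i : `|x 0 i| <= `|x|.
Proof.
rewrite [leRHS]/Num.norm /= mx_normrE; apply/bigmax_geP; right => /=.
by exists (ord0, i).
Qed.

Lemma rV_norm_le n (x : 'rV[R]_n) e : 0 <= e -> (forall i, `|x 0 i| <= e) ->
  `|x| <= e.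
Proof.
move=> e0 xe; rewrite [leLHS]/Num.norm /= mx_normrE; apply/bigmax_leP => /=.
by split => // -[i j] _ /=; rewrite ord1.
Qed.

(** An open set is the union of the cubes that it contains, among those with
    a rational centre and a radius [1 / (m + 1)]. *)
Lemma open_rV_measurable n (U : set 'rV[R]_n) : open U -> measurable U.
Proof.
move=> oU.
pose box (qm : 'rV[rat]_n * nat) : set 'rV[R]_n :=
  \bigcap_(i in [set: 'I_n])
    ((fun x : 'rV[R]_n => x 0 i) @^-1` ball (ratr (qm.1 0 i) : R) (qm.2.+1%:R^-1)).
have mbox qm : measurable (box qm).
  apply: fin_bigcap_measurable => // i _; rewrite -[X in measurable X]setTI.
  by apply: measurable_rV_coord => //; exact: measurable_ball.
pose F k := if unpickle k is Some qm then
  (if `[< box qm `<=` U >] then box qm else set0) else set0.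
suff -> : U = \bigcup_k F k.
  apply: bigcupT_measurable => k; rewrite /F; case: unpickle => // qm.
  by case: ifP.
apply/seteqP; split => [x Ux|x [k _]]; last first.
  by rewrite /F; case: unpickle => // qm; case: asboolP => // + bx; apply.
have /nbhs_ballP[e /= e0 xeU] : nbhs x U by exact: open_nbhs_nbhs.
have [m me] : exists m : nat, m.+1%:R^-1 < e / 2.
  exists (Num.truncn (e / 2)^-1).
  by rewrite invf_plt ?posrE ?divr_gt0// truncnS_gt.
have m0 : 0 < m.+1%:R^-1 :> R by [].
have /choice[q xq] : forall i : 'I_n, exists q : rat,
    ball (ratr q : R) (m.+1%:R^-1) (x 0 i).
  move=> i; have [|q] := @rat_in_itvoo R (x 0 i - m.+1%:R^-1) (x 0 i + m.+1%:R^-1).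
    by rewrite ltrD2l gt0_cp.
  rewrite in_itv/= => /andP[q1 q2]; exists q; rewrite /ball/=.
  by rewrite ltr_norml ltrBlDl q2 ltrBrDl q1.
pose qm := (\row_i q i : 'rV[rat]_n, m).
exists (pickle qm) => //; rewrite /F pickleK.
have bxU : box qm `<=` U.
  move=> y yq; apply: xeU; split => // i j; rewrite ord1.
  have := yq j I; have := xq j; rewrite /box/= mxE /ball/= => a b.
  rewrite (splitr e) -(subrKA (ratr (q j))) (le_lt_trans (ler_normD _ _))//.
  by apply: ltrD; [rewrite distrC|]; apply: lt_trans me.
case: asboolP => // _ i _; rewrite /= mxE; exact: xq.
Qed.

Lemma continuous_rV_measurable n (f : 'rV[R]_n -> R) : continuous f ->
  measurable_fun setT f.
Proof.
move=> /continuousP cf; apply: (measurability _ (RGenOpens.measurableE R)).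
move=> _ [_ [a [b ->] <-]]; rewrite setTI; apply: open_rV_measurable.
by apply: cf; exact: interval_open.
Qed.

Lemma continuous_rVP n (T : topologicalType) (f : T -> 'rV[R]_n) :
  (forall i, continuous (fun t => f t 0 i)) -> continuous f.
Proof.
move=> cf t; apply/cvg_ballP => e e0.
suff : \forall s \near t, forall i, ball (f t 0 i) e (f s 0 i).
  by apply: filterS => s H; split => // i j; rewrite ord1.
apply: filter_forall => i.
by move/cvg_ballP : (cf i t); exact.
Qed.

Lemma rV_coord_continuous n (i : 'I_n) : continuous (fun x : 'rV[R]_n => x 0 i).
Proof. exact: coord_continuous. Qed.

Lemma continuous_rV_consr n (t : R) : continuous (fun y : 'rV[R]_n => rV_cons (t, y)).
Proof.
apply: continuous_rVP => i.
under eq_fun do rewrite rV_consE.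
by case: unliftP => [j _|_]; [exact: rV_coord_continuous|exact: cst_continuous].
Qed.

Lemma continuous_rV_consl n (y : 'rV[R]_n) : continuous (fun t : R => rV_cons (t, y)).
Proof.
apply: continuous_rVP => i.
under eq_fun do rewrite rV_consE /=.
by case: unliftP => [j _|_] t; [exact: cst_continuous|exact: cvg_id].
Qed.

Lemma measurable_cube n (M : R) : measurable [set x : 'rV[R]_n | forall i, `[- M, M]%classic (x 0 i)].
Proof.
rewrite [X in measurable X](_ : _ = \bigcap_(i in [set: 'I_n])
    ((fun x : 'rV[R]_n => x 0 i) @^-1` `[- M, M])).
  apply: fin_bigcap_measurable => // i _; rewrite -[X in measurable X]setTI.
  exact: measurable_rV_coord.
by apply/seteqP; split => x/= H i; [move=> _|]; exact: H.
Qed.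

Definition bounded_support n (f : 'rV[R]_n -> R) :=
  exists M : R, forall x, f x != 0 -> `|x| <= M.

Lemma continuous_bounded_support n (f : 'rV[R]_n -> R) :
  continuous f -> bounded_support f -> exists K, forall x, `|f x| <= K.
Proof.
move=> cf [M fM].
have cK : compact [set x : 'rV[R]_n | forall i, `[- M, M]%classic (x ord0 i)].
  by apply: (@rV_compact _ _ (fun=> `[- M, M]%classic)) => _; exact: segment_compact.
have := continuous_compact (continuous_subspaceT cf) cK.
move=> /compact_bounded [K [_ HK]].
exists (Num.max 0 (K + 1)) => x; have [->|fx] := eqVneq (f x) 0.
  by rewrite normr0 le_max lexx.
rewrite le_max; apply/orP; right; apply: (HK (K + 1)); first by rewrite ltrDl.
exists x => //= i.
by rewrite in_itv/= -ler_norml (le_trans (rV_coord_le x i))// fM.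
Qed.

Lemma integrable_bounded_support n (f : 'rV[R]_n -> R) :
  continuous f -> bounded_support f ->
  (lebesgue_rV n).-integrable setT (EFin \o f).
Proof.
move=> cf bf; have [M fM] := bf; have [K fK] := continuous_bounded_support cf bf.
pose B := [set x : 'rV[R]_n | forall i, `[- M, M]%classic (x 0 i)].
have mB : measurable B by exact: measurable_cube.
have mf := continuous_rV_measurable cf.
have -> : f = f \_ B.
  apply/funext => x; rewrite patchE; case: ifPn => // /negP xB.
  apply/eqP; apply: contra_notT xB => fx; apply/mem_set => i.
  by rewrite /= in_itv/= -ler_norml (le_trans (rV_coord_le x i))// fM.
rewrite -restrict_EFin; apply: (integrable_mkcond _ mB).1.
apply: measurable_bounded_integrable => //.
- have boxE := @lebesgue_rV_box R n (fun=> `[- M, M]%classic) (fun=> measurable_itv _).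
  suff : (\prod_(i < n) lebesgue_measure `[(- M)%R, M]%classic < +oo)%E by rewrite -boxE.
  rewrite ltey_eq; apply/orP; left; apply: (big_ind (fun z : \bar R => z \is a fin_num)) => // [x y|i _].
    exact: fin_numM.
  by rewrite lebesgue_measure_itv/=; case: ifP.
- exact: measurable_funS mf.
- exists K; split; first exact: num_real.
  by move=> L KL x _ /=; rewrite (le_trans (fK x))// ltW.
Qed.

End rV_topology.

Section slices.
Context {R : realType}.

Let prodm n : {measure set (measurableTypeR R * 'rV[R]_n)%type -> \bar R} :=
  (@lebesgue_measure R \x lebesgue_rV n)%E.

(** The Lebesgue measure of the line lives on [measurableTypeR R], whose
    sigma-algebra is the one that product measures see. *)
Lemma measurable_rV_cons_leb n :
  @measurable_fun _ _ (measurableTypeR R * 'rV[R]_n)%type _ setT (@rV_cons R n).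
Proof. exact: measurable_rV_cons. Qed.

Lemma ge0_integral_prod n (f : 'rV[R]_n.+1 -> \bar R) :
  measurable_fun setT f -> (forall x, (0 <= f x)%E) ->
  (\int[lebesgue_rV n.+1]_x f x = \int[prodm n]_p f (rV_cons p))%E.
Proof.
move=> mf f0.
have := @ge0_integral_pushforward _ _ _ _ _ _ (@measurable_rV_cons_leb n)
  (prodm n) _ _ measurableT mf (fun x _ => f0 x).
by rewrite preimage_setT.
Qed.

Lemma ge0_integral_rV n (f : 'rV[R]_n.+1 -> \bar R) :
  measurable_fun setT f -> (forall x, (0 <= f x)%E) ->
  (\int[lebesgue_rV n.+1]_x f x =
   \int[lebesgue_measure]_t \int[lebesgue_rV n]_y f (rV_cons (t, y)))%E.
Proof.
move=> mf f0; rewrite ge0_integral_prod// /prodm.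
apply: (@fubini_tonelli1 _ _ _ _ _ (@lebesgue_measure R) (lebesgue_rV n)
  (fun p => f (rV_cons p))) => //.
by apply: (measurableT_comp mf); exact: measurable_rV_cons_leb.
Qed.

Lemma ge0_integral_rV_swap n (f : 'rV[R]_n.+1 -> \bar R) :
  measurable_fun setT f -> (forall x, (0 <= f x)%E) ->
  (\int[lebesgue_rV n.+1]_x f x =
   \int[lebesgue_rV n]_y \int[lebesgue_measure]_t f (rV_cons (t, y)))%E.
Proof.
move=> mf f0; rewrite ge0_integral_prod// /prodm.
apply: (@fubini_tonelli2 _ _ _ _ _ (@lebesgue_measure R) (lebesgue_rV n)
  (fun p => f (rV_cons p))) => //.
by apply: (measurableT_comp mf); exact: measurable_rV_cons_leb.
Qed.

Lemma integrable_rV_cons n (f : 'rV[R]_n.+1 -> \bar R) :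
  (lebesgue_rV n.+1).-integrable setT f ->
  (prodm n).-integrable setT (fun p => f (rV_cons p)).
Proof.
move=> /integrableP[mf fi]; apply/integrableP; split.
  by apply: (measurableT_comp mf); exact: measurable_rV_cons_leb.
by move: fi; rewrite ge0_integral_prod//; exact: measurableT_comp.
Qed.

Lemma integral_rV n (f : 'rV[R]_n.+1 -> \bar R) :
  (lebesgue_rV n.+1).-integrable setT f ->
  (\int[lebesgue_rV n.+1]_x f x =
   \int[lebesgue_measure]_t \int[lebesgue_rV n]_y f (rV_cons (t, y)))%E.
Proof.
move=> fi; have mf := measurable_int _ fi; have pf := integrable_rV_cons fi.
rewrite (integral12_prod_meas1 pf).
have := @integral_pushforward _ _ _ _ _ _ (@measurable_rV_cons_leb n)
  (prodm n) setT f mf pf measurableT.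
by rewrite preimage_setT.
Qed.

Lemma integral_rV_swap n (f : 'rV[R]_n.+1 -> \bar R) :
  (lebesgue_rV n.+1).-integrable setT f ->
  (\int[lebesgue_rV n.+1]_x f x =
   \int[lebesgue_rV n]_y \int[lebesgue_measure]_t f (rV_cons (t, y)))%E.
Proof. by move=> fi; rewrite integral_rV// (Fubini (integrable_rV_cons fi)). Qed.

End slices.

(** * Continuously differentiable functions with bounded support *)

Section line.
Context {R : realType}.
Local Notation leb := (@lebesgue_measure R).
Variables (g : R -> R) (M : R).
Hypothesis dg : forall t, derivable g t 1.
Hypothesis cg : continuous (derive1 g).
Hypothesis gM : forall t, g t != 0 -> `|t| <= M.

(* [g] vanishes at [- L] and [L]; the absolute value makes [L] positive for
   every [M]. *)
Let L : R := `|M| + 1.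

Let ML : M < L. Proof. by rewrite (le_lt_trans (ler_norm M))// ltrDl. Qed.

Let L0 : 0 < L. Proof. by rewrite ltr_wpDl. Qed.

Let g0 t : L <= `|t| -> g t = 0.
Proof.
move=> Lt; apply/eqP; apply: contraTT ML => /gM tM.
by rewrite -leNgt (le_trans Lt).
Qed.

Let ctg : continuous g.
Proof. by move=> t; apply: differentiable_continuous; apply/derivable1_diffP. Qed.

Let dg0 t : ~ `[- L, L]%classic t -> derive1 g t = 0.
Proof.
rewrite /= in_itv/= -ler_norml => /negP; rewrite -ltNge => Lt.
rewrite derive1E (@near_eq_derive _ _ _ g (cst 0)) ?derive_cst//.
have : \forall s \near t, L < `|s|.
  exact: (@cvgr_gt _ _ _ _ _ `|t| (@norm_continuous _ _ t) _ Lt).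
by apply: filterS => s Ls; rewrite g0// ltW.
Qed.

Let FTC a b : a < b -> (\int[leb]_(t in `[a, b]) (derive1 g t)%:E = (g b - g a)%:E)%E.
Proof.
move=> ab; have cw : {within `[a, b], continuous (derive1 g)}.
  exact: continuous_subspaceT.
have dw : derivable_oo_LRcontinuous g a b.
  split; first by move=> x _; exact: dg.
  + by apply: cvg_at_right_filter; exact: ctg.
  + by apply: cvg_at_left_filter; exact: ctg.
exact: (continuous_FTC2 ab cw dw).
Qed.

Let mg : measurable_fun setT (fun t => (derive1 g t)%:E).
Proof.
apply/measurable_EFinP; exact: continuous_measurable_fun.
Qed.

Lemma line_integral_derive : (\int[leb]_t (derive1 g t)%:E = 0)%E.
Proof.
have -> : (fun t => (derive1 g t)%:E) = (fun t => (derive1 g t)%:E) \_ `[- L, L].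
  apply/funext => t; rewrite patchE; case: ifPn => // /negP tL.
  by rewrite dg0// => /mem_set.
rewrite -integral_mkcond FTC; last by rewrite gtrN.
by rewrite !g0 ?subrr// ?normrN ler_norm.
Qed.

Lemma line_derive_integrable : leb.-integrable setT (fun t => (derive1 g t)%:E).
Proof.
have -> : (fun t => (derive1 g t)%:E) = (fun t => (derive1 g t)%:E) \_ `[- L, L].
  apply/funext => t; rewrite patchE; case: ifPn => // /negP tL.
  by rewrite dg0// => /mem_set.
apply/(integrable_mkcond _ _).1 => //.
apply: continuous_compact_integrable; first exact: segment_compact.
exact: continuous_subspaceT.
Qed.

(** [g t] is the integral of the derivative from [- L], where [g] vanishes,
    to [t]. *)
Lemma line_norm_le t : (`|g t|%:E <= \int[leb]_s `|derive1 g s|%:E)%E.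
Proof.
have [tL|Lt] := ltP `|t| L; last first.
  by rewrite g0// normr0 integral_ge0.
have Nt : - L < t by move: tL; rewrite ltr_norml => /andP[].
have -> : g t = g t - g (- L) by rewrite [g (- L)]g0 ?subr0// normrN ler_norm.
rewrite -abse_EFin -FTC//.
apply: (@le_trans _ _ (\int[leb]_(s in `[(- L)%R, t]) `|derive1 g s|%:E)%E).
  apply: (le_trans (le_abse_integral _ _ _)) => //.
  exact: measurable_funTS.
apply: ge0_subset_integral => //.
by apply/measurable_EFinP; apply: measurableT_comp => //; exact: continuous_measurable_fun.
Qed.

End line.

Section c1c.
Context {R : realType}.
Local Notation leb := (@lebesgue_measure R).

Lemma delta_addE n (h : R) (k : 'I_n) (x : 'rV[R]_n) i :
  (h *: delta_mx 0 k + x) 0 i = h * (i == k)%:R + x 0 i.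
Proof. by rewrite !mxE eqxx. Qed.

Lemma rV_cons_addr n (t h : R) (y : 'rV[R]_n) j :
  rV_cons (t, h *: delta_mx 0 j + y) =
  h *: delta_mx 0 (lift ord0 j) + rV_cons (t, y).
Proof.
apply/rowP => i; rewrite delta_addE !rV_consE /=; case: unliftP => [k ->|->].
  by rewrite delta_addE (inj_eq (@lift_inj _ ord0)).
by rewrite (negPf (neq_lift _ _)) mulr0 add0r.
Qed.

Lemma rV_cons_addl n (t h : R) (y : 'rV[R]_n) :
  rV_cons (h + t, y) = h *: delta_mx 0 ord0 + rV_cons (t, y).
Proof.
apply/rowP => i; rewrite delta_addE !rV_consE /=; case: unliftP => [k ->|->].
  by rewrite [lift _ _ == _]eq_sym (negPf (neq_lift _ _)) mulr0 add0r.
by rewrite eqxx mulr1.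
Qed.

Definition slice n (f : 'rV[R]_n.+1 -> R) t y := f (rV_cons (t, y)).

Lemma quotient_slice n (f : 'rV[R]_n.+1 -> R) t y j :
  (fun h : R => h^-1 *: (slice f t (h *: delta_mx 0 j + y) - slice f t y)) =
  (fun h : R => h^-1 *: (f (h *: delta_mx 0 (lift ord0 j) + rV_cons (t, y)) -
     f (rV_cons (t, y)))).
Proof. by apply/funext => h; rewrite /slice rV_cons_addr. Qed.

Lemma partial_slice n (f : 'rV[R]_n.+1 -> R) t j :
  partial j (slice f t) = slice (partial (lift ord0 j) f) t.
Proof.
apply/funext => y; rewrite /slice /partial /derive.
by have /= -> := quotient_slice f t y j.
Qed.

Lemma quotient_line n (f : 'rV[R]_n.+1 -> R) t y :
  (fun h : R => h^-1 *: (slice f (h *: 1 + t) y - slice f t y)) =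
  (fun h : R => h^-1 *: (f (h *: delta_mx 0 ord0 + rV_cons (t, y)) -
     f (rV_cons (t, y)))).
Proof. by apply/funext => h; rewrite /slice scaler1 rV_cons_addl. Qed.

Lemma derive1_slice n (f : 'rV[R]_n.+1 -> R) y :
  derive1 (fun t => slice f t y) = (fun t => slice (partial ord0 f) t y).
Proof.
apply/funext => t; rewrite derive1E /slice /partial /derive.
by have /= -> := quotient_line f t y.
Qed.

(** Regularity in a single direction: this is the property that passes both
    to slices and to the lines parallel to the [i]-th axis.  All directions
    together amount to C^1 with bounded support. *)
Definition C1c n (i : 'I_n) (f : 'rV[R]_n -> R) :=
  [/\ continuous f, forall x, derivable f x (delta_mx 0 i),
      continuous (partial i f) & bounded_support f].

Lemma bounded_support_partial n (i : 'I_n) (f : 'rV[R]_n -> R) :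
  bounded_support f -> bounded_support (partial i f).
Proof.
move=> [M fM]; exists M => x; apply: contraNT; rewrite -ltNge => Mx.
apply/eqP; rewrite /partial (@near_eq_derive _ _ _ f (cst 0)) ?derive_cst//.
have : \forall y \near x, M < `|y|.
  exact: (@cvgr_gt _ _ _ _ _ `|x| (@norm_continuous _ _ x) _ Mx).
apply: filterS => y My; apply/eqP; apply: contraTT My => /fM.
by rewrite -leNgt.
Qed.

Lemma rV_cons_norm_ger n (t : R) (y : 'rV[R]_n) : `|y| <= `|rV_cons (t, y)|.
Proof.
apply: rV_norm_le => // j; have := rV_coord_le (rV_cons (t, y)) (lift ord0 j).
by rewrite rV_consE liftK.
Qed.

Lemma rV_cons_norm_gel n (t : R) (y : 'rV[R]_n) : `|t| <= `|rV_cons (t, y)|.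
Proof.
by have := rV_coord_le (rV_cons (t, y)) ord0; rewrite rV_consE unlift_none.
Qed.

Lemma bounded_support_slice n (f : 'rV[R]_n.+1 -> R) t :
  bounded_support f -> bounded_support (slice f t).
Proof.
move=> [M fM]; exists M => y /fM; apply: le_trans; exact: rV_cons_norm_ger.
Qed.

Lemma continuous_slice n (f : 'rV[R]_n.+1 -> R) t :
  continuous f -> continuous (slice f t).
Proof.
move=> cf y; apply: (@continuous_comp _ _ _ (fun y => rV_cons (t, y)) f).
  exact: continuous_rV_consr.
exact: cf.
Qed.

Lemma continuous_line n (f : 'rV[R]_n.+1 -> R) y :
  continuous f -> continuous (fun t => slice f t y).
Proof.
move=> cf t; apply: (@continuous_comp _ _ _ (fun t => rV_cons (t, y)) f).
  exact: continuous_rV_consl.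
exact: cf.
Qed.

Lemma C1c_slice n (f : 'rV[R]_n.+1 -> R) t j :
  C1c (lift ord0 j) f -> C1c j (slice f t).
Proof.
move=> [cf df cdf bf]; split.
- exact: continuous_slice.
- move=> y; have := df (rV_cons (t, y)); rewrite /derivable.
  by have /= -> := quotient_slice f t y j.
- by rewrite partial_slice; exact: continuous_slice.
- exact: bounded_support_slice.
Qed.

Lemma C1c_line n (f : 'rV[R]_n.+1 -> R) y : C1c ord0 f ->
  [/\ forall t, derivable (fun t => slice f t y) t 1,
      continuous (derive1 (fun t => slice f t y)) &
      exists M : R, forall t, slice f t y != 0 -> `|t| <= M].
Proof.
move=> [cf df cdf [M fM]]; split.
- move=> t; have := df (rV_cons (t, y)); rewrite /derivable.
  by have /= -> := quotient_line f t y.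
- by rewrite derive1_slice; exact: continuous_line.
- by exists M => t /fM; apply: le_trans; exact: rV_cons_norm_gel.
Qed.

Lemma C1c_integrable n (i : 'I_n) (f : 'rV[R]_n -> R) : C1c i f ->
  (lebesgue_rV n).-integrable setT (EFin \o partial i f).
Proof.
move=> [_ _ cdf bf]; apply: integrable_bounded_support => //.
exact: bounded_support_partial.
Qed.

(** Integrating first along the [i]-th coordinate, this is the fundamental
    theorem of calculus. *)
Lemma integral_partial n (i : 'I_n) (f : 'rV[R]_n -> R) : C1c i f ->
  (\int[lebesgue_rV n]_x (partial i f x)%:E = 0)%E.
Proof.
elim: n i f => [|n IH] i f; first by case: i.
case: (unliftP ord0 i) => [j ->|->] cf.
  rewrite (integral_rV (C1c_integrable cf)).
  rewrite integral0_eq// => t _.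
  have := IH _ _ (C1c_slice t cf).
  by rewrite partial_slice.
rewrite (integral_rV_swap (C1c_integrable cf)) integral0_eq// => y _.
have [dg cg [M gM]] := C1c_line y cf.
by have := line_integral_derive dg cg gM; rewrite derive1_slice.
Qed.

Definition gradsum n (f : 'rV[R]_n -> R) x := \sum_(i < n) `|partial i f x|.

Lemma measurable_partial n (i : 'I_n) (f : 'rV[R]_n -> R) : C1c i f ->
  measurable_fun setT (partial i f).
Proof. by case=> _ _ cdf _; exact: continuous_rV_measurable. Qed.

Lemma measurable_gradsum n (f : 'rV[R]_n -> R) : (forall i, C1c i f) ->
  measurable_fun setT (gradsum f).
Proof.
move=> cf; rewrite /gradsum; apply: measurable_sum => i.
by apply: measurableT_comp => //; exact: measurable_partial.
Qed.

Lemma gradsum_ge0 n (f : 'rV[R]_n -> R) x : 0 <= gradsum f x.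
Proof. exact: sumr_ge0. Qed.

End c1c.

(** * The Gagliardo-Nirenberg inequality *)

Section gagliardo_nirenberg.
Context {R : realType}.
Local Notation leb := (@lebesgue_measure R).

Lemma measurable_integral_slice n (f : 'rV[R]_n.+1 -> \bar R) :
  measurable_fun setT f -> (forall x, (0 <= f x)%E) ->
  measurable_fun setT (fun t : measurableTypeR R => \int[lebesgue_rV n]_y f (rV_cons (t, y)))%E.
Proof.
move=> mf f0.
apply: (@measurable_fun_fubini_tonelli_F _ _ (measurableTypeR R) _ _ (lebesgue_rV n) (fun p => f (rV_cons p))) => //.
by apply: (measurableT_comp mf); exact: measurable_rV_cons_leb.
Qed.

Lemma measurable_integral_line n (f : 'rV[R]_n.+1 -> \bar R) :
  measurable_fun setT f -> (forall x, (0 <= f x)%E) ->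
  measurable_fun setT (fun y : 'rV[R]_n => \int[leb]_t f (rV_cons (t, y)))%E.
Proof.
move=> mf f0.
apply: (@measurable_fun_fubini_tonelli_G _ _ (measurableTypeR R) _ _ leb (fun p => f (rV_cons p))) => //.
by apply: (measurableT_comp mf); exact: measurable_rV_cons_leb.
Qed.

Lemma measurable_rV_consr n (t : R) :
  measurable_fun setT (fun y : 'rV[R]_n => rV_cons (t, y)).
Proof.
apply: measurable_fun_rVP => i; under eq_fun do rewrite rV_consE /=.
by case: unliftP => [j _|_]; [exact: measurable_rV_coord|exact: measurable_cst].
Qed.

(** The Gagliardo-Nirenberg inequality in dimension [n], with an arbitrary
    weight [g].  This form can be integrated over the parallel slices of a
    function of [n + 1] variables, all with the same weight. *)
Definition gn_property n := forall f : 'rV[R]_n -> R, (forall i, C1c i f) ->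
  forall (g : 'rV[R]_n -> R) (G : R), measurable_fun setT g ->
  (forall y, 0 <= g y) -> 0 <= G ->
  (\int[lebesgue_rV n]_y (g y)%:E <= G%:E ->
   \int[lebesgue_rV n]_y (`|f y| * g y `^ n%:R^-1)%:E <=
   (\int[lebesgue_rV n]_y (gradsum f y)%:E) * (G `^ n%:R^-1)%:E)%E.

Lemma C1c_measurable n (i : 'I_n) (f : 'rV[R]_n -> R) : C1c i f ->
  measurable_fun setT f.
Proof. by case=> cf _ _ _; exact: continuous_rV_measurable. Qed.

(** On the line, [|f|] is at most the integral of [|f'|], and [g] has
    integral at most [G]. *)
Lemma gn_property1 : gn_property 1.
Proof.
move=> f cf g G mg g0 G0 gG.
have mf : measurable_fun setT f := C1c_measurable (cf ord0).
have mgr := measurable_gradsum cf.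
have fT x : (`|f x|%:E <= \int[lebesgue_rV 1]_y (gradsum f y)%:E)%E.
  rewrite ge0_integral_rV_swap; last 2 first.
  - exact/measurable_EFinP.
  - by move=> y; rewrite lee_fin gradsum_ge0.
  rewrite /= integral_dirac//; last first.
    apply: (@measurable_integral_line 0 (fun x => (gradsum f x)%:E)).
      exact/measurable_EFinP.
    by move=> y; rewrite lee_fin gradsum_ge0.
  rewrite diracT mul1e.
  have [dl cl [M fM]] := C1c_line 0 (cf ord0).
  have := line_norm_le dl cl fM (x 0 0).
  rewrite derive1_slice /slice.
  have -> : rV_cons (x 0 0, 0) = x.
    apply/rowP => i; rewrite rV_consE; case: unliftP => [[]//|->].
    by congr (x _ _); apply: val_inj.
  move=> /le_trans; apply; rewrite le_eqVlt; apply/orP; left; apply/eqP.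
  by apply: eq_integral => t _; rewrite /gradsum big_ord1.
rewrite invr1 powRr1//.
have mg' : measurable_fun setT (fun y => (g y)%:E) by exact/measurable_EFinP.
have f0 y : (0 <= `|f y|%:E * (g y)%:E)%E by rewrite -EFinM lee_fin mulr_ge0.
set T := (\int[_]_y (gradsum f y)%:E)%E in fT *.
have T0 : (0 <= T)%E by apply: integral_ge0 => y _; rewrite lee_fin gradsum_ge0.
apply: (@le_trans _ _ (\int[lebesgue_rV 1]_y (T * (g y)%:E))%E).
  apply: ge0_le_integral => //.
  - by move=> y _; rewrite lee_fin mulr_ge0 ?powR_ge0.
  - apply/measurable_EFinP; apply: measurable_funM; first exact: measurableT_comp.
    exact: (measurableT_comp (measurable_powR _) mg).
  - exact: measurable_funeM.
  - by move=> y _; rewrite powRr1// EFinM lee_wpmul2r// lee_fin.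
rewrite ge0_integralZl//; first by rewrite lee_wpmul2l.
by move=> y _; rewrite lee_fin.
Qed.

(** Let [g y] be the integral of [|d_0 f|] on the line [(t, y)], where [t]
    varies.  It bounds [|f|] on this line, so [|f|^(1 + 1/n)] is at most
    [|f| g^(1/n)], and the hypothesis applies to each slice [t = const] with the
    weight [g], whose integral is at most [T]. *)
Lemma gagliardo_nirenberg_step n : (0 < n)%N -> gn_property n ->
  forall f : 'rV[R]_n.+1 -> R, (forall i, C1c i f) -> forall T : R, 0 <= T ->
  (\int[lebesgue_rV n.+1]_x (gradsum f x)%:E <= T%:E ->
   \int[lebesgue_rV n.+1]_x (`|f x| `^ (1 + n%:R^-1))%:E
     <= (T `^ (1 + n%:R^-1))%:E)%E.
Proof.
move=> n0 IH f cf T T0 fT.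
have n0' : 0 < n%:R^-1 :> R by rewrite invr_gt0 ltr0n.
pose h (x : 'rV[R]_n.+1) : \bar R := (`|partial ord0 f x|)%:E.
have mh : measurable_fun setT h.
  by apply/measurable_EFinP; apply: measurableT_comp => //; exact: measurable_partial.
have mgr : measurable_fun setT (fun x => (gradsum f x)%:E).
  by apply/measurable_EFinP; exact: measurable_gradsum.
have gr0 x : (0 <= (gradsum f x)%:E)%E by rewrite lee_fin gradsum_ge0.
have h0 x : (0 <= h x)%E by rewrite lee_fin.
have hfin y : (\int[leb]_t h (rV_cons (t, y)))%E \is a fin_num.
  rewrite ge0_fin_numE; last exact: integral_ge0.
  have [dl cl [M fM]] := C1c_line y (cf ord0).
  have := line_derive_integrable cl fM.
  rewrite derive1_slice => /integrableP[_]; apply: le_lt_trans.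
  by rewrite le_eqVlt; apply/orP; left; apply/eqP; apply: eq_integral.
pose g y : R := fine (\int[leb]_t h (rV_cons (t, y)))%E.
have mg : measurable_fun setT g.
  apply: (measurableT_comp (@fine_measurable R setT measurableT)).
  exact: measurable_integral_line.
have g0 y : 0 <= g y by rewrite fine_ge0// integral_ge0.
have gT : (\int[lebesgue_rV n]_y (g y)%:E <= T%:E)%E.
  apply: le_trans fT.
  under eq_integral do rewrite fineK//.
  rewrite -ge0_integral_rV_swap//; apply: ge0_le_integral => //.
  by move=> x _; rewrite lee_fin /gradsum (bigD1 ord0)//= lerDl sumr_ge0.
have fg t y : `|f (rV_cons (t, y))| <= g y.
  rewrite -lee_fin fineK//.
  have [dl cl [M fM]] := C1c_line y (cf ord0).
  by have := line_norm_le dl cl fM t; rewrite derive1_slice.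
have mpow : measurable_fun setT (fun x => (`|f x| `^ (1 + n%:R^-1))%:E).
  apply/measurable_EFinP.
  apply: (measurableT_comp (measurable_powR _)); apply: measurableT_comp => //.
  exact: C1c_measurable (cf ord0).
rewrite ge0_integral_rV//.
have slice_le t : (\int[lebesgue_rV n]_y (`|f (rV_cons (t, y))| `^ (1 + n%:R^-1))%:E
   <= (\int[lebesgue_rV n]_y (gradsum f (rV_cons (t, y)))%:E) * (T `^ n%:R^-1)%:E)%E.
  have cs i : C1c i (slice f t) by exact: C1c_slice.
  apply: (@le_trans _ _ (\int[lebesgue_rV n]_y (`|slice f t y| * g y `^ n%:R^-1)%:E)%E).
    apply: ge0_le_integral => //.
    - apply/measurable_EFinP; apply: (measurableT_comp (measurable_powR _)).
      apply: measurableT_comp => //; apply: continuous_rV_measurable.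
      by apply: continuous_slice; case: (cf ord0).
    - apply/measurable_EFinP; apply: measurable_funM.
        apply: measurableT_comp => //; apply: continuous_rV_measurable.
        by apply: continuous_slice; case: (cf ord0).
      exact: (measurableT_comp (measurable_powR _) mg).
    - move=> y _; rewrite lee_fin powRD; last by rewrite gt_eqF// addr_gt0.
      rewrite powRr1// ler_wpM2l// le_powRl//; exact: ltW.
  apply: (le_trans (IH _ cs g T mg g0 T0 gT)).
  rewrite lee_wpmul2r ?lee_fin ?powR_ge0//.
  apply: ge0_le_integral => //.
  - by move=> y _; rewrite lee_fin gradsum_ge0.
  - by apply/measurable_EFinP; exact: measurable_gradsum.
  - apply: (measurableT_comp mgr).
    exact: measurable_rV_consr.
  - move=> y _; rewrite lee_fin /gradsum big_ord_recl /=.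
    rewrite -[leLHS]add0r lerD//; apply: ler_sum => j _.
    by rewrite partial_slice.
apply: (@le_trans _ _ (\int[leb]_t ((\int[lebesgue_rV n]_y (gradsum f (rV_cons (t, y)))%:E) * (T `^ n%:R^-1)%:E))%E).
  apply: ge0_le_integral => //.
  - by move=> t _; apply: integral_ge0 => y _; rewrite lee_fin powR_ge0.
  - apply: (@measurable_integral_slice n (fun x => (`|f x| `^ (1 + n%:R^-1))%:E)) => //.
  - apply: emeasurable_funM => //.
    exact: (@measurable_integral_slice n (fun x => (gradsum f x)%:E)).
rewrite ge0_integralZr//.
- rewrite -(@ge0_integral_rV R n (fun x => (gradsum f x)%:E))//.
  rewrite powRD; last by rewrite gt_eqF// addr_gt0.
  by rewrite powRr1// EFinM lee_wpmul2r ?lee_fin ?powR_ge0.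
- exact: (@measurable_integral_slice n (fun x => (gradsum f x)%:E)).
- by move=> t _; apply: integral_ge0.
- by rewrite lee_fin powR_ge0.
Qed.

(** By Hölder's inequality with the exponents [(n + 1) / n] and [n + 1], the
    weighted inequality follows from the unweighted one for
    [|f|^(1 + 1/n)]. *)
Lemma gn_propertyS n : (0 < n)%N -> gn_property n -> gn_property n.+1.
Proof.
move=> n0 IH f cf g G mg g0 G0 gG.
have mgr : measurable_fun setT (gradsum f) by exact: measurable_gradsum.
have n0' : 0 < n%:R :> R by rewrite ltr0n.
have Tfin : (\int[lebesgue_rV n.+1]_y (gradsum f y)%:E)%E \is a fin_num.
  rewrite ge0_fin_numE; last by apply: integral_ge0 => y _; rewrite lee_fin gradsum_ge0.
  have : (lebesgue_rV n.+1).-integrable setT (fun x => \sum_(i < n.+1) (`|partial i f x|)%:E)%E.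
    apply: integrable_sum => // i _.
    exact: (integrable_abse (C1c_integrable (cf i))).
  move=> /integrableP[_]; apply: le_lt_trans.
  rewrite le_eqVlt; apply/orP; left; apply/eqP; apply: eq_integral => x _.
  by rewrite sumEFin abse_EFin ger0_norm ?gradsum_ge0.
set TT := (\int[_]_y (gradsum f y)%:E)%E in Tfin *.
pose T := fine TT.
have TE : TT = T%:E by rewrite fineK.
have T0 : 0 <= T.
  by rewrite fine_ge0// integral_ge0// => y _; rewrite lee_fin gradsum_ge0.
have := gagliardo_nirenberg_step n0 IH cf T0.
rewrite -/TT TE lexx => /(_ isT) GN.
have mf := C1c_measurable (cf ord0).
have n1 : n.+1%:R = n%:R + 1 :> R by rewrite -natr1.
have t01 : 0 < (n%:R / n.+1%:R : R) < 1.
  by rewrite divr_gt0 ?ltr0n//= ltr_pdivrMr ?ltr0n// mul1r ltr_nat.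
have tE : 1 - n%:R / n.+1%:R = n.+1%:R^-1 :> R.
  by rewrite n1; field; rewrite gt_eqF// addr_gt0.
have mpow : measurable_fun setT (fun x => `|f x| `^ (1 + n%:R^-1)).
  by apply: (measurableT_comp (measurable_powR _)); exact: measurableT_comp.
have := integral_hoelder measurableT mpow mg (fun x _ => powR_ge0 _ _)
  (fun x _ => g0 x) t01 (powR_ge0 _ _) G0 GN gG.
have pE : (1 + n%:R^-1) * (n%:R / n.+1%:R) = 1 :> R.
  by rewrite n1; field; rewrite !gt_eqF// addr_gt0.
rewrite tE; under eq_integral do rewrite -powRrM pE powRr1//.
by rewrite -powRrM pE powRr1// EFinM.
Qed.

Theorem gagliardo_nirenberg n (f : 'rV[R]_n.+2 -> R) (T : R) :
  (forall i, C1c i f) -> 0 <= T ->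
  (\int[lebesgue_rV n.+2]_x (gradsum f x)%:E <= T%:E ->
   \int[lebesgue_rV n.+2]_x (`|f x| `^ (1 + n.+1%:R^-1))%:E
     <= (T `^ (1 + n.+1%:R^-1))%:E)%E.
Proof.
move=> cf T0; apply: gagliardo_nirenberg_step => //.
elim: n {f cf} => [|n IH]; first exact: gn_property1.
exact: gn_propertyS.
Qed.

End gagliardo_nirenberg.

(** * Calculus of powers *)

Section calculus.
Context {R : realType}.

Lemma continuous_mul (T : topologicalType) (f g : T -> R) :
  continuous f -> continuous g -> continuous (fun x => f x * g x).
Proof. by move=> cf cg x; exact: (cvgM (cf x) (cg x)). Qed.

Lemma continuous_add (T : topologicalType) (f g : T -> R) :
  continuous f -> continuous g -> continuous (fun x => f x + g x).
Proof. by move=> cf cg x; exact: (cvgD (cf x) (cg x)). Qed.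

Lemma continuous_opp (T : topologicalType) (f : T -> R) :
  continuous f -> continuous (fun x => - f x).
Proof. by move=> cf x; exact: (cvgN (cf x)). Qed.

Lemma continuous_inv (T : topologicalType) (f : T -> R) :
  (forall x, f x != 0) -> continuous f -> continuous (fun x => (f x)^-1).
Proof. by move=> f0 cf x; exact: (cvgV (f0 x) (cf x)). Qed.

Lemma cvg_of_linear_bound (f : R -> R) (l K : R) :
  (forall h, `|h| <= 1 -> h != 0 -> `|f h - l| <= K * `|h|) ->
  f x @[x --> 0^'] --> l.
Proof.
move=> fK; apply/cvgrPdist_le => e e0;
have K1 : 0 < `|K| + 1 by rewrite ltr_wpDl.
near=> h.
have h0 : h != 0 by near: h; exact: nbhs_dnbhs_neq.
have h1 : `|h| <= 1.
  near: h; apply: dnbhs0_le; exact: ltr01.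
have h2 : `|h| <= e / (`|K| + 1).
  by near: h; apply: dnbhs0_le; rewrite divr_gt0.
rewrite distrC (le_trans (fK h h1 h0))//.
rewrite ler_pdivlMr// in h2.
rewrite (le_trans _ h2)// mulrC ler_wpM2l// (le_trans (ler_norm _))// lerDl//.
Unshelve. all: by end_near. Qed.

(** For [2 <= a] the remainder of [|x|^a] is quadratic in the increment. *)
Lemma is_derive_norm_powR (a x : R) : 2 <= a ->
  is_derive x 1 (fun x => `|x| `^ a) (a * spow (a - 1) x).
Proof.
move=> a2; have a1 : 1 < a by rewrite (lt_le_trans _ a2)// ltr1n.
have t01 : 0 < (1 : R) <= 1 by rewrite ltr01 lexx.
have ta : 1 <= a - 1 by lra.
suff cv : (h^-1 *: ((`|h *: 1 + x| `^ a) - `|x| `^ a)) @[h --> 0^']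
    --> a * spow (a - 1) x.
  by apply: DeriveDef; [apply/cvg_ex; exists (a * spow (a - 1) x)|exact: cvg_lim cv].
apply: (@cvg_of_linear_bound _ _ (2 * a * a * (2 * `|x| + 1) `^ (a - 1 - 1))).
move=> h h1 h0; rewrite [h *: 1]mulr1 addrC [_ *: _]/(_ * _) /= [h + x]addrC.
have -> : - (a * spow (a - 1) x) + h^-1 * (`|x + h| `^ a - `|x| `^ a) =
    h^-1 * (`|x + h| `^ a - `|x| `^ a - a * spow (a - 1) x * h) by field.
rewrite normrM normfV ler_pdivrMl ?normr_gt0//.
apply: (le_trans (powR_remainder x h a1 t01 ta)).
have -> : `|h| `^ (1 + 1) = `|h| * `|h|.
  by rewrite (_ : 1 + 1 = 2%:R)// powR_mulrn// expr2.
have H : (2 * `|x| + `|h|) `^ (a - 1 - 1) <= (2 * `|x| + 1) `^ (a - 1 - 1).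
  by rewrite le_powRl ?subr_ge0 ?addr_ge0 ?mulr_ge0// lerD2l.
have c0 : 0 <= 2 * a * a * (`|h| * `|h|) by rewrite !mulr_ge0//; lra.
have := ler_wpM2l c0 H; lra.
Qed.

Lemma continuous_norm_powR (a : R) : 2 <= a -> continuous (fun x : R => `|x| `^ a).
Proof.
move=> a2 x; apply: differentiable_continuous; apply/derivable1_diffP.
by have [] := is_derive_norm_powR x a2.
Qed.

Lemma continuous_spow (a : R) : 1 <= a -> continuous (@spow R a).
Proof.
move=> a1 x; have t01 : 0 < (1 : R) <= 1 by rewrite ltr01 lexx.
pose K := 2 * (a + 1) * (2 * `|x| + 1) `^ (a - 1).
have K0 : 0 <= K by rewrite !mulr_ge0 ?powR_ge0//; lra.
apply/cvgrPdist_le => e e0; apply/nbhs_ballP.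
exists (Num.min 1 (e / (K + 1))) => /=.
  by rewrite lt_min ltr01 divr_gt0// ltr_wpDl.
move=> y; rewrite /ball /= lt_min => /andP[y1 y2].
have := spow_hoelder x y t01 a1; rewrite powRr1//.
have H : (`|x| + `|y|) `^ (a - 1) <= (2 * `|x| + 1) `^ (a - 1).
  rewrite le_powRl ?subr_ge0 ?addr_ge0//.
  have := ler_normB x (x - y); rewrite subKr; lra.
have c0 : 0 <= 2 * (a + 1) * `|x - y| by rewrite !mulr_ge0//; lra.
have H1 := ler_wpM2l c0 H.
move=> /le_trans; apply; apply: (le_trans H1).
have -> : 2 * (a + 1) * `|x - y| * (2 * `|x| + 1) `^ (a - 1) = K * `|x - y|.
  by rewrite /K; ring.
apply: (@le_trans _ _ ((K + 1) * `|x - y|)); first by rewrite ler_wpM2r// lerDl.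
by rewrite mulrC -ler_pdivlMr ?ltW// ltr_wpDl.
Qed.

Lemma derive_lineE (V : normedModType R) (f : V -> R) (x v : V) :
  'D_v f x = derive1 (fun h : R => f (h *: v + x)) 0.
Proof.
rewrite /derive /derive1; congr (lim _).
have -> // : (fun h : R => h^-1 *: ((f \o shift x) (h *: v) - f x)) =
  (fun h : R => h^-1 *: (f ((h + 0) *: v + x) - f (0 *: v + x))).
by apply/funext => h /=; rewrite addr0 scale0r add0r.
Qed.

(** The chain rule on the line through [x] of direction [v]; [u] may fail to
    be differentiable at [x] in the other directions. *)
Lemma is_derive_comp_real (V : normedModType R) (u : V -> R) (phi : R -> R)
    (x v : V) (du dphi : R) :
  is_derive x v u du -> is_derive (u x) 1 phi dphi ->
  is_derive x v (phi \o u) (dphi * du).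
Proof.
move=> [dvu <-] [dvp <-].
pose k (h : R) := u (h *: v + x).
have k0 : k 0 = u x by rewrite /k scale0r add0r.
have dk : derivable k 0 1 := (derivable1P u x v).1 dvu.
have dp : derivable phi (k 0) 1 := eq_ind_r (fun y => derivable phi y 1) dvp k0.
have dpk : derivable (phi \o k) 0 1.
  by apply/derivable1_diffP; apply: differentiable_comp; exact/derivable1_diffP.
apply: DeriveDef; first exact: (derivable1P (phi \o u) x v).2 dpk.
rewrite derive_lineE; apply: (etrans (derive1_comp dk dp)).
by rewrite k0 derive1E (derive_lineE u).
Qed.

Lemma is_derive_coord n (x v : 'rV[R]_n) j :
  is_derive x v (fun x : 'rV[R]_n => x 0 j) (v 0 j).
Proof.
suff cv : (fun h : R => h^-1 *: ((h *: v + x) 0 j - x 0 j)) h @[h --> 0^'] --> v 0 j.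
  by apply: DeriveDef; [apply/cvg_ex; exists (v 0 j)|exact: cvg_lim cv].
apply: (@cvg_of_linear_bound _ _ 0) => h _ h0.
by rewrite !mxE addrK scalerA mulVf// scale1r subrr normr0 mul0r.
Qed.

End calculus.

(** * The Sobolev inequality *)

Section sobolev.
Context {R : realType}.

Definition gradsq n (f : 'rV[R]_n -> R) x := \sum_(i < n) partial i f x ^+ 2.

Lemma gradsq_ge0 n (f : 'rV[R]_n -> R) x : 0 <= gradsq f x.
Proof. by apply: sumr_ge0 => i _; exact: sqr_ge0. Qed.

Lemma measurable_gradsq n (f : 'rV[R]_n -> R) : (forall i, C1c i f) ->
  measurable_fun setT (gradsq f).
Proof.
move=> cf; rewrite /gradsq; apply: measurable_sum => i.
by apply: measurable_funX; exact: measurable_partial.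
Qed.

Lemma C1c_gradsq_integrable n (f : 'rV[R]_n -> R) : (forall i, C1c i f) ->
  (lebesgue_rV n).-integrable setT (EFin \o gradsq f).
Proof.
move=> cf.
rewrite (_ : EFin \o _ = (fun x => \sum_(i < n) (partial i f x ^+ 2)%:E)%E); last first.
  by apply/funext => x; rewrite /= sumEFin.
apply: integrable_sum => // i _.
have [_ _ cdf bf] := cf i; have [K fK] := bounded_support_partial i bf.
apply: (@integrable_bounded_support _ _ (fun x => partial i f x ^+ 2)).
  exact: continuous_mul.
exists K => x; have [->|fx _] := eqVneq (partial i f x) 0; last exact: fK.
by rewrite expr0n/= eqxx.
Qed.

Lemma partial_norm_powR n (f : 'rV[R]_n -> R) (a : R) i x : 2 <= a -> C1c i f ->
  is_derive x (delta_mx 0 i) (fun x => `|f x| `^ a)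
    (a * spow (a - 1) (f x) * partial i f x).
Proof.
move=> a2 [_ df _ _].
apply: (@is_derive_comp_real _ _ f (fun x => `|x| `^ a)).
  exact: derivableP.
exact: is_derive_norm_powR.
Qed.

Lemma C1c_norm_powR n (f : 'rV[R]_n -> R) (a : R) i : 2 <= a -> C1c i f ->
  C1c i (fun x => `|f x| `^ a).
Proof.
move=> a2 cif; have [cf df cdf [M fM]] := cif; split.
- move=> x; apply: (@continuous_comp _ _ _ f (fun x => `|x| `^ a)).
    exact: cf.
  exact: continuous_norm_powR.
- by move=> x; have [] := partial_norm_powR x a2 cif.
- rewrite (_ : partial i _ = (fun x => a * spow (a - 1) (f x) * partial i f x)).
    apply: continuous_mul; last exact: cdf.
    apply: continuous_mul; first by move=> x; exact: cst_continuous.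
    move=> x; apply: (@continuous_comp _ _ _ f (@spow R (a - 1))); first exact: cf.
    by apply: continuous_spow; lra.
  by apply/funext => x; have [_] := partial_norm_powR x a2 cif.
- exists M => x; have [->|fx _] := eqVneq (f x) 0; last exact: fM.
  by rewrite normr0 powR0 ?eqxx// gt_eqF// (lt_le_trans _ a2).
Qed.

Lemma gradsum_norm_powR n (f : 'rV[R]_n -> R) (a : R) x :
  2 <= a -> (forall i, C1c i f) ->
  gradsum (fun x => `|f x| `^ a) x = a * `|f x| `^ (a - 1) * gradsum f x.
Proof.
move=> a2 cf; rewrite /gradsum mulr_sumr; apply: eq_bigr => i _.
rewrite {1}/partial; have [_ ->] := partial_norm_powR x a2 (cf i).
rewrite normrM (normrM a) ger0_norm ?normr_spow//; lra.
Qed.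

Lemma gradsum_le n (f : 'rV[R]_n -> R) x :
  gradsum f x <= n%:R * gradsq f x `^ 2^-1.
Proof.
rewrite mulr_natl -[X in _ *+ X](card_ord n) -sumr_const.
apply: ler_sum => i _; rewrite powR12_sqrt ?gradsq_ge0//.
rewrite -sqrtr_sqr ler_wsqrtr// /gradsq (bigD1 i)//= lerDl sumr_ge0//.
by move=> j _; exact: sqr_ge0.
Qed.

(** The Gagliardo-Nirenberg inequality is applied to the power [|f|^a] for
    which the right-hand side, after the Cauchy-Schwarz inequality, contains
    a smaller power of the integral on the left-hand side. *)
Theorem sobolev n : exists2 C : R, 0 <= C &
  forall (f : 'rV[R]_n.+3 -> R) (D : R), (forall i, C1c i f) -> 0 <= D ->
  (\int[lebesgue_rV n.+3]_x (gradsq f x)%:E <= D%:E ->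
   \int[lebesgue_rV n.+3]_x (`|f x| `^ crit_exp n.+3 0)%:E
   <= (C * D `^ (crit_exp n.+3 0 / 2))%:E)%E.
Proof.
(* The dimension is [k + 1], and [a = 2 k / (k - 1)] satisfies both
   [a (1 + 1/k) = p] and [a - 1 = p / 2]. *)
pose k : R := n.+2%:R; have k1 : 1 < k by rewrite /k ltr1n.
have k0 : 0 < k by rewrite (lt_trans _ k1).
have km0 : k - 1 != 0 by rewrite gt_eqF// subr_gt0.
pose a := 2 * k / (k - 1); pose p : R := crit_exp n.+3 0.
have NE : n.+3%:R = k + 1 :> R by rewrite /k -natr1.
have pE : p = 2 * (k + 1) / (k - 1).
  by rewrite /p /crit_exp NE subr0; congr (_ / _); ring.
have a2 : 2 <= a.
  by rewrite /a ler_pdivlMr ?subr_gt0// ler_pM2l//; lra.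
have p0 : 0 < p by rewrite pE divr_gt0 ?subr_gt0// mulr_gt0// addr_gt0.
have p2 : 2 <= p by rewrite pE ler_pdivlMr ?subr_gt0// ler_pM2l//; lra.
have ap : a * (1 + k^-1) = p by rewrite pE /a; field; rewrite ?km0 ?gt_eqF.
have a1p : a - 1 = p * 2^-1 by rewrite pE /a; field.
pose r := 1 + k^-1; have r0 : 0 < r by rewrite addr_gt0// invr_gt0.
pose K := (a * n.+3%:R) `^ r.
pose s := (2 * k) / (k - 1).
exists (K `^ s); first exact: powR_ge0.
move=> f D cf D0 fD.
have a0 : 0 <= a by lra.
have mf := C1c_measurable (cf ord0).
have mfp : measurable_fun setT (fun x => `|f x| `^ p).
  by apply: (measurableT_comp (measurable_powR _)); exact: measurableT_comp.
(* The integral must be finite, since a power of it is cancelled below. *)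
have Xfin : (\int[lebesgue_rV n.+3]_x (`|f x| `^ p)%:E)%E \is a fin_num.
  rewrite ge0_fin_numE ?integral_ge0//.
  have [cfp _ _ bfp] := C1c_norm_powR p2 (cf ord0).
  have /integrableP[_] := integrable_bounded_support cfp bfp.
  apply: le_lt_trans; rewrite le_eqVlt; apply/orP; left; apply/eqP.
  by apply: eq_integral => x _; rewrite /= (ger0_norm (powR_ge0 _ _)).
set XX := (\int[_]_x (`|f x| `^ p)%:E)%E in Xfin *.
pose X := fine XX; have XE : XX = X%:E by rewrite fineK.
have X0 : 0 <= X by rewrite fine_ge0// integral_ge0.
pose T := a * n.+3%:R * (X `^ 2^-1 * D `^ 2^-1).
have T0 : 0 <= T by apply: mulr_ge0; apply: mulr_ge0 => //; exact: powR_ge0.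
have half : 0 < (2^-1 : R) < 1 by rewrite invr_gt0 ltr0n invf_lt1 ?ltr1n ?ltr0n.
have HT : (\int[lebesgue_rV n.+3]_x (gradsum (fun x => `|f x| `^ a) x)%:E <= T%:E)%E.
  have mg := measurable_gradsq cf.
  have XX1 : (XX <= X%:E)%E by rewrite XE.
  have := integral_hoelder measurableT mfp mg (fun x _ => powR_ge0 _ _)
   (fun x _ => gradsq_ge0 f x) half X0 D0 XX1 fD.
  rewrite (_ : 1 - 2^-1 = 2^-1); last by lra.
  move=> H; rewrite /T EFinM.
  have c0 : (0 <= (a * n.+3%:R)%:E)%E by rewrite lee_fin mulr_ge0.
  apply: (le_trans _ (lee_wpmul2l c0 H)).
  have mH : measurable_fun setT (fun x => (`|f x| `^ p) `^ 2^-1 * gradsq f x `^ 2^-1).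
    by apply: measurable_funM; apply: (measurableT_comp (measurable_powR _)).
  rewrite -ge0_integralZl_EFin//; last 2 first.
  - by move=> x _; rewrite lee_fin mulr_ge0 ?powR_ge0.
  - exact/measurable_EFinP.
  have cw i := C1c_norm_powR a2 (cf i).
  apply: ge0_le_integral => //.
  - by move=> x _; rewrite lee_fin gradsum_ge0.
  - by apply/measurable_EFinP; exact: measurable_gradsum.
  - by apply/measurable_EFinP; exact: measurable_funM.
  - move=> x _; rewrite -EFinM lee_fin gradsum_norm_powR// -powRrM -a1p.
    have c1 : 0 <= a * `|f x| `^ (a - 1) by rewrite mulr_ge0 ?powR_ge0.
    by have := ler_wpM2l c1 (gradsum_le f x); lra.
have := gagliardo_nirenberg (fun i => C1c_norm_powR a2 (cf i)) T0 HT.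
rewrite -/k (_ : (\int[_]_x _)%E = XX); last first.
  by apply: eq_integral => x _; rewrite (ger0_norm (powR_ge0 _ _)) -powRrM ap.
rewrite XE !lee_fin -/r -/p => XT.
have [->|Xn0] := eqVneq X 0; first by rewrite mulr_ge0 ?powR_ge0.
have Xp : 0 < X by rewrite lt_def Xn0.
(* The inequality [X <= T^r] reads [X <= K X^(r/2) D^(r/2)], with
   [1 - r / 2 = 1 / s]. *)
have TE : T `^ r = K * (X `^ (r / 2) * D `^ (r / 2)).
  have aN0 : 0 <= a * n.+3%:R by rewrite mulr_ge0.
  have XD0 : 0 <= X `^ 2^-1 * D `^ 2^-1 by rewrite mulr_ge0 ?powR_ge0.
  rewrite /T (powRM _ aN0 XD0) (powRM _ (powR_ge0 _ _) (powR_ge0 _ _)).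
  by rewrite -!powRrM (mulrC _ r).
rewrite TE in XT.
have : X `^ (1 - r / 2) <= K * D `^ (r / 2).
  rewrite -(ler_pM2l (powR_gt0 (r / 2) Xp)) -gt0_powRD//.
  by rewrite subrKC powRr1// mulrCA.
have s0 : 0 <= s by rewrite divr_ge0 ?subr_ge0 ?mulr_ge0// ltW.
have r2 : 1 - r / 2 = s^-1 by rewrite /r /s; field; rewrite ?km0 ?gt_eqF.
move=> /(le_powRl s0 (powR_ge0 _ _)); rewrite -powRrM r2 mulVf ?powRr1//.
  rewrite powRM ?powR_ge0// -powRrM; congr (_ <= _ * _ `^ _).
  by rewrite pE /r /s; field; rewrite ?km0 ?gt_eqF.
by rewrite gt_eqF// divr_gt0 ?subr_gt0 ?mulr_gt0.
Qed.

End sobolev.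

(** * The Hardy inequality *)

Section hardy.
Context {R : realType}.

Lemma dotv_ge0 n (x : 'rV[R]_n) : 0 <= dotv x x.
Proof. by apply: sumr_ge0 => i _; rewrite -expr2 sqr_ge0. Qed.

Lemma dotv_delta n (h : R) (i : 'I_n) (x : 'rV[R]_n) :
  dotv (h *: delta_mx 0 i + x) (h *: delta_mx 0 i + x) =
  h ^+ 2 + 2 * h * x 0 i + dotv x x.
Proof.
rewrite /dotv (bigD1 i)//= [in RHS](bigD1 i)//= delta_addE eqxx mulr1 addrA.
congr (_ + _); first by ring.
by apply: eq_bigr => j /negPf ji; rewrite delta_addE ji mulr0 add0r.
Qed.

Lemma is_derive_dotv n (x : 'rV[R]_n) i :
  is_derive x (delta_mx 0 i) (fun x => dotv x x) (2 * x 0 i).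
Proof.
suff cv : (fun h : R => h^-1 *: (dotv (h *: delta_mx 0 i + x) (h *: delta_mx 0 i + x)
    - dotv x x)) h @[h --> 0^'] --> 2 * x 0 i.
  by apply: DeriveDef; [apply/cvg_ex; exists (2 * x 0 i)|exact: cvg_lim cv].
apply: (@cvg_of_linear_bound _ _ _ 1) => h _ h0.
rewrite dotv_delta addrK mul1r.
rewrite (_ : _ - _ = h)//.
have -> : h^-1 *: (h ^+ 2 + 2 * h * x 0 i : R^o) = h^-1 * (h ^+ 2 + 2 * h * x 0 i) by [].
by field.
Qed.

Lemma continuous_sumr (T : topologicalType) (I : Type) (r : seq I) (f : I -> T -> R) :
  (forall i, continuous (f i)) -> continuous (fun x => \sum_(i <- r) f i x).
Proof.
move=> cf; elim: r => [|i r IH].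
  by under eq_fun do rewrite big_nil; move=> x; exact: cst_continuous.
by under eq_fun do rewrite big_cons; exact: continuous_add.
Qed.

Lemma continuous_dotv n : continuous (fun x : 'rV[R]_n => dotv x x).
Proof.
by apply: continuous_sumr => i; apply: continuous_mul; exact: rV_coord_continuous.
Qed.

Let rho n (dl : R) (x : 'rV[R]_n) := dotv x x + dl.

Let hfield n dl (f : 'rV[R]_n -> R) i (x : 'rV[R]_n) :=
  (f x * f x) * (x 0 i * (rho dl x)^-1).

Let dhfield n dl (f : 'rV[R]_n -> R) i (x : 'rV[R]_n) :=
  2 * f x * partial i f x * x 0 i / rho dl x + f x ^+ 2 / rho dl x -
  2 * (f x ^+ 2 * x 0 i ^+ 2) / rho dl x ^+ 2.

Let rho_gt0 n dl (x : 'rV[R]_n) : 0 < dl -> 0 < rho dl x.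
Proof. by move=> dl0; rewrite ltr_wpDl// dotv_ge0. Qed.

Let is_derive_hfield n dl (f : 'rV[R]_n -> R) i x : 0 < dl -> C1c i f ->
  is_derive x (delta_mx 0 i) (hfield dl f i) (dhfield dl f i x).
Proof.
move=> dl0 [_ df _ _]; have r0 : rho dl x != 0 by rewrite gt_eqF// rho_gt0.
have Df : is_derive x (delta_mx 0 i) f (partial i f x) by exact: derivableP.
have Dx := is_derive_coord x (delta_mx 0 i) i.
have Dr : is_derive x (delta_mx 0 i) (rho dl) (2 * x 0 i + 0).
  exact: (is_deriveD (is_derive_dotv x i) (is_derive_cst dl x _)).
have Dri : is_derive x (delta_mx 0 i) (fun x => (rho dl x)^-1)
    (- (rho dl x) ^- 2 *: (2 * x 0 i + 0)).
  have [dr <-] := Dr; apply: DeriveDef; first exact: derivableV.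
  exact: deriveV.
have [D1 D2] := is_deriveM (is_deriveM Df Df) (is_deriveM Dx Dri).
apply: DeriveDef; first exact: D1.
apply: (etrans D2); rewrite /dhfield mxE !eqxx.
have scE (a b : R) : a *: (b : R^o) = a * b by [].
have mE (g h : 'rV[R]_n -> R) y : (g * h) y = g y * h y by [].
rewrite !mE.
rewrite !scE /=; move: r0; set r := rho dl x => r0.
by field.
Qed.

Let continuous_rho_inv n dl : 0 < dl ->
  continuous (fun x : 'rV[R]_n => (rho dl x)^-1).
Proof.
move=> dl0; apply: continuous_inv.
  by move=> x; rewrite gt_eqF// rho_gt0.
apply: continuous_add; first exact: continuous_dotv.
by move=> x; exact: cst_continuous.
Qed.

Let C1c_hfield n dl (f : 'rV[R]_n -> R) i : 0 < dl -> C1c i f ->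
  C1c i (hfield dl f i).
Proof.
move=> dl0 cif; have [cf df cdf [M fM]] := cif.
have cr := continuous_rho_inv (n := n) dl0.
have cx := @rV_coord_continuous R n i.
have cc (r : R) : continuous (fun _ : 'rV[R]_n => r) by move=> x; exact: cst_continuous.
split.
- by apply: continuous_mul; apply: continuous_mul.
- by move=> x; have [] := is_derive_hfield x dl0 cif.
- rewrite (_ : partial i _ = dhfield dl f i).
    rewrite /dhfield; apply: continuous_add; first apply: continuous_add.
    + by apply: continuous_mul => //; do 3 apply: continuous_mul => //.
    + by apply: continuous_mul => //; exact: continuous_mul.
    + apply: continuous_opp.
      rewrite (_ : (fun _ => _) = (fun x => 2 * ((f x * f x) * (x 0 i * x 0 i)) *
          ((rho dl x)^-1 * (rho dl x)^-1))).
        by apply: continuous_mul; apply: continuous_mul => //;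
          apply: continuous_mul; apply: continuous_mul.
      by apply/funext => x; rewrite !expr2 invfM.
  by apply/funext => x; have [_] := is_derive_hfield x dl0 cif.
- exists M => x; have [fx0|fx _] := eqVneq (f x) 0; last exact: fM.
  by rewrite /hfield fx0 !mul0r eqxx.
Qed.

(** Integrate the divergence of the field [f^2 x / (|x|^2 + dl)], and absorb
    the term containing the gradient of [f] by completing the square.  The
    parameter [dl] removes the singularity at the origin, and the constant does
    not depend on it. *)
Theorem hardy n (f : 'rV[R]_n.+3 -> R) (dl D : R) : (forall i, C1c i f) ->
  0 < dl -> 0 <= D ->
  (\int[lebesgue_rV n.+3]_x (gradsq f x)%:E <= D%:E ->
   \int[lebesgue_rV n.+3]_x (f x ^+ 2 / (dotv x x + dl))%:E <= (4 * D)%:E)%E.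
Proof.
move=> cf dl0 D0 fD; pose c : R := n.+1%:R / 2.
have c0 : 0 < c by rewrite divr_gt0.
have c1 : 2^-1 <= c by rewrite /c ler_pdivlMr// mulVf// ler1n.
(* The integral of the divergence controls [c] times the left-hand side, up
   to [D / c]; this gives the constant [c^-2], which is at most 4. *)
have NE : n.+3%:R = 2 * c + 2 :> R.
  by rewrite /c -addn2 natrD; field.
have [cf0 _ _ [M fM]] := cf ord0.
have L0 x : 0 <= f x ^+ 2 / rho dl x by rewrite divr_ge0 ?sqr_ge0// ltW// rho_gt0.
have iL : (lebesgue_rV n.+3).-integrable setT (EFin \o (fun x => f x ^+ 2 / rho dl x)).
  apply: integrable_bounded_support.
    by apply: continuous_mul; [exact: continuous_mul|exact: continuous_rho_inv].
  exists M => x; have [->|fx _] := eqVneq (f x) 0; last exact: fM.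
  by rewrite expr0n/= mul0r eqxx.
have iGs := C1c_gradsq_integrable cf.
have iH i := C1c_integrable (C1c_hfield dl0 (cf i)).
have iHs : (lebesgue_rV n.+3).-integrable setT
    (fun x => \sum_(i < n.+3) (partial i (hfield dl f i) x)%:E)%E.
  by apply: integrable_sum => // i _; exact: iH.
have H0 : (\int[lebesgue_rV n.+3]_x \sum_(i < n.+3) (partial i (hfield dl f i) x)%:E = 0)%E.
  rewrite integral_sum//.
  by rewrite big1// => i _; exact: (integral_partial (C1c_hfield dl0 (cf i))).
have pw x : c * (f x ^+ 2 / rho dl x) <=
    \sum_(i < n.+3) partial i (hfield dl f i) x + c^-1 * gradsq f x.
  have r0 := rho_gt0 x dl0; set r := rho dl x in r0 *.
  have rn0 : r != 0 by rewrite gt_eqF.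
  apply: (@le_trans _ _ (\sum_(i < n.+3)
      (f x ^+ 2 / r - (2 + c) * (f x ^+ 2 / r ^+ 2) * x 0 i ^+ 2))).
    rewrite sumrB sumr_const card_ord -mulr_sumr -[_ *+ n.+3]mulr_natl NE.
    have -> : \sum_(i < n.+3) x 0 i ^+ 2 = dotv x x by [].
    have dr : dotv x x <= r by rewrite /r /rho lerDl ltW.
    have h0 : 0 <= (2 + c) * (f x ^+ 2 / r ^+ 2).
      by apply: mulr_ge0; [lra|rewrite divr_ge0 ?sqr_ge0].
    have := ler_wpM2l h0 dr.
    have -> : (2 + c) * (f x ^+ 2 / r ^+ 2) * r = (2 + c) * (f x ^+ 2 / r) by field.
    lra.
  rewrite /gradsq mulr_sumr -big_split/=; apply: ler_sum => i _.
  have -> : partial i (hfield dl f i) x = dhfield dl f i x.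
    by have [_] := is_derive_hfield x dl0 (cf i).
  rewrite /dhfield -/r -subr_ge0.
  have -> : 2 * f x * partial i f x * x 0 i / r + f x ^+ 2 / r -
     2 * (f x ^+ 2 * x 0 i ^+ 2) / r ^+ 2 + c^-1 * partial i f x ^+ 2 -
     (f x ^+ 2 / r - (2 + c) * (f x ^+ 2 / r ^+ 2) * x 0 i ^+ 2) =
     (partial i f x + c * f x * x 0 i / r) ^+ 2 / c.
    by field; rewrite rn0 gt_eqF.
  by rewrite divr_ge0 ?sqr_ge0// ltW.
have main : (c%:E * \int[lebesgue_rV n.+3]_x (f x ^+ 2 / rho dl x)%:E <= (c^-1)%:E * D%:E)%E.
  have iGs' : (lebesgue_rV n.+3).-integrable setT (fun x => (c^-1)%:E * (gradsq f x)%:E)%E.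
    exact: integrableZl.
  rewrite -integralZl//.
  apply: (@le_trans _ _ (\int[lebesgue_rV n.+3]_x
     (\sum_(i < n.+3) (partial i (hfield dl f i) x)%:E + (c^-1)%:E * (gradsq f x)%:E))%E).
    apply: le_integral => //.
    - exact: (integrableZl measurableT c iL).
    - exact: integrableD.
    - by move=> x _; rewrite sumEFin -!EFinM -EFinD lee_fin; exact: pw.
  rewrite integralD// H0 add0e integralZl//.
  by rewrite lee_wpmul2l// lee_fin invr_ge0 ltW.
have Lfin : (\int[lebesgue_rV n.+3]_x (f x ^+ 2 / rho dl x)%:E)%E \is a fin_num.
  exact: (integrable_fin_num measurableT iL).
rewrite -/(rho dl _); move: main; rewrite -/(rho dl _) -(fineK Lfin) -!EFinM !lee_fin.
set I := fine _ => main.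
have : c * (c * I) <= D.
  by have := ler_wpM2l (ltW c0) main; rewrite [c * (c^-1 * D)]mulrA mulfV ?gt_eqF// mul1r.
have I0 : 0 <= I by apply: fine_ge0; apply: integral_ge0 => x _; rewrite lee_fin.
have cc : 4^-1 <= c * c.
  have := ler_pM (ltW _) (ltW _) c1 c1; rewrite invr_gt0 ltr0n => /(_ isT isT).
  by apply: le_trans; rewrite le_eqVlt; apply/orP; left; apply/eqP; field.
have := ler_wpM2r I0 cc; lra.
Qed.

End hardy.

(** * The Hardy-Sobolev inequality for functions with bounded support *)

Section hardy_sobolev_C1c.
Context {R : realType}.

Lemma crit_expE n (s : R) : crit_exp n.+3 s = 2 * (n.+3%:R - s) / n.+1%:R.
Proof.
by rewrite /crit_exp; congr (_ / _); rewrite -[n.+3]addn2 natrD addrK.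
Qed.

Lemma crit_exp_ge2 n (s : R) : s <= 2 -> 2 <= crit_exp n.+3 s.
Proof.
move=> s2; rewrite crit_expE ler_pdivlMr ?ltr0n// ler_pM2l//.
by rewrite lerBrDr -lerBrDl -[n.+3]addn2 natrD addrAC subrr add0r.
Qed.

(** Interpolation between the inequalities of Sobolev and Hardy, which are
    the cases [s = 0] and [s = 2]. *)
Lemma hardy_sobolev_C1c n (s : R) : 0 < s < 2 -> exists2 C : R, 0 <= C &
  forall (f : 'rV[R]_n.+3 -> R) (dl D : R), (forall i, C1c i f) -> 0 < dl -> 0 <= D ->
  (\int[lebesgue_rV n.+3]_x (gradsq f x)%:E <= D%:E ->
   \int[lebesgue_rV n.+3]_x
      (`|f x| `^ crit_exp n.+3 s / (dotv x x + dl) `^ (s / 2))%:E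
   <= (C * D `^ (crit_exp n.+3 s / 2))%:E)%E.
Proof.
move=> /andP[s0 s2]; have [C0 C00 sob] := @sobolev R n.
(* The integrand is [F^t G^(1 - t)], where [F] and [G] are the integrands of
   the inequalities of Hardy and Sobolev. *)
pose t := s / 2; have t01 : 0 < t < 1.
  by rewrite divr_gt0//= ltr_pdivrMr// mul1r.
have /andP[t0 t1] := t01.
exists (4 `^ t * C0 `^ (1 - t)); first by rewrite mulr_ge0 ?powR_ge0.
move=> f dl D cf dl0 D0 fD.
set q := crit_exp n.+3 0 in sob.
set p := crit_exp n.+3 s.
have pE : p = 2 * t + q * (1 - t).
  rewrite /p /q !crit_expE /t -[n.+3]addn2 natrD.
  have : n.+1%:R != 0 :> R by rewrite pnatr_eq0.
  by move: (n.+1%:R : R) => k k0; field.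
have q2 : 2 <= q by rewrite crit_exp_ge2.
have p2 : 2 <= p by rewrite crit_exp_ge2// ltW.
have r0 x : 0 < dotv x x + dl :> R by rewrite ltr_wpDl// dotv_ge0.
have mf := C1c_measurable (cf ord0).
have mr : measurable_fun setT (fun x : 'rV[R]_n.+3 => (dotv x x + dl)^-1).
  apply: continuous_rV_measurable; apply: continuous_inv.
    by move=> x; rewrite gt_eqF.
  apply: continuous_add; first exact: continuous_dotv.
  by move=> x; exact: cst_continuous.
have mF : measurable_fun setT (fun x => f x ^+ 2 / (dotv x x + dl)).
  by apply: measurable_funM => //; exact: measurable_funX.
have mG : measurable_fun setT (fun x => `|f x| `^ q).
  by apply: (measurableT_comp (measurable_powR _)); exact: measurableT_comp.
have F0 x : 0 <= f x ^+ 2 / (dotv x x + dl) by rewrite divr_ge0 ?sqr_ge0 ?ltW.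
have D4 : 0 <= 4 * D by rewrite mulr_ge0.
have Dq : 0 <= C0 * D `^ (q / 2) by rewrite mulr_ge0 ?powR_ge0.
have := integral_hoelder measurableT mF mG (fun x _ => F0 x)
  (fun x _ => powR_ge0 _ _) t01 D4 Dq (hardy cf dl0 D0 fD) (sob f D cf D0 fD).
congr (_ <= _)%E.
  apply: eq_integral => x _; congr EFin.
  have ri0 : 0 <= (dotv x x + dl)^-1 by rewrite invr_ge0 ltW.
  rewrite (powRM _ (sqr_ge0 _) ri0).
  rewrite powRV ?r0//.
  rewrite mulrAC; congr (_ / _).
  have -> : f x ^+ 2 = `|f x| `^ 2 by rewrite powR_mulrn// real_normK ?num_real.
  rewrite -!powRrM.
  by rewrite -pos_powRD -?pE// (lt_le_trans _ p2).
congr EFin; have four : 0 <= 4 :> R by [].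
rewrite (powRM _ four D0) (powRM _ C00 (powR_ge0 _ _)) -powRrM mulrACA.
congr (_ * _).
have [->|Dn0] := eqVneq D 0.
  have pn : p / 2 != 0 by rewrite lt0r_neq0// divr_gt0// (lt_le_trans _ p2).
  by rewrite (powR0 (lt0r_neq0 t0)) mul0r powR0.
have Dp : 0 < D by rewrite lt_def Dn0.
by rewrite -gt0_powRD//; congr (_ `^ _); rewrite pE; field.
Qed.

End hardy_sobolev_C1c.

(** * Test functions and their completion *)

Section measurable_on.
Context {R : realType} d (T : measurableType d) (D : set T) (mD : measurable D).

Lemma measurable_patchR (f : T -> R) : measurable_fun D f -> measurable_fun setT (f \_ D).
Proof. by move=> mf; apply/(measurable_restrictT _ mD). Qed.

Lemma measurable_fun_rV_on n (f : T -> 'rV[R]_n) :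
  (forall i, measurable_fun D (fun t => f t 0 i)) -> measurable_fun D f.
Proof.
move=> mf; pose g t := \row_i ((fun t => f t 0 i) \_ D) t.
apply: (@eq_measurable_fun _ _ _ _ D g) => [t /[!inE] Dt|].
  by apply/rowP => i; rewrite mxE patchE mem_set.
apply: measurable_funTS; apply: measurable_fun_rVP => i.
under eq_fun do rewrite mxE.
exact: measurable_patchR.
Qed.

Lemma measurable_fun_pair_on (f : R * R -> R) (u v : T -> R) :
  measurable_fun setT f -> measurable_fun D u -> measurable_fun D v ->
  measurable_fun D (fun t => f (u t, v t)).
Proof.
move=> mf mu mv.
apply: (@eq_measurable_fun _ _ _ _ D (fun t => f ((u \_ D) t, (v \_ D) t))).
  by move=> t /[!inE] Dt; rewrite !patchE mem_set.
apply: measurable_funTS; apply: measurableT_comp => //.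
by apply: measurable_fun_pair; exact: measurable_patchR.
Qed.

End measurable_on.

Section test_functions.
Context {R : realType} {N : nat}.
Variable Omega : set 'rV[R]_N.
Implicit Types (phi : 'rV[R]_N -> R).

Lemma enorm_sq (x : 'rV[R]_N) : enorm x ^+ 2 = dotv x x.
Proof. by rewrite sqr_sqrtr// dotv_ge0. Qed.

Lemma gradsqE phi x : gradsq phi x = dotv (egrad phi x) (egrad phi x).
Proof. by apply: eq_bigr => i _; rewrite !mxE expr2. Qed.

Lemma test_C1c phi : test_function Omega phi -> forall i, C1c i phi.
Proof.
move=> [sm cpt _] i; have [c0 d0] := sm [::]; have [c1 _] := sm [:: i].
split => //; have [M [_ HM]] := compact_bounded cpt.
exists (M + 1) => x fx; apply: (HM (M + 1)); first by rewrite ltrDl.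
exact: subset_closure.
Qed.

Lemma test_partial_out phi i x : test_function Omega phi -> ~ Omega x ->
  partial i phi x = 0.
Proof.
move=> [_ _ sub] Ox.
rewrite /partial (@near_eq_derive _ _ _ phi (cst 0)) ?derive_cst//.
have : nbhs x (~` closure [set x | phi x != 0]).
  apply: open_nbhs_nbhs; split; last by move=> /sub.
  by apply: closed_openC; exact: closed_closure.
apply: filterS => y Sy; apply/eqP; apply: contra_notT Sy => fy.
exact: subset_closure.
Qed.

Lemma test_gradsq_out phi x : test_function Omega phi -> ~ Omega x ->
  gradsq phi x = 0.
Proof.
move=> tp Ox; rewrite /gradsq big1// => i _.
by rewrite (test_partial_out i tp Ox) expr0n.
Qed.

Lemma integral_test_gradsq phi : test_function Omega phi ->
  (\int[lebesgue_rV N]_x (gradsq phi x)%:E =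
   \int[lebesgue_rV N]_(x in Omega) (gradsq phi x)%:E)%E.
Proof.
move=> tp; rewrite [RHS]integral_mkcond; apply: eq_integral => x _.
rewrite patchE; case: ifPn => // /negP Ox.
by rewrite (test_gradsq_out tp)// => /mem_set.
Qed.

Lemma dotv_le_sub (a b : 'rV[R]_N) :
  dotv a a <= 2 * dotv (a - b) (a - b) + 2 * dotv b b.
Proof.
rewrite /dotv !mulr_sumr -big_split/=; apply: ler_sum => i _; rewrite !mxE.
have := sqr_ge0 (a 0 i - 2 * b 0 i); lra.
Qed.

Lemma dotvNN (a : 'rV[R]_N) : dotv (- a) (- a) = dotv a a.
Proof. by apply: eq_bigr => i _; rewrite !mxE mulrNN. Qed.

Hypothesis oOmega : open Omega.

Lemma measurable_open : measurable Omega.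
Proof. exact: open_rV_measurable. Qed.
Let mO := measurable_open.
Hint Resolve mO : core.

Lemma measurable_dotv (f g : 'rV[R]_N -> 'rV[R]_N) :
  measurable_fun Omega f -> measurable_fun Omega g ->
  measurable_fun Omega (fun x => dotv (f x) (g x)).
Proof.
move=> mf mg; apply: measurable_sum => i; apply: measurable_funM.
- exact: (measurableT_comp (measurable_rV_coord i)).
- exact: (measurableT_comp (measurable_rV_coord i)).
Qed.

Lemma measurable_egrad phi : test_function Omega phi ->
  measurable_fun Omega (egrad phi).
Proof.
move=> tp; apply: measurable_funTS; apply: measurable_fun_rVP => i.
under eq_fun do rewrite mxE.
by apply: measurable_partial; exact: test_C1c.
Qed.

Lemma measurable_rV_add (f g : 'rV[R]_N -> 'rV[R]_N) (a : R) :
  measurable_fun Omega f -> measurable_fun Omega g ->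
  measurable_fun Omega (fun x => a *: f x + g x).
Proof.
move=> mf mg.
apply: measurable_fun_rV_on => // i; under eq_fun do rewrite !mxE.
apply: measurable_funD; first apply: measurable_funM => //.
  exact: (measurableT_comp (measurable_rV_coord i) mf).
exact: (measurableT_comp (measurable_rV_coord i) mg).
Qed.

Lemma measurable_dist_egrad phi (u : 'rV[R]_N -> 'rV[R]_N) :
  test_function Omega phi -> measurable_fun Omega u ->
  measurable_fun Omega (fun x => (dotv (egrad phi x - u x) (egrad phi x - u x))%:E).
Proof.
move=> tp mu; have md : measurable_fun Omega (fun x => egrad phi x - u x).
  have := measurable_rV_add (-1) mu (measurable_egrad tp).
  by congr measurable_fun; apply/funext => x; rewrite scaleN1r addrC.
by apply/measurable_EFinP; exact: measurable_dotv.
Qed.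

Lemma D012_seq (w : @D12fun R N) : D012 Omega w ->
  exists phi : nat -> 'rV[R]_N -> R, [/\ forall n, test_function Omega (phi n),
   {ae lebesgue_rV N, forall x, Omega x -> phi n x @[n --> \oo] --> w.1 x} &
   forall e : R, 0 < e -> exists n0, forall n, (n0 <= n)%N ->
    (\int[lebesgue_rV N]_(x in Omega)
      (dotv (egrad (phi n) x - w.2 x) (egrad (phi n) x - w.2 x))%:E <= e%:E)%E].
Proof.
move=> [_ _ [phi [tp ae cv]]]; exists phi; split => // e e0.
have /fine_cvgP[fn cv0] := cv.
have : \forall n \near \oo,
    (\int[lebesgue_rV N]_(x in Omega) (enorm (egrad (phi n) x - w.2 x) ^+ 2)%:E <= e%:E)%E.
  have /cvgrPdist_le/(_ e e0) := cv0.
  apply: filterS2 fn => n fn; rewrite /= sub0r normrN => H.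
  by rewrite -(fineK fn) lee_fin (le_trans (ler_norm _)).
move=> [n0 _ H]; exists n0 => n n0n; have := H n n0n.
by under eq_integral do rewrite enorm_sq.
Qed.

Lemma D012_integrable (w : @D12fun R N) : D012 Omega w ->
  (lebesgue_rV N).-integrable Omega (fun x => (dotv (w.2 x) (w.2 x))%:E).
Proof.
move=> Dw; have [_ mw _] := Dw; have [phi [tp _ cv]] := D012_seq Dw.
have [n0 /(_ n0 (leqnn _)) H] := cv 1 ltr01.
have m2 : measurable_fun Omega (fun x => (dotv (w.2 x) (w.2 x))%:E).
  by apply/measurable_EFinP; exact: measurable_dotv.
have iG : (lebesgue_rV N).-integrable Omega (fun x => (gradsq (phi n0) x)%:E).
  apply: (integrableS measurableT) => //.
  exact: C1c_gradsq_integrable (test_C1c (tp n0)).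
have id : (lebesgue_rV N).-integrable Omega
   (fun x => (dotv (egrad (phi n0) x - w.2 x) (egrad (phi n0) x - w.2 x))%:E).
  apply/integrableP; split; first exact: measurable_dist_egrad.
  apply: (@le_lt_trans _ _ 1%:E); last exact: ltry.
  by under eq_integral do rewrite abse_EFin ger0_norm ?dotv_ge0//.
apply: (@le_integrable _ _ _ _ _ mO _ (fun x =>
   2%:E * (dotv (egrad (phi n0) x - w.2 x) (egrad (phi n0) x - w.2 x))%:E +
   2%:E * (gradsq (phi n0) x)%:E)%E) => //.
  move=> x _; rewrite -!EFinM -EFinD !abse_EFin lee_fin.
  rewrite !ger0_norm ?addr_ge0 ?mulr_ge0 ?dotv_ge0 ?gradsq_ge0//.
  rewrite gradsqE; have := dotv_le_sub (- w.2 x) (- egrad (phi n0) x).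
  by rewrite opprK (dotvNN (w.2 x)) (dotvNN (egrad _ x)) [- w.2 x + _]addrC.
by apply: integrableD => //; exact: integrableZl.
Qed.

Lemma dnorm2E (w : @D12fun R N) : dnorm2 Omega w =
  \int[lebesgue_rV N]_(x in Omega) dotv (w.2 x) (w.2 x).
Proof. by apply: eq_Rintegral => x _; rewrite enorm_sq. Qed.

Lemma dnorm2_EFin (w : @D12fun R N) : D012 Omega w ->
  ((dnorm2 Omega w)%:E = \int[lebesgue_rV N]_(x in Omega) (dotv (w.2 x) (w.2 x))%:E)%E.
Proof.
move=> Dw; rewrite dnorm2E /Rintegral fineK//.
exact: (integrable_fin_num mO (D012_integrable Dw)).
Qed.

Lemma dnorm2_ge0 (w : @D12fun R N) : 0 <= dnorm2 Omega w.
Proof. by apply: Rintegral_ge0 => x _; rewrite sqr_ge0. Qed.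

(** The gradients of the approximating test functions are close to [w.2] in
    square mean; the factor 2 is that of [dotv_le_sub]. *)
Lemma D012_approx (w : @D12fun R N) : D012 Omega w ->
  exists phi : nat -> 'rV[R]_N -> R, [/\ forall n, test_function Omega (phi n),
   {ae lebesgue_rV N, forall x, Omega x -> phi n x @[n --> \oo] --> w.1 x} &
   forall e : R, 0 < e -> exists n0, forall n, (n0 <= n)%N ->
    (\int[lebesgue_rV N]_x (gradsq (phi n) x)%:E <= (2 * dnorm2 Omega w + e)%:E)%E].
Proof.
move=> Dw; have [_ mw _] := Dw; have [phi [tp ae cv]] := D012_seq Dw.
exists phi; split => // e e0; have e20 : 0 < e / 2 by rewrite divr_gt0.
have [n0 H] := cv _ e20; exists n0 => n n0n; have {}H := H n n0n.
rewrite integral_test_gradsq//.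
have m1 := measurable_dist_egrad (tp n) mw.
have m2 : measurable_fun Omega (fun x => (dotv (w.2 x) (w.2 x))%:E).
  by apply/measurable_EFinP; exact: measurable_dotv.
have d0 (x : 'rV[R]_N) : (0 <= (dotv x x)%:E)%E by rewrite lee_fin dotv_ge0.
apply: (@le_trans _ _ (\int[lebesgue_rV N]_(x in Omega)
   (2%:E * (dotv (egrad (phi n) x - w.2 x) (egrad (phi n) x - w.2 x))%:E +
    2%:E * (dotv (w.2 x) (w.2 x))%:E))%E).
  apply: ge0_le_integral => //.
  - by move=> x _; rewrite gradsqE.
  - apply/measurable_EFinP; apply: measurable_funTS; apply: measurable_gradsq.
    exact: test_C1c.
  - by apply: emeasurable_funD; exact: measurable_funeM.
  - move=> x _; rewrite -!EFinM -EFinD lee_fin gradsqE; exact: dotv_le_sub.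
rewrite ge0_integralD//; last 4 first.
- by move=> x _; rewrite mule_ge0.
- exact: measurable_funeM.
- by move=> x _; rewrite mule_ge0.
- exact: measurable_funeM.
rewrite !ge0_integralZl_EFin// -dnorm2_EFin//.
have -> : (2 * dnorm2 Omega w + e)%:E =
    (2%:E * (e / 2)%:E + 2%:E * (dnorm2 Omega w)%:E)%E.
  by rewrite -!EFinM -EFinD; congr EFin; field.
by apply: leeD => //; rewrite lee_wpmul2l.
Qed.

End test_functions.

(** * The Hardy-Sobolev inequality on the completion *)

Section fatou_bound.
Context d (T : measurableType d) {R : realType}.
Variable nu : {measure set T -> \bar R}.

Lemma limn_einf_ge (u : (\bar R)^nat) (l : \bar R) :
  (forall k, (l <= u k)%E) -> (l <= limn_einf u)%E.
Proof.
move=> ul; rewrite limn_einf_lim; apply: lime_ge; first exact: is_cvg_einfs.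
by apply: nearW => n; apply: le_ereal_inf_tmp => _ [k _ <-].
Qed.

Lemma limn_einf_le (u : (\bar R)^nat) (l : \bar R) :
  (forall k, (u k <= l)%E) -> (limn_einf u <= l)%E.
Proof.
move=> ul; rewrite limn_einf_lim; apply: lime_le; first exact: is_cvg_einfs.
apply: nearW => n; apply: le_trans (ul n).
by apply: ereal_inf_lbound; exists n => //=.
Qed.

(** The alternative [f x = 0] is for the points where [f] vanishes by
    convention although the sequence may diverge, such as the origin for a
    quotient by a power of [|x|]. *)
Lemma fatou_bound (D : set T) (g : nat -> T -> R) (f : T -> R) (B : \bar R) :
  measurable D -> (forall k, measurable_fun D (g k)) ->
  (forall k x, 0 <= g k x) -> measurable_fun D f -> (forall x, 0 <= f x) ->
  {ae nu, forall x, D x -> f x = 0 \/ g k x @[k --> \oo] --> f x} ->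
  (forall k, (\int[nu]_(x in D) (g k x)%:E <= B)%E) ->
  (\int[nu]_(x in D) (f x)%:E <= B)%E.
Proof.
move=> mD mg g0 mf f0 ae gB.
have mg' k : measurable_fun D (fun x => (g k x)%:E) by exact/measurable_EFinP.
have g0' k x : D x -> (0 <= (g k x)%:E)%E by rewrite lee_fin.
have := fatou nu mD mg' g0'.
move=> /le_trans/(_ (limn_einf_le gB)); apply: le_trans.
apply: ae_ge0_le_integral => //.
- by move=> x _; rewrite lee_fin.
- exact/measurable_EFinP.
- by move=> x Dx; apply: limn_einf_ge => k; exact: g0'.
- rewrite /limn_einf; apply: measurableT_comp => //.
  apply: measurable_fun_limn_esup => n.
  exact: measurableT_comp.
- apply: filterS ae => x H Dx; have [->|cv] := H Dx.
    by apply: limn_einf_ge => k; exact: g0'.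
  have cv' : (g k x)%:E @[k --> \oo] --> (f x)%:E by apply: cvg_EFin => //; exact: nearW.
  by have [-> _] := cvg_limn_einf_sup cv'.
Qed.

End fatou_bound.

Section hardy_sobolev.
Context {R : realType}.

Lemma continuous_powR_pos (a x : R) : 0 < x ->
  {for x, continuous (fun y : R => y `^ a)}.
Proof.
move=> x0; apply: differentiable_continuous; apply/derivable1_diffP.
by apply: derivable_powR; rewrite in_itv/= x0.
Qed.

Lemma measurable_enorm n : measurable_fun setT (@enorm R n).
Proof.
apply: (@measurableT_comp _ _ _ _ _ _ (@Num.sqrt R)).
  exact: continuous_measurable_fun (@sqrt_continuous R).
by apply: continuous_rV_measurable; exact: continuous_dotv.
Qed.

Lemma measurable_invpow n (s : R) :
  measurable_fun setT (fun x : 'rV[R]_n => (enorm x `^ s)^-1).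
Proof.
have -> : (fun x : 'rV[R]_n => (enorm x `^ s)^-1) = (fun x => enorm x `^ (- s)).
  by apply/funext => x; rewrite powRN.
apply: (measurableT_comp (measurable_powR _)); exact: measurable_enorm.
Qed.

(** Fatou's lemma for the approximating test functions, with the singular
    weight regularised by [dl = 1 / (k + 1)] at the [k]-th step. *)
Theorem hardy_sobolev n (Omega : set 'rV[R]_n.+3) (s : R) : open Omega ->
  0 < s < 2 -> exists2 C : R, 0 <= C & forall w, D012 Omega w ->
  (\int[lebesgue_rV n.+3]_(x in Omega)
      (`|w.1 x| `^ crit_exp n.+3 s / enorm x `^ s)%:E <=
   (C * dnorm2 Omega w `^ (crit_exp n.+3 s / 2))%:E)%E.
Proof.
move=> oO s02; have [C C0 HS] := @hardy_sobolev_C1c R n s s02.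
have /andP[s0 s2] := s02.
set p := crit_exp n.+3 s in HS *.
have p2 : 2 <= p by rewrite crit_exp_ge2// ltW.
have p0 : 0 < p by rewrite (lt_le_trans _ p2).
have mO := measurable_open oO.
exists (C * 2 `^ (p / 2)); first by rewrite mulr_ge0 ?powR_ge0.
move=> w Dw; have [mw1 _ _] := Dw; have [phi [tp ae app]] := D012_approx oO Dw.
set d := dnorm2 Omega w in app *.
have d0 : 0 <= d by exact: dnorm2_ge0.
have f0 x : 0 <= `|w.1 x| `^ p / enorm x `^ s.
  by rewrite divr_ge0// powR_ge0.
have mf : measurable_fun Omega (fun x => `|w.1 x| `^ p / enorm x `^ s).
  apply: measurable_funM; last first.
    by apply: measurable_funTS; exact: measurable_invpow.
  by apply: (measurableT_comp (measurable_powR _)); exact: measurableT_comp.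
have main (e : R) : 0 < e ->
   (\int[lebesgue_rV n.+3]_(x in Omega) (`|w.1 x| `^ p / enorm x `^ s)%:E
     <= (C * (2 * d + e) `^ (p / 2))%:E)%E.
  move=> e0; have [n0 H] := app e e0.
  have de0 : 0 <= 2 * d + e by rewrite addr_ge0 ?mulr_ge0 ?(ltW e0).
  pose g k x := `|phi (k + n0)%N x| `^ p / (dotv x x + k.+1%:R^-1) `^ (s / 2).
  have mg k : measurable_fun setT (g k).
    apply: measurable_funM.
      apply: (measurableT_comp (measurable_powR _)); apply: measurableT_comp => //.
      exact: C1c_measurable (test_C1c (tp _) ord0).
    have -> : (fun x : 'rV[R]_n.+3 => ((dotv x x + k.+1%:R^-1) `^ (s / 2))^-1) =
        (fun x => (dotv x x + k.+1%:R^-1) `^ (- (s / 2))).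
      by apply/funext => x; rewrite powRN.
    apply: (measurableT_comp (measurable_powR _)).
    apply: continuous_rV_measurable; apply: continuous_add; first exact: continuous_dotv.
    by move=> x; exact: cst_continuous.
  have g0 k x : 0 <= g k x by rewrite divr_ge0// powR_ge0.
  apply: (@fatou_bound _ _ _ _ _ g) => //.
  - by move=> k; exact: measurable_funTS.
  - apply: filterS ae => x /[apply] cv.
    have [xx|xx] := eqVneq (dotv x x) 0.
      left; have -> : enorm x = 0 by rewrite /enorm xx sqrtr0.
      by rewrite powR0 ?invr0 ?mulr0// gt_eqF.
    right; have xp : 0 < dotv x x by rewrite lt_def xx dotv_ge0.
    have -> : enorm x `^ s = dotv x x `^ (s / 2).
      by rewrite /enorm -powR12_sqrt ?dotv_ge0// -powRrM mulrC.
    have cvphi : phi (k + n0)%N x @[k --> \oo] --> w.1 x.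
      by rewrite (cvg_shiftn n0 (fun k => phi k x) _).
    apply: cvgM.
      apply: (@cvg_comp _ _ _ (fun k : nat => phi (k + n0)%N x) (fun y : R => `|y| `^ p) _ _ _ cvphi).
      exact: (@continuous_norm_powR R p p2 (w.1 x)).
    apply: cvgV; first by rewrite gt_eqF// powR_gt0.
    have cvd : (fun k : nat => dotv x x + k.+1%:R^-1) @ \oo --> dotv x x.
      by rewrite -[X in _ --> X]addr0; apply: cvgD; [exact: cvg_cst|exact: cvg_harmonic].
    apply: (@cvg_comp _ _ _ (fun k : nat => dotv x x + k.+1%:R^-1) (fun y : R => y `^ (s / 2)) _ _ _ cvd).
    exact: continuous_powR_pos.
  - move=> k; have tk := tp (k + n0)%N.
    have de : (\int[lebesgue_rV n.+3]_x (gradsq (phi (k + n0)%N) x)%:E <= (2 * d + e)%:E)%E.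
      by apply: H; rewrite leq_addl.
    have k0 : 0 < k.+1%:R^-1 :> R by rewrite invr_gt0.
    apply: le_trans (HS _ _ _ (test_C1c tk) k0 de0 de).
    apply: ge0_subset_integral => //.
      exact/measurable_EFinP.
    by move=> x _; rewrite lee_fin.
have Ifin : (\int[lebesgue_rV n.+3]_(x in Omega) (`|w.1 x| `^ p / enorm x `^ s)%:E)%E
    \is a fin_num.
  rewrite ge0_fin_numE; last by apply: integral_ge0 => x _; rewrite lee_fin.
  exact: (le_lt_trans (main 1 ltr01) (ltry _)).
move: main; rewrite -(fineK Ifin); set I := fine _ => main.
have I0 : 0 <= I by apply: fine_ge0; apply: integral_ge0 => x _; rewrite lee_fin.
rewrite lee_fin -mulrA -powRM//.
have p20 : 0 < p / 2 by rewrite divr_gt0.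
have [Cz|Cn0] := eqVneq C 0.
  by have := main 1 ltr01; rewrite lee_fin Cz !mul0r.
have Cp : 0 < C by rewrite lt_def Cn0.
have IC0 : 0 <= I / C by rewrite divr_ge0.
(* The bound holds for every [e > 0]; the limit [e = 0] is taken after
   inverting the power. *)
have le2 : (I / C) `^ (p / 2)^-1 <= 2 * d.
  apply/ler_addgt0Pr => e e0; have := main e e0; rewrite lee_fin mulrC -ler_pdivrMr//.
  move=> /(@le_powRl R _ _ (p / 2)^-1); rewrite invr_ge0 (ltW p20) IC0 => /(_ isT isT).
  by rewrite powRVK ?gt_eqF// addr_ge0 ?mulr_ge0// ltW.
have := le_powRl (ltW p20) (powR_ge0 _ _) le2.
by rewrite -powRrM mulVf ?gt_eqF// powRr1// ler_pdivrMr// mulrC.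
Qed.

End hardy_sobolev.

(** * Linear structure of the completion *)

Section D012_space.
Context {R : realType} {N : nat}.

(** Transfers to multiples what is known of the combinations [a *: h + k]. *)
Lemma scale_subr1 (V : lmodType R) (a : R) (x : V) : (a - 1) *: x + x = a *: x.
Proof. by rewrite -[X in _ + X]scale1r -scalerDl subrK. Qed.

Variable Omega : set 'rV[R]_N.
Implicit Types (phi psi : 'rV[R]_N -> R) (w v : @D12fun R N).

Lemma smooth_linear (a : R) phi psi : smooth phi -> smooth psi ->
  smooth (fun x => a * phi x + psi x).
Proof.
move=> sphi spsi.
have fE s : foldr partial (fun x => a * phi x + psi x) s =
    (fun x => a * foldr partial phi s x + foldr partial psi s x).
  elim: s => //= i s ->; apply/funext => x.
  have [_ d1] := sphi s; have [_ d2] := spsi s.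
  have D1 := is_deriveZ a (derivableP (d1 i x)).
  have [_ D] := is_deriveD D1 (derivableP (d2 i x)).
  exact: D.
move=> s; rewrite fE /=; have [c1 d1] := sphi s; have [c2 d2] := spsi s; split.
- apply: continuous_add => //; apply: continuous_mul => //.
  by move=> x; exact: cst_continuous.
- move=> i x.
  have D1 := is_deriveZ a (derivableP (d1 i x)).
  have [D _] := is_deriveD D1 (derivableP (d2 i x)).
  exact: D.
Qed.

Lemma test_linear (a : R) phi psi : test_function Omega phi ->
  test_function Omega psi -> test_function Omega (fun x => a * phi x + psi x).
Proof.
move=> [s1 c1 i1] [s2 c2 i2].
have sub : closure [set x | a * phi x + psi x != 0] `<=`
    closure [set x | phi x != 0] `|` closure [set x | psi x != 0].
  rewrite -closureU; apply: closure_subset => x /=.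
  have [->|px _] := eqVneq (phi x) 0; last by left.
  by rewrite mulr0 add0r => ?; right.
split; first exact: smooth_linear.
- apply: subclosed_compact sub; first exact: closed_closure.
  exact: compactU.
- by move=> x /sub[/i1|/i2].
Qed.

Lemma egrad_linear (a : R) phi psi x : test_function Omega phi ->
  test_function Omega psi ->
  egrad (fun x => a * phi x + psi x) x = a *: egrad phi x + egrad psi x.
Proof.
move=> [s1 _ _] [s2 _ _]; apply/rowP => i; rewrite !mxE.
have [_ d1] := s1 [::]; have [_ d2] := s2 [::].
have D1 := is_deriveZ a (derivableP (d1 i x)).
have [_ D] := is_deriveD D1 (derivableP (d2 i x)).
exact: D.
Qed.

Hypothesis oOmega : open Omega.
Let mO : measurable Omega := measurable_open oOmega.
Hint Resolve mO : core.

Lemma dotv_linear_le (a : R) (x y : 'rV[R]_N) :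
  dotv (a *: x + y) (a *: x + y) <= 2 * a ^+ 2 * dotv x x + 2 * dotv y y.
Proof.
rewrite /dotv !mulr_sumr -big_split/=; apply: ler_sum => i _; rewrite !mxE.
have := sqr_ge0 (a * x 0 i - y 0 i); lra.
Qed.

Lemma D012_linear (a : R) w v : D012 Omega w -> D012 Omega v ->
  D012 Omega (a *: w + v).
Proof.
move=> Dw Dv; have [mw1 mw2 [phi [tp aep cvp]]] := Dw.
have [mv1 mv2 [psi [ts aes cvs]]] := Dv; split.
- by apply: measurable_funD => //; exact: measurable_funM.
- exact: measurable_rV_add.
exists (fun n x => a * phi n x + psi n x); split.
- by move=> n; exact: test_linear.
- apply: filterS2 aep aes => x H1 H2 Ox.
  apply: cvgD; last exact: H2.
  by apply: cvgM; [exact: cvg_cst|exact: H1].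
have d0 (x : 'rV[R]_N) : (0 <= (dotv x x)%:E)%E by rewrite lee_fin dotv_ge0.
have lin n : (\int[lebesgue_rV N]_(x in Omega)
   (enorm (egrad (fun x => (a * phi n x + psi n x)%R) x - (a *: w + v).2 x) ^+ 2)%:E <=
   (2 * a ^+ 2)%:E * (\int[lebesgue_rV N]_(x in Omega) (enorm (egrad (phi n) x - w.2 x) ^+ 2)%:E)
   + 2%:E * (\int[lebesgue_rV N]_(x in Omega) (enorm (egrad (psi n) x - v.2 x) ^+ 2)%:E))%E.
  under eq_integral do rewrite enorm_sq.
  under [X in (_ <= _ * X + _)%E]eq_integral do rewrite enorm_sq.
  under [X in (_ <= _ + _ * X)%E]eq_integral do rewrite enorm_sq.
  have m1 := measurable_dist_egrad oOmega (tp n) mw2.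
  have m2 := measurable_dist_egrad oOmega (ts n) mv2.
  have a0 : 0 <= 2 * a ^+ 2 by rewrite mulr_ge0 ?sqr_ge0.
  rewrite -!ge0_integralZl_EFin// -ge0_integralD//; last 4 first.
  - by move=> x _; rewrite mule_ge0.
  - exact: measurable_funeM.
  - by move=> x _; rewrite mule_ge0.
  - exact: measurable_funeM.
  apply: ge0_le_integral => //.
  - apply: measurable_dist_egrad => //; first exact: test_linear.
    exact: measurable_rV_add.
  - by apply: emeasurable_funD; exact: measurable_funeM.
  - move=> x _; rewrite -!EFinM -EFinD lee_fin egrad_linear//.
    apply: le_trans (dotv_linear_le _ _ _).
    rewrite le_eqVlt; apply/orP; left; apply/eqP; congr dotv;
      by rewrite scalerBr opprD addrACA.
apply: (@squeeze_cvge _ _ _ _ (fun=> 0%E) _ (fun n =>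
   (2 * a ^+ 2)%:E * (\int[lebesgue_rV N]_(x in Omega) (enorm (egrad (phi n) x - w.2 x) ^+ 2)%:E)
   + 2%:E * (\int[lebesgue_rV N]_(x in Omega) (enorm (egrad (psi n) x - v.2 x) ^+ 2)%:E))%E).
- apply: nearW => n; rewrite lin andbT.
  by apply: integral_ge0 => x _; rewrite lee_fin sqr_ge0.
- exact: cvg_cst.
- have -> : (0 = (2 * a ^+ 2)%:E * 0 + 2%:E * 0 :> \bar R)%E by rewrite !mule0 adde0.
  exact: (cvgeD _ (cvgeZl _ cvp) (cvgeZl _ cvs)).
Qed.

Lemma DxD_linear (a : R) (h k : @D12pair R N) : DxD Omega h -> DxD Omega k ->
  DxD Omega (a *: h + k).
Proof.
move=> [h1 h2] [k1 k2]; split.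
- exact: (D012_linear a h1 k1).
- exact: (D012_linear a h2 k2).
Qed.

Lemma DxD_add (h k : @D12pair R N) : DxD Omega h -> DxD Omega k ->
  DxD Omega (h + k).
Proof.
move=> Dh Dk; have E : 1 *: h = h := scale1r h.
by have := DxD_linear 1 Dh Dk; rewrite E.
Qed.

Lemma DxD_scale (a : R) (h : @D12pair R N) : DxD Omega h -> DxD Omega (a *: h).
Proof.
by move=> Dh; have := DxD_linear (a - 1) Dh Dh; rewrite (scale_subr1 a h).
Qed.

Lemma DxD_sub (h k : @D12pair R N) : DxD Omega h -> DxD Omega k ->
  DxD Omega (h - k).
Proof.
move=> Dh Dk; have E (V : lmodType R) (x y : V) : -1 *: y + x = x - y.
  by rewrite scaleN1r addrC.
by have := DxD_linear (-1) Dk Dh; rewrite (E _ h).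
Qed.

End D012_space.

(** * The energy and Fréchet derivatives *)

Section inner_product.
Context {R : realType} {N : nat}.
Variable Omega : set 'rV[R]_N.
Hypothesis oOmega : open Omega.
Let mO : measurable Omega := measurable_open oOmega.
Hint Resolve mO : core.
Local Notation leb := (@lebesgue_rV R N).

Definition ip (w v : @D12fun R N) : R := \int[leb]_(x in Omega) dotv (w.2 x) (v.2 x).

Definition pip (z h : @D12pair R N) : R := ip z.1 h.1 + ip z.2 h.2.

Definition energy (z : @D12pair R N) : R := dnorm2 Omega z.1 + dnorm2 Omega z.2.

Lemma dotv_norm_le (x y : 'rV[R]_N) : `|dotv x y| <= dotv x x + dotv y y.
Proof.
rewrite /dotv -big_split/= (le_trans (ler_norm_sum _ _ _))//.
apply: ler_sum => i _; apply/ler_normlP.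
have := sqr_ge0 (x 0 i - y 0 i); have := sqr_ge0 (x 0 i + y 0 i).
have := sqr_ge0 (x 0 i); have := sqr_ge0 (y 0 i); split; lra.
Qed.

Lemma ip_integrable (w v : @D12fun R N) : D012 Omega w -> D012 Omega v ->
  leb.-integrable Omega (EFin \o (fun x => dotv (w.2 x) (v.2 x))).
Proof.
move=> Dw Dv; have [_ mw _] := Dw; have [_ mv _] := Dv.
have iw := D012_integrable oOmega Dw; have iv := D012_integrable oOmega Dv.
apply: (le_integrable mO _ _ (integrableD mO iw iv)).
  by apply/measurable_EFinP; exact: measurable_dotv.
move=> x _; rewrite /= lee_fin.
by rewrite (le_trans (dotv_norm_le _ _))// ler_norm.
Qed.

Lemma dotv_linearr (a : R) (x y z : 'rV[R]_N) :
  dotv x (a *: y + z) = a * dotv x y + dotv x z.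
Proof.
by rewrite /dotv mulr_sumr -big_split/=; apply: eq_bigr => i _; rewrite !mxE; ring.
Qed.

Lemma dotvC (x y : 'rV[R]_N) : dotv x y = dotv y x.
Proof. by apply: eq_bigr => i _; rewrite mulrC. Qed.

Lemma ip_linear (a : R) (w h k : @D12fun R N) : D012 Omega w -> D012 Omega h ->
  D012 Omega k -> ip w (a *: h + k) = a * ip w h + ip w k.
Proof.
move=> Dw Dh Dk; have ih := ip_integrable Dw Dh; have ik := ip_integrable Dw Dk.
rewrite /ip -RintegralZl// -RintegralD//; last exact: (integrableZl mO a ih).
by apply: eq_Rintegral => x _; rewrite -dotv_linearr.
Qed.

Lemma ipC (w v : @D12fun R N) : ip w v = ip v w.
Proof. by apply: eq_Rintegral => x _; rewrite dotvC. Qed.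

Lemma ipww (w : @D12fun R N) : ip w w = dnorm2 Omega w.
Proof. by rewrite dnorm2E. Qed.

Lemma dnorm2_linear (a : R) (h k : @D12fun R N) : D012 Omega h -> D012 Omega k ->
  dnorm2 Omega (a *: h + k) =
  a ^+ 2 * dnorm2 Omega h + 2 * a * ip h k + dnorm2 Omega k.
Proof.
move=> Dh Dk; have Dhk := D012_linear oOmega a Dh Dk.
rewrite -!ipww ip_linear// [ip _ h]ipC [ip _ k]ipC !ip_linear// (ipC k h); ring.
Qed.

Lemma energy_linear (a : R) (h k : @D12pair R N) : DxD Omega h -> DxD Omega k ->
  energy (a *: h + k) = a ^+ 2 * energy h + 2 * a * pip h k + energy k.
Proof.
move=> [h1 h2] [k1 k2].
have E1 := dnorm2_linear a h1 k1; have E2 := dnorm2_linear a h2 k2.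
rewrite /energy /pip.
have -> : dnorm2 Omega (a *: h + k).1 = dnorm2 Omega (a *: h.1 + k.1) by [].
have -> : dnorm2 Omega (a *: h + k).2 = dnorm2 Omega (a *: h.2 + k.2) by [].
by rewrite E1 E2; ring.
Qed.

Lemma pip_linear (a : R) (z h k : @D12pair R N) : DxD Omega z -> DxD Omega h ->
  DxD Omega k -> pip z (a *: h + k) = a * pip z h + pip z k.
Proof.
move=> [z1 z2] [h1 h2] [k1 k2].
have E1 := ip_linear a z1 h1 k1; have E2 := ip_linear a z2 h2 k2.
rewrite /pip.
have -> : ip z.1 (a *: h + k).1 = ip z.1 (a *: h.1 + k.1) by [].
have -> : ip z.2 (a *: h + k).2 = ip z.2 (a *: h.2 + k.2) by [].
by rewrite E1 E2; ring.
Qed.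

Lemma energy_ge0 z : 0 <= energy z.
Proof. by rewrite addr_ge0// dnorm2_ge0. Qed.

Lemma pnorm_sq z : pnorm Omega z ^+ 2 = energy z.
Proof. by rewrite sqr_sqrtr// energy_ge0. Qed.

Lemma pnorm_ge0 z : 0 <= pnorm Omega z.
Proof. exact: sqrtr_ge0. Qed.

Lemma energy_add z h : DxD Omega z -> DxD Omega h ->
  energy (z + h) = energy z + 2 * pip z h + energy h.
Proof.
move=> Dz Dh; have E := energy_linear 1 Dz Dh.
have E1 : 1 *: z = z := scale1r z.
by rewrite E1 in E; rewrite E; ring.
Qed.

(** The quadratic polynomial [energy (a *: z + h)] in [a] is nonnegative.
    As [pnorm] is only a seminorm on pairs of functions, it may also degenerate
    to an affine one. *)
Lemma pip_cauchy_schwarz z h : DxD Omega z -> DxD Omega h ->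
  `|pip z h| <= pnorm Omega z * pnorm Omega h.
Proof.
move=> Dz Dh; set p := pip z h.
have H a : 0 <= a ^+ 2 * energy z + 2 * a * p + energy h.
  by rewrite -energy_linear// energy_ge0.
suff H2 : p ^+ 2 <= energy z * energy h.
  rewrite -ler_sqr ?nnegrE ?mulr_ge0 ?pnorm_ge0//.
  by rewrite exprMn !pnorm_sq real_normK ?num_real.
have [z0|zn0] := eqVneq (energy z) 0.
  have [p0|pn0] := eqVneq p 0; first by rewrite p0 z0 expr0n mul0r.
  have := H (- (energy h + 1) / (2 * p)); rewrite z0 mulr0 add0r.
  have -> : 2 * (- (energy h + 1) / (2 * p)) * p = - (energy h + 1) by field.
  lra.
have zp : 0 < energy z by rewrite lt_def zn0 energy_ge0.
have := H (- p / energy z).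
have -> : (- p / energy z) ^+ 2 * energy z + 2 * (- p / energy z) * p + energy h =
  (energy z * energy h - p ^+ 2) / energy z by field.
by rewrite pmulr_lge0 ?invr_gt0// subr_ge0.
Qed.

Lemma energy_scale (a : R) z : DxD Omega z -> energy (a *: z) = a ^+ 2 * energy z.
Proof.
have pzz : pip z z = energy z by rewrite /pip !ipww.
by move=> Dz; rewrite -(scale_subr1 a z) energy_linear// pzz; ring.
Qed.

Lemma pnorm_scale (a : R) z : DxD Omega z ->
  pnorm Omega (a *: z) = `|a| * pnorm Omega z.
Proof.
move=> Dz; apply/eqP; rewrite -(@eqrXn2 _ 2) ?mulr_ge0 ?pnorm_ge0//.
by rewrite exprMn !pnorm_sq energy_scale// real_normK ?num_real.
Qed.

Lemma frechet_energy z : DxD Omega z ->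
  is_frechet_derivative Omega energy z (fun h => 2 * pip z h).
Proof.
move=> Dz; split.
- by move=> a h k Dh Dk; rewrite pip_linear//; ring.
- exists (2 * pnorm Omega z) => h Dh; rewrite normrM ger0_norm// -mulrA.
  by rewrite ler_pM2l// pip_cauchy_schwarz.
- move=> e e0; exists e => // h Dh he; rewrite energy_add//.
  have -> : energy z + 2 * pip z h + energy h - energy z - 2 * pip z h = energy h by ring.
  rewrite ger0_norm ?energy_ge0// -pnorm_sq expr2.
  by rewrite ler_wpM2r ?pnorm_ge0// ltW.
Qed.

Lemma frechet_linear (F G : @D12pair R N -> R) (a : R) z L M :
  is_frechet_derivative Omega F z L -> is_frechet_derivative Omega G z M ->
  is_frechet_derivative Omega (fun z => a * F z + G z) z (fun h => a * L h + M h).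
Proof.
move=> [L1 [C L2] L3] [M1 [D M2] M3]; split.
- by move=> b h k Dh Dk; rewrite L1// M1//; ring.
- exists (`|a| * C + D) => h Dh.
  rewrite (le_trans (ler_normD _ _))// mulrDl lerD ?M2//.
  by rewrite normrM -mulrA ler_wpM2l// L2.
- move=> e e0; have e2 : 0 < e / 2 by rewrite divr_gt0.
  have ea : 0 < e / 2 / (`|a| + 1) by rewrite divr_gt0// ltr_wpDl.
  have [d1 d10 H1] := L3 _ ea; have [d2 d20 H2] := M3 _ e2.
  exists (Num.min d1 d2) => [|h Dh]; first by rewrite lt_min d10.
  rewrite lt_min => /andP[/(H1 h Dh) {}H1 /(H2 h Dh) {}H2].
  have -> : a * F (z + h) + G (z + h) - (a * F z + G z) - (a * L h + M h) =
     a * (F (z + h) - F z - L h) + (G (z + h) - G z - M h) by ring.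
  rewrite (le_trans (ler_normD _ _))// normrM.
  have a1 : `|a| * (e / 2 / (`|a| + 1)) <= e / 2.
    by rewrite mulrA ler_pdivrMr ?ltr_wpDl// mulrC ler_wpM2l ?(ltW e2)// lerDl.
  have := ler_wpM2l (normr_ge0 a) H1.
  have := ler_wpM2r (pnorm_ge0 h) a1; lra.
Qed.

Lemma frechet_continuous (F : @D12pair R N -> R) z L :
  is_frechet_derivative Omega F z L -> forall e, 0 < e ->
  exists2 d, 0 < d & forall h, DxD Omega h -> pnorm Omega h < d ->
    `|F (z + h) - F z| < e.
Proof.
move=> [_ [C LC] L3] e e0; have [d d0 H] := L3 1 ltr01.
have c0 : 0 < `|C| + 1 by rewrite ltr_wpDl.
exists (Num.min d (e / (`|C| + 1))) => [|h Dh]; first by rewrite lt_min d0 divr_gt0.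
rewrite lt_min => /andP[/(H h Dh) {}H]; rewrite ltr_pdivlMr// => he.
apply: le_lt_trans he.
have -> : F (z + h) - F z = (F (z + h) - F z - L h) + L h by ring.
have := ler_normD (F (z + h) - F z - L h) (L h).
have := LC h Dh; have := ler_wpM2r (pnorm_ge0 h) (ler_norm C); lra.
Qed.

End inner_product.

(** * Superposition functionals *)

Section integral_bound.
Context d (T : measurableType d) {R : realType}.
Variable nu : {measure set T -> \bar R}.

Lemma Rintegral_bound (D : set T) (g G : T -> R) (B : R) : measurable D ->
  measurable_fun D g -> measurable_fun D G -> (forall x, D x -> `|g x| <= G x) ->
  (\int[nu]_(x in D) (G x)%:E <= B%:E)%E ->
  nu.-integrable D (EFin \o g) /\ `|\int[nu]_(x in D) g x| <= B.
Proof.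
move=> mD mg mG gG GB.
have H : (\int[nu]_(x in D) `|(g x)%:E| <= B%:E)%E.
  apply: le_trans GB; apply: ge0_le_integral => //.
  - by apply: measurableT_comp => //; exact/measurable_EFinP.
  - exact/measurable_EFinP.
have ig : nu.-integrable D (EFin \o g).
  apply/integrableP; split; first exact/measurable_EFinP.
  exact: le_lt_trans H (ltry _).
split => //; rewrite -lee_fin EFin_normr_Rintegral//.
apply: le_trans H; apply: le_abse_integral => //.
exact/measurable_EFinP.
Qed.

End integral_bound.

Section nemytskii.
Context {R : realType} {N : nat}.
Variable Omega : set 'rV[R]_N.
Hypothesis oOmega : open Omega.
Let mO : measurable Omega := measurable_open oOmega.
Hint Resolve mO : core.
Local Notation leb := (@lebesgue_rV R N).

(* The weight enters only through an inequality of Hardy-Sobolev type. *)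
Variables (W : 'rV[R]_N -> R) (q K : R).
Hypotheses (q2 : 2 < q) (mW : measurable_fun Omega W) (W0 : forall x, 0 <= W x).
Hypotheses (K0 : 0 <= K) (HK : forall w : @D12fun R N, D012 Omega w ->
  (\int[leb]_(x in Omega) (W x * `|w.1 x| `^ q)%:E
     <= (K * dnorm2 Omega w `^ (q / 2))%:E)%E).

Let q0 : 0 < q. Proof. by rewrite (lt_trans _ q2). Qed.

Let qn0 : 0 <= q. Proof. exact: ltW. Qed.

Lemma powR_sum_le (a b : R) : 0 <= a -> 0 <= b ->
  (a + b) `^ q <= 2 `^ q * (a `^ q + b `^ q).
Proof.
move=> a0 b0; wlog ab : a b a0 b0 / a <= b.
  have [h|/ltW h] := leP a b; first exact.
  by move=> /(_ b a b0 a0 h); rewrite addrC [X in _ * X]addrC.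
apply: (@le_trans _ _ (2 `^ q * b `^ q)); last first.
  by rewrite ler_wpM2l ?powR_ge0// lerDr powR_ge0.
by rewrite -powRM// le_powRl ?addr_ge0//; lra.
Qed.

Definition asum (z : @D12pair R N) x : R := `|z.1.1 x| + `|z.2.1 x|.

Lemma asum_ge0 z x : 0 <= asum z x.
Proof. by rewrite addr_ge0. Qed.

Lemma DxD_meas1 z : DxD Omega z -> measurable_fun Omega z.1.1.
Proof. by case=> [[]]. Qed.

Lemma DxD_meas2 z : DxD Omega z -> measurable_fun Omega z.2.1.
Proof. by case=> _ []. Qed.

Lemma measurable_asum z : DxD Omega z -> measurable_fun Omega (asum z).
Proof.
move=> Dz; apply: measurable_funD; apply: measurableT_comp => //.
- exact: DxD_meas1.
- exact: DxD_meas2.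
Qed.

Lemma measurable_Wpow (g : 'rV[R]_N -> R) (a : R) : measurable_fun Omega g ->
  measurable_fun Omega (fun x => W x * g x `^ a).
Proof.
by move=> mg; apply: measurable_funM => //; apply: (measurableT_comp (measurable_powR _)).
Qed.

Let K1 := 2 `^ q * (2 * K).

Let K10 : 0 <= K1. Proof. by rewrite mulr_ge0 ?powR_ge0// mulr_ge0. Qed.

Lemma integral_pow_sum (f g : 'rV[R]_N -> R) (A B : R) :
  measurable_fun Omega f -> measurable_fun Omega g ->
  (forall x, 0 <= f x) -> (forall x, 0 <= g x) ->
  (\int[leb]_(x in Omega) (W x * f x `^ q)%:E <= A%:E)%E ->
  (\int[leb]_(x in Omega) (W x * g x `^ q)%:E <= B%:E)%E ->
  (\int[leb]_(x in Omega) (W x * (f x + g x) `^ q)%:E <= (2 `^ q * (A + B))%:E)%E.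
Proof.
move=> mf mg f0 g0 fA gB.
have p0 (h : 'rV[R]_N -> R) x : (0 <= (W x * h x `^ q)%:E)%E.
  by rewrite lee_fin mulr_ge0 ?powR_ge0.
have mfq : measurable_fun Omega (fun x => (W x * f x `^ q)%:E).
  by apply/measurable_EFinP; exact: measurable_Wpow.
have mgq : measurable_fun Omega (fun x => (W x * g x `^ q)%:E).
  by apply/measurable_EFinP; exact: measurable_Wpow.
apply: (@le_trans _ _ (\int[leb]_(x in Omega)
   ((2 `^ q)%:E * ((W x * f x `^ q)%:E + (W x * g x `^ q)%:E)))%E).
  apply: ge0_le_integral => //.
  - by move=> x _; rewrite lee_fin mulr_ge0 ?powR_ge0.
  - by apply/measurable_EFinP; apply: measurable_Wpow; exact: measurable_funD.
  - by apply: measurable_funeM; exact: emeasurable_funD.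
  - move=> x _; rewrite -EFinD -EFinM lee_fin -mulrDr mulrCA.
    by rewrite ler_wpM2l// powR_sum_le.
rewrite ge0_integralZl_EFin ?powR_ge0//; last 2 first.
- by move=> x _; rewrite adde_ge0.
- exact: emeasurable_funD.
rewrite ge0_integralD// EFinM EFinD lee_wpmul2l ?lee_fin ?powR_ge0//.
exact: leeD.
Qed.

Lemma integral_asum z : DxD Omega z ->
  (\int[leb]_(x in Omega) (W x * asum z x `^ q)%:E <= (K1 * pnorm Omega z `^ q)%:E)%E.
Proof.
move=> Dz; have [Dz1 Dz2] := Dz.
have m1 := DxD_meas1 Dz; have m2 := DxD_meas2 Dz.
have := @integral_pow_sum (fun x => `|z.1.1 x|) (fun x => `|z.2.1 x|) _ _
  (measurableT_comp (@normr_measurable R setT) m1)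
  (measurableT_comp (@normr_measurable R setT) m2)
  (fun=> normr_ge0 _) (fun=> normr_ge0 _) (HK Dz1) (HK Dz2).
move=> /le_trans; apply; rewrite lee_fin /K1 -mulrA ler_wpM2l ?powR_ge0//.
have H w : 0 <= dnorm2 Omega w -> dnorm2 Omega w <= energy Omega z ->
    dnorm2 Omega w `^ (q / 2) <= pnorm Omega z `^ q.
  move=> w0 wz; have -> : q = 2 * (q / 2) by field.
  rewrite [in leRHS]powRrM powR_mulrn ?pnorm_ge0// pnorm_sq.
  have -> : 2 * (q / 2) / 2 = q / 2 by field.
  by rewrite le_powRl// divr_ge0.
have H1 := H z.1 (dnorm2_ge0 _ _); have H2 := H z.2 (dnorm2_ge0 _ _).
rewrite /energy lerDl lerDr !dnorm2_ge0 in H1 H2.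
move: (H1 isT) (H2 isT).
move: (dnorm2 _ z.1 `^ _) (dnorm2 _ z.2 `^ _) (pnorm _ z `^ _) => a b c ac bc.
by rewrite -mulrDr (mulrC 2 K) -mulrA ler_wpM2l// mulr_natl mulr2n lerD.
Qed.

Variables (f d1 d2 : R -> R -> R).
Hypothesis fgrowth : c1_growth q f d1 d2.

Definition nemytskii (z : @D12pair R N) : R :=
  \int[leb]_(x in Omega) (W x * f (z.1.1 x) (z.2.1 x)).

Definition dnemytskii (z h : @D12pair R N) : R :=
  \int[leb]_(x in Omega)
    (W x * (d1 (z.1.1 x) (z.2.1 x) * h.1.1 x + d2 (z.1.1 x) (z.2.1 x) * h.2.1 x)).

Lemma measurable_comp2 (g : R -> R -> R) z : DxD Omega z ->
  measurable_fun setT (fun z : R * R => g z.1 z.2) ->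
  measurable_fun Omega (fun x => g (z.1.1 x) (z.2.1 x)).
Proof.
move=> Dz mg; exact: (measurable_fun_pair_on mO mg (DxD_meas1 Dz) (DxD_meas2 Dz)).
Qed.

Lemma nemytskii_integrable : exists2 C : R, 0 <= C & forall z, DxD Omega z ->
  leb.-integrable Omega (EFin \o (fun x => W x * f (z.1.1 x) (z.2.1 x))) /\
  `|nemytskii z| <= C * pnorm Omega z `^ q.
Proof.
have [ta [C [[ta01 taq C0] [mf _ _] fC _ _]]] := fgrowth.
exists (C * K1) => [|z Dz]; first exact: mulr_ge0.
apply: (@Rintegral_bound _ _ _ _ _ _ (fun x => C * (W x * asum z x `^ q))) => //.
- by apply: measurable_funM => //; exact: measurable_comp2.
- by apply: measurable_funM => //; apply: measurable_Wpow; exact: measurable_asum.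
- move=> x _; rewrite normrM ger0_norm// mulrCA ler_wpM2l//; exact: fC.
have m := measurable_Wpow q (measurable_asum Dz).
under eq_integral do rewrite EFinM.
rewrite ge0_integralZl_EFin//.
- by rewrite -mulrA EFinM lee_wpmul2l ?lee_fin//; exact: integral_asum.
- by move=> x _; rewrite lee_fin mulr_ge0 ?powR_ge0.
- exact/measurable_EFinP.
Qed.

(** Hölder's inequality for the measure of density [W], with the exponents
    [q / r] and [q / (q - r)]. *)
Lemma integral_W_hoelder (g h : 'rV[R]_N -> R) (r A B : R) :
  measurable_fun Omega g -> measurable_fun Omega h ->
  (forall x, 0 <= g x) -> (forall x, 0 <= h x) -> 0 < r < q ->
  0 <= A -> 0 <= B ->
  (\int[leb]_(x in Omega) (W x * g x `^ q)%:E <= A%:E)%E ->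
  (\int[leb]_(x in Omega) (W x * h x `^ q)%:E <= B%:E)%E ->
  (\int[leb]_(x in Omega) (W x * (g x `^ r * h x `^ (q - r)))%:E
    <= (A `^ (r / q) * B `^ (1 - r / q))%:E)%E.
Proof.
move=> mg mh g0 h0 /andP[r0 rq] A0 B0 gA hB.
have t01 : 0 < r / q < 1 by rewrite divr_gt0//= ltr_pdivrMr// mul1r.
have p0 (k : 'rV[R]_N -> R) x : Omega x -> 0 <= W x * k x `^ q.
  by rewrite mulr_ge0 ?powR_ge0.
have := integral_hoelder mO (measurable_Wpow q mg) (measurable_Wpow q mh)
  (p0 g) (p0 h) t01 A0 B0 gA hB.
congr (_ <= _)%E; apply: eq_integral => x _; congr EFin.
rewrite !powRM ?powR_ge0// mulrACA -!powRrM.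
have -> : W x `^ (r / q) * W x `^ (1 - r / q) = W x.
  by rewrite -pos_powRD subrKC ?powRr1.
by congr (_ * (_ `^ _ * _ `^ _)); field; rewrite gt_eqF.
Qed.

Lemma dnemytskii_integrable z : DxD Omega z -> exists C : R, forall h, DxD Omega h ->
  leb.-integrable Omega (EFin \o (fun x => W x * (d1 (z.1.1 x) (z.2.1 x) * h.1.1 x +
     d2 (z.1.1 x) (z.2.1 x) * h.2.1 x))) /\
  `|dnemytskii z h| <= C * pnorm Omega h.
Proof.
move=> Dz; have [ta [C [[ta01 taq C0] [_ md1 md2] _ dC _]]] := fgrowth.
have qz : q != 0 by rewrite gt_eqF.
have [Z Z0 Zz] : exists2 Z : R, 0 <= Z &
    (\int[leb]_(x in Omega) (W x * asum z x `^ q)%:E <= Z%:E)%E.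
  exists (K1 * pnorm Omega z `^ q); first by rewrite mulr_ge0 ?powR_ge0.
  exact: integral_asum.
exists (C * (K1 `^ q^-1 * Z `^ (1 - 1 / q))) => h Dh.
have q1 : 0 < (1 : R) < q by apply/andP; split => //; lra.
have [A [A0 AE hA]] : exists A : R, [/\ 0 <= A,
    A `^ (1 / q) = K1 `^ q^-1 * pnorm Omega h &
    (\int[leb]_(x in Omega) (W x * asum h x `^ q)%:E <= A%:E)%E].
  exists (K1 * pnorm Omega h `^ q); split.
  - by rewrite mulr_ge0 ?powR_ge0.
  - by rewrite div1r (powRM _ K10 (powR_ge0 _ _)) (powRVK (pnorm_ge0 _ _) qz).
  - exact: integral_asum.
have hol := integral_W_hoelder (measurable_asum Dh) (measurable_asum Dz)
  (asum_ge0 h) (asum_ge0 z) q1 A0 Z0 hA Zz.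
have mg : measurable_fun Omega (fun x => W x * (asum h x `^ 1 * asum z x `^ (q - 1))).
  apply: measurable_funM => //; apply: measurable_funM;
    apply: (measurableT_comp (measurable_powR _)); exact: measurable_asum.
apply: (@Rintegral_bound _ _ _ _ _ _
   (fun x => C * (W x * (asum h x `^ 1 * asum z x `^ (q - 1))))) => //.
- apply: measurable_funM => //; apply: measurable_funD; apply: measurable_funM.
  + exact: measurable_comp2.
  + exact: DxD_meas1.
  + exact: measurable_comp2.
  + exact: DxD_meas2.
- by apply: measurable_funM.
- move=> x _; rewrite normrM (ger0_norm (W0 x)) mulrCA ler_wpM2l//.
  rewrite powRr1 ?asum_ge0//.
  have [e1 e2] := dC (z.1.1 x) (z.2.1 x).
  rewrite (le_trans (ler_normD _ _))// !normrM /asum.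
  have := ler_wpM2r (normr_ge0 (h.1.1 x)) e1.
  have := ler_wpM2r (normr_ge0 (h.2.1 x)) e2; lra.
under eq_integral do rewrite EFinM.
rewrite ge0_integralZl_EFin//.
- apply: (@le_trans _ _ (C%:E * (A `^ (1 / q) * Z `^ (1 - 1 / q))%:E)%E).
    exact: lee_wpmul2l.
  by rewrite -EFinM lee_fin AE le_eqVlt; apply/orP; left; apply/eqP; ring.
- by move=> x _; rewrite lee_fin !mulr_ge0 ?powR_ge0.
- exact/measurable_EFinP.
Qed.

Lemma dnemytskii_linear z (a : R) h k : DxD Omega z -> DxD Omega h -> DxD Omega k ->
  dnemytskii z (a *: h + k) = a * dnemytskii z h + dnemytskii z k.
Proof.
move=> Dz Dh Dk; have [C HC] := dnemytskii_integrable Dz.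
have [ih _] := HC h Dh; have [ik _] := HC k Dk.
rewrite /dnemytskii -RintegralZl// -RintegralD//; last exact: (integrableZl mO a ih).
apply: eq_Rintegral => x _.
set A := d1 _ _; set B := d2 _ _; move: A B => A B.
have -> : (a *: h + k).1.1 x = a * h.1.1 x + k.1.1 x := erefl.
have -> : (a *: h + k).2.1 x = a * h.2.1 x + k.2.1 x := erefl.
by move: (h.1.1 x) (h.2.1 x) (k.1.1 x) (k.2.1 x) (W x) => *; ring.
Qed.

(** The pointwise remainder is at most
    [W H^(1 + ta) (M + H)^(q - 1 - ta)], where [H] and [M] are the sizes of [h]
    and [z]; by Hölder's inequality, the first power contributes
    [pnorm h ^ (1 + ta)] to the integral. *)
Lemma nemytskii_remainder z : DxD Omega z -> exists ta C : R, [/\ 0 < ta, 0 <= C &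
  forall h, DxD Omega h -> pnorm Omega h <= 1 ->
  `|nemytskii (z + h) - nemytskii z - dnemytskii z h| <= C * pnorm Omega h `^ (1 + ta)].
Proof.
move=> Dz; have [ta [C [[/andP[ta0 ta1] taq C0] [mf md1 md2] _ _ rC]]] := fgrowth.
have [CN _ iN] := nemytskii_integrable.
have [CL iL] := dnemytskii_integrable Dz.
have rq : 0 < 1 + ta < q.
  rewrite addr_gt0//= (le_lt_trans _ q2)//.
  by rewrite [leRHS](_ : _ = 1 + 1)// lerD2l.
have [Z Z0 Zz] : exists2 Z : R, 0 <= Z &
    (\int[leb]_(x in Omega) (W x * asum z x `^ q)%:E <= Z%:E)%E.
  exists (K1 * pnorm Omega z `^ q); first by rewrite mulr_ge0 ?powR_ge0.
  exact: integral_asum.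
(* A bound of the integral of [W (M + H)^q], valid for [pnorm h <= 1]. *)
pose B := 2 `^ q * (Z + K1).
have B0 : 0 <= B by rewrite mulr_ge0 ?powR_ge0// addr_ge0.
exists ta, (C * (K1 `^ ((1 + ta) / q) * B `^ (1 - (1 + ta) / q))); split => //.
  by rewrite !mulr_ge0 ?powR_ge0.
move=> h Dh h1; have Dzh := DxD_add oOmega Dz Dh.
have [izh _] := iN _ Dzh; have [iz _] := iN _ Dz; have [ih _] := iL _ Dh.
have [A [A0 AE AK hA]] : exists A : R, [/\ 0 <= A,
    A `^ ((1 + ta) / q) = K1 `^ ((1 + ta) / q) * pnorm Omega h `^ (1 + ta), A <= K1 &
    (\int[leb]_(x in Omega) (W x * asum h x `^ q)%:E <= A%:E)%E].
  exists (K1 * pnorm Omega h `^ q); split.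
  - by rewrite mulr_ge0 ?powR_ge0.
  - rewrite (powRM _ K10 (powR_ge0 _ _)) -[X in _ * X = _]powRrM.
    by congr (_ * _ `^ _); field; rewrite gt_eqF.
  - rewrite -[leRHS]mulr1 ler_wpM2l// -(powRr0 (pnorm Omega h)).
    have [->|hn0] := eqVneq (pnorm Omega h) 0.
      by rewrite powR0 ?gt_eqF// powRr0.
    by rewrite ger_powR// lt_def hn0 pnorm_ge0.
  - exact: integral_asum.
have hB : (\int[leb]_(x in Omega) (W x * (asum z x + asum h x) `^ q)%:E <= B%:E)%E.
  apply: le_trans (integral_pow_sum (measurable_asum Dz) (measurable_asum Dh)
    (asum_ge0 z) (asum_ge0 h) Zz hA) _.
  by rewrite lee_fin ler_wpM2l ?powR_ge0// lerD2l.
have mzh : measurable_fun Omega (fun x => asum z x + asum h x).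
  by apply: measurable_funD; exact: measurable_asum.
have zh0 x : 0 <= asum z x + asum h x by rewrite addr_ge0 ?asum_ge0.
have hol := integral_W_hoelder (measurable_asum Dh) mzh
  (asum_ge0 h) zh0 rq A0 B0 hA hB.
pose rem x := W x * f ((z + h).1.1 x) ((z + h).2.1 x) - W x * f (z.1.1 x) (z.2.1 x) -
  W x * (d1 (z.1.1 x) (z.2.1 x) * h.1.1 x + d2 (z.1.1 x) (z.2.1 x) * h.2.1 x).
have -> : nemytskii (z + h) - nemytskii z - dnemytskii z h =
    \int[leb]_(x in Omega) rem x.
  rewrite /rem RintegralB//; last exact: (integrableB mO izh iz).
  by rewrite RintegralB.
pose G x := W x * (asum h x `^ (1 + ta) * (asum z x + asum h x) `^ (q - (1 + ta))).
have G0 x : 0 <= G x by rewrite !mulr_ge0 ?powR_ge0.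
have mG : measurable_fun Omega G.
  apply: measurable_funM => //; apply: measurable_funM.
    by apply: (measurableT_comp (measurable_powR _)); exact: measurable_asum.
  exact: (measurableT_comp (measurable_powR _)).
have mrem : measurable_fun Omega rem.
  have m1 := measurable_int _ izh; have m2 := measurable_int _ iz.
  have m3 := measurable_int _ ih.
  by apply: measurable_funB; [apply: measurable_funB|]; exact/measurable_EFinP.
have remG x : Omega x -> `|rem x| <= C * G x.
  move=> _; rewrite /rem -!mulrBr normrM (ger0_norm (W0 x)) /G mulrCA ler_wpM2l//.
  have qE : q - (1 + ta) = q - 1 - ta by ring.
  by rewrite qE; exact: (rC (z.1.1 x) (z.2.1 x) (h.1.1 x) (h.2.1 x)).
have mCG : measurable_fun Omega (fun x => C * G x) by exact: measurable_funM.
have CGB : (\int[leb]_(x in Omega) (C * G x)%:E <=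
    (C * (A `^ ((1 + ta) / q) * B `^ (1 - (1 + ta) / q)))%:E)%E.
  under eq_integral do rewrite EFinM.
  rewrite ge0_integralZl_EFin//.
  - by rewrite [leRHS]EFinM; exact: lee_wpmul2l.
  - by move=> x _; rewrite lee_fin.
  - exact/measurable_EFinP.
have [_ /le_trans] := Rintegral_bound mO mrem mCG remG CGB; apply.
by rewrite AE le_eqVlt; apply/orP; left; apply/eqP; ring.
Qed.

Theorem frechet_nemytskii z : DxD Omega z ->
  is_frechet_derivative Omega nemytskii z (dnemytskii z).
Proof.
move=> Dz; split.
- by move=> a h k Dh Dk; exact: dnemytskii_linear.
- have [C HC] := dnemytskii_integrable Dz.
  by exists C => h Dh; have [] := HC h Dh.
- have [ta [C [ta0 C0 HC]]] := nemytskii_remainder Dz.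
  move=> e e0; have c0 : 0 < C + 1 by rewrite ltr_wpDl.
  have b0 : 0 < e / (C + 1) by rewrite divr_gt0.
  exists (Num.min 1 ((e / (C + 1)) `^ ta^-1)).
    by rewrite lt_min ltr01 powR_gt0.
  move=> h Dh; rewrite lt_min => /andP[h1 h2].
  rewrite (le_trans (HC h Dh (ltW h1)))//.
  move: (pnorm Omega h) (pnorm_ge0 Omega h) h2 => P P0 Pe.
  have -> : P `^ (1 + ta) = P * P `^ ta by rewrite pos_powRD ?powRr1// addr_gt0.
  have Pt : P `^ ta <= e / (C + 1).
    have := le_powRl (ltW ta0) P0 (ltW Pe).
    by rewrite -powRrM mulVf ?gt_eqF// powRr1// ltW.
  rewrite mulrCA mulrC ler_wpM2r//.
  rewrite (le_trans (ler_wpM2l C0 Pt))// mulrA ler_pdivrMr// mulrC.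
  by rewrite ler_wpM2l ?(ltW e0)// lerDl.
Qed.

End nemytskii.

(** * The Nehari set and the mountain pass level *)

Section mountain_pass.
Context {R : realType} {N : nat}.
Variable Omega : set 'rV[R]_N.
Hypothesis oOmega : open Omega.
Variables (p q kappa : R) (J1 J2 : @D12pair R N -> R).
Hypotheses (p2 : 2 < p) (q2 : 2 < q) (kappa0 : 0 < kappa).
Hypothesis J1_ge0 : forall z, 0 <= J1 z.
Hypothesis J2_ge0 : forall z, 0 <= J2 z.
Hypothesis J1_hom : forall (t : R) z, DxD Omega z -> 0 <= t -> J1 (t *: z) = t `^ p * J1 z.
Hypothesis J2_hom : forall (t : R) z, DxD Omega z -> 0 <= t -> J2 (t *: z) = t `^ q * J2 z.
Hypothesis J1_frechet : forall z, DxD Omega z ->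
  exists L, is_frechet_derivative Omega J1 z L.
Hypothesis J2_frechet : forall z, DxD Omega z ->
  exists L, is_frechet_derivative Omega J2 z L.
Hypothesis J1_bound : exists2 C, 0 <= C &
  forall z, DxD Omega z -> J1 z <= C * pnorm Omega z `^ p.
Hypothesis J2_bound : exists2 C, 0 <= C &
  forall z, DxD Omega z -> J2 z <= C * pnorm Omega z `^ q.

Let F z := 2^-1 * energy Omega z - p^-1 * J1 z - kappa * J2 z.

(* By homogeneity, the value at [z] of the derivative of [F] at [z]. *)
Let K z := energy Omega z - J1 z - kappa * q * J2 z.

Let p0 : 0 < p. Proof. by rewrite (lt_trans _ p2). Qed.
Let q0 : 0 < q. Proof. by rewrite (lt_trans _ q2). Qed.

Let fiber (A B C t : R) : R := 2^-1 * A * t `^ 2 - p^-1 * B * t `^ p - kappa * C * t `^ q.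

Let F_fiber z t : DxD Omega z -> 0 <= t ->
  F (t *: z) = fiber (energy Omega z) (J1 z) (J2 z) t.
Proof.
move=> Dz t0; rewrite /F energy_scale// J1_hom// J2_hom// /fiber powR_mulrn//.
by ring.
Qed.

Let F_frechet z : DxD Omega z -> exists L, is_frechet_derivative Omega F z L.
Proof.
move=> Dz; have [L1 H1] := J1_frechet Dz; have [L2 H2] := J2_frechet Dz.
have H0 := frechet_energy oOmega Dz.
have H3 := frechet_linear (- kappa) H2 (frechet_linear (- p^-1) H1
  (frechet_linear (2^-1 - 1) H0 H0)).
eexists; move: H3; congr is_frechet_derivative.
by apply/funext => w; rewrite /F; field; rewrite gt_eqF.
Qed.

Let K_frechet z : DxD Omega z -> exists L, is_frechet_derivative Omega K z L.
Proof.
move=> Dz; have [L1 H1] := J1_frechet Dz; have [L2 H2] := J2_frechet Dz.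
have H0 := frechet_energy oOmega Dz.
have H3 := frechet_linear (- (kappa * q)) H2 (frechet_linear (- 1) H1 H0).
eexists; move: H3; congr is_frechet_derivative.
by apply/funext => w; rewrite /K; ring.
Qed.

Let is_derive_fiber A B C : is_derive (1 : R) 1 (fiber A B C) (A - B - kappa * q * C).
Proof.
have D r : is_derive (1 : R) 1 (fun t : R => t `^ r) (r * 1 `^ (r - 1)).
  exact: is_derive1_powR.
have := is_deriveB (is_deriveB (is_deriveZ (2^-1 * A) (D 2)) (is_deriveZ (p^-1 * B) (D p)))
  (is_deriveZ (kappa * C) (D q)).
rewrite !powR1 !mulr1 => -[d e]; apply: DeriveDef; first exact: d.
apply: (etrans e).
have scE (a b : R) : a *: (b : R^o) = a * b by [].
by rewrite !scE; field; rewrite gt_eqF.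
Qed.

(** The derivative along the ray through [z] determines [L z]. *)
Lemma frechet_self z L : DxD Omega z -> is_frechet_derivative Omega F z L ->
  L z = K z.
Proof.
move=> Dz [L1 _ L3].
have [dG eG] := is_derive_fiber (energy Omega z) (J1 z) (J2 z).
set G := fiber _ _ _ in dG eG.
have cv : (fun h : R => h^-1 *: (G (h *: 1 + 1) - G 1)) @ 0^' --> L z.
  apply/cvgrPdist_le => e e0.
  have e1 : 0 < e / (pnorm Omega z + 1) by rewrite divr_gt0// ltr_wpDl// pnorm_ge0.
  have [d d0 H] := L3 _ e1.
  have dz : 0 < d / (pnorm Omega z + 1) by rewrite divr_gt0// ltr_wpDl// pnorm_ge0.
  near=> h.
  have h0 : h != 0 by near: h; exact: nbhs_dnbhs_neq.
  have h1 : `|h| < 1 by near: h; apply: dnbhs0_lt; exact: ltr01.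
  have hd : `|h| < d / (pnorm Omega z + 1) by near: h; exact: dnbhs0_lt.
  have hp : pnorm Omega (h *: z) < d.
    rewrite (pnorm_scale oOmega)//; move: hd.
    rewrite ltr_pdivlMr ?ltr_wpDl ?pnorm_ge0//.
    by apply: le_lt_trans; rewrite ler_wpM2l// lerDl.
  have := H _ (DxD_scale oOmega h Dz) hp.
  have E1 (V : lmodType R) (x : V) : x + h *: x = (h + 1) *: x.
    by rewrite scalerDl scale1r addrC.
  have h10 : 0 <= h + 1.
    by move: h1; rewrite ltr_norml => /andP[+ _]; lra.
  have E3 : F z = G 1.
    by have := F_fiber Dz ler01; have -> : 1 *: z = z := scale1r z.
  have E4 : L (h *: z) = h * L z.
    by rewrite -(scale_subr1 h z) L1//; ring.
  rewrite (E1 _ z) (F_fiber Dz h10) E3 E4 (pnorm_scale oOmega)// -/G => {}H.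
  have -> : h *: 1 = h :> R by exact: mulr1.
  have -> : L z - h^-1 *: (G (h + 1) - G 1 : R^o) =
      - (h^-1 * (G (h + 1) - G 1 - h * L z)).
    by rewrite (_ : _ *: _ = h^-1 * (G (h + 1) - G 1))//; field.
  rewrite normrN normrM normfV ler_pdivrMl ?normr_gt0//.
  apply: (le_trans H).
  rewrite mulrCA ler_wpM2l// mulrAC ler_pdivrMr ?ltr_wpDl ?pnorm_ge0//.
  by rewrite ler_wpM2l ?(ltW e0)// lerDl.
have D : 'D_1 G 1 = L z := cvg_lim (@Rhausdorff R) cv.
by rewrite -D eG.
Unshelve. all: by end_near. Qed.

Lemma nehari_K z : nehari Omega F z -> [/\ DxD Omega z, 0 < energy Omega z & K z = 0].
Proof.
move=> [Dz zn0 [L HL Lz]]; split => //; last by rewrite -(frechet_self Dz HL).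
by rewrite -pnorm_sq exprn_gt0// lt_def zn0 pnorm_ge0.
Qed.

Lemma frechet_cst (c : R) z : is_frechet_derivative Omega (fun=> c) z (fun=> 0).
Proof.
split; first by move=> a h k _ _; rewrite mulr0 addr0.
- by exists 0 => h _; rewrite normr0 mul0r.
- move=> e e0; exists 1 => // h _ _.
  by rewrite !subrr normr0 mulr_ge0 ?pnorm_ge0// ltW.
Qed.

Lemma K_nehari z : DxD Omega z -> 0 < energy Omega z -> K z = 0 -> nehari Omega F z.
Proof.
move=> Dz ez Kz; have [L HL] := F_frechet Dz; split => //.
  by rewrite -sqrf_eq0 pnorm_sq gt_eqF.
by exists L => //; rewrite (frechet_self Dz HL).
Qed.

(** The maximum of the fibering map at [t = 1] is Young's inequality. *)
Lemma fiber_max (r t : R) : 2 < r -> 0 <= t ->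
  2^-1 * t `^ 2 - r^-1 * t `^ r <= 2^-1 - r^-1.
Proof.
move=> r2 t0; have r0 : 0 < r by rewrite (lt_trans _ r2).
have th : 0 < 2 / r < 1 by rewrite divr_gt0//= ltr_pdivrMr// mul1r.
have := young_powR (powR_ge0 t r) ler01 th.
rewrite powR1 !mulr1 -powRrM.
have -> : r * (2 / r) = 2 by field; rewrite gt_eqF.
move=> H; have h : 0 <= 2^-1 :> R by [].
have := ler_wpM2l h H.
have -> : 2^-1 * (2 / r * t `^ r + (1 - 2 / r)) = r^-1 * t `^ r + (2^-1 - r^-1).
  by field; rewrite gt_eqF.
lra.
Qed.

Lemma fiber_neg (r T : R) : 2 < r -> r `^ (r - 2)^-1 <= T ->
  2^-1 * T `^ 2 - r^-1 * T `^ r < 0.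
Proof.
move=> r2 rT; have r0 : 0 < r by rewrite (lt_trans _ r2).
have T0 : 0 < T by rewrite (lt_le_trans _ rT)// powR_gt0.
have r20 : 0 < r - 2 by rewrite subr_gt0.
have H : r <= T `^ (r - 2).
  have := le_powRl (ltW r20) (powR_ge0 _ _) rT.
  by rewrite -powRrM mulVf ?gt_eqF// powRr1// ltW.
have -> : T `^ r = T `^ 2 * T `^ (r - 2) by rewrite -gt0_powRD// subrKC.
have T2 : 0 < T `^ 2 by rewrite powR_gt0.
have : 1 <= r^-1 * T `^ (r - 2) by rewrite ler_pdivlMl// mulr1.
move=> /(ler_wpM2l (ltW T2)); lra.
Qed.

(* The multiples of a point of the Nehari set by [Tmax] or more have [F < 0]. *)
Let Tmax : R := Num.max (p `^ (p - 2)^-1) (q `^ (q - 2)^-1) + 1.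

Let Tmax1 : 1 <= Tmax.
Proof. by rewrite lerDr le_max powR_ge0. Qed.

(* On the Nehari set, [F] along a ray is a combination with nonnegative
   coefficients of two profiles with a single power, each maximal at 1. *)
Let fiberE A B C t : A = B + kappa * q * C ->
  fiber A B C t = B * (2^-1 * t `^ 2 - p^-1 * t `^ p) +
    kappa * q * C * (2^-1 * t `^ 2 - q^-1 * t `^ q).
Proof. by move=> ->; rewrite /fiber; field; rewrite !gt_eqF. Qed.

(** The ray through a point of the Nehari set is an admissible path on which
    the functional is maximal at that point. *)
Lemma nehari_ray z : nehari Omega F z ->
  exists2 gamma, mp_paths Omega F gamma &
    path_max F gamma = (F z)%:E /\ exists2 t, t \in `[0, 1] & gamma t = z.
Proof.
move=> /nehari_K [Dz ez Kz].
have T0 : 0 < Tmax by rewrite (lt_le_trans _ Tmax1).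
have AE : energy Omega z = J1 z + kappa * q * J2 z by move: Kz; rewrite /K; lra.
have C0 : 0 <= kappa * q * J2 z by rewrite mulr_ge0// mulr_ge0// ltW.
have B0 := J1_ge0 z.
have FE t : 0 <= t -> F (t *: z) = J1 z * (2^-1 * t `^ 2 - p^-1 * t `^ p) +
    kappa * q * J2 z * (2^-1 * t `^ 2 - q^-1 * t `^ q).
  by move=> t0; rewrite F_fiber// fiberE.
have s1 : 1 *: z = z := scale1r z.
have Fz : F z = J1 z * (2^-1 - p^-1) + kappa * q * J2 z * (2^-1 - q^-1).
  by have := FE 1 ler01; rewrite s1 !powR1 !mulr1.
pose gamma (t : R) := (t * Tmax) *: z.
have gmem : Tmax^-1 \in `[0, 1].
  by rewrite in_itv/= invr_ge0 ltW//= invf_le1.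
have gz : gamma Tmax^-1 = z by rewrite /gamma mulVf ?gt_eqF.
exists gamma; last split; last by exists Tmax^-1.
- split.
  + by move=> t _; exact: DxD_scale.
  + move=> t _ e e0; have c0 : 0 < Tmax * pnorm Omega z + 1.
      by rewrite ltr_wpDl// mulr_ge0 ?pnorm_ge0// ltW.
    exists (e / (Tmax * pnorm Omega z + 1)); first by rewrite divr_gt0.
    move=> t' _ tt'.
    have E (V : lmodType R) (x : V) : (t' * Tmax) *: x - (t * Tmax) *: x =
        ((t' - t) * Tmax) *: x by rewrite -scalerBl mulrBl.
    rewrite /gamma (E _ z) (pnorm_scale oOmega)// normrM (ger0_norm (ltW T0)) -mulrA.
    move: tt'; rewrite ltr_pdivlMr//; apply: le_lt_trans.
    by rewrite ler_wpM2l// lerDl.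
  + by rewrite /gamma (pnorm_scale oOmega)// mul0r normr0 mul0r.
  + rewrite /gamma mul1r FE ?ltW//.
    have Tp : p `^ (p - 2)^-1 <= Tmax by rewrite ler_wpDr// le_max lexx.
    have Tq : q `^ (q - 2)^-1 <= Tmax by rewrite ler_wpDr// le_max lexx orbT.
    have np := fiber_neg p2 Tp; have nq := fiber_neg q2 Tq.
    have [Bz|Bn0] := eqVneq (J1 z) 0.
      rewrite Bz mul0r add0r pmulr_rlt0//.
      by rewrite AE Bz add0r in ez.
    rewrite ltr_wnDr//; first by rewrite mulr_ge0_le0// ltW.
    by rewrite pmulr_rlt0// lt_def Bn0.
- apply/eqP; rewrite eq_le; apply/andP; split.
    apply: ge_ereal_sup => _ [t /= tI <-]; rewrite lee_fin.
    move: tI; rewrite in_itv/= => /andP[t0 _].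
    have tT0 : 0 <= t * Tmax by rewrite mulr_ge0// ltW.
    rewrite /gamma (FE _ tT0) Fz.
    exact: (lerD (ler_wpM2l B0 (fiber_max p2 tT0)) (ler_wpM2l C0 (fiber_max q2 tT0))).
  by apply: ereal_sup_ubound; exists Tmax^-1 => //; rewrite gz.
Qed.

(** By the Hardy-Sobolev bounds, [K] is positive on a punctured ball. *)
Lemma K_pos_near0 : exists2 rho : R, 0 < rho & forall z, DxD Omega z ->
  energy Omega z <= rho ^+ 2 -> 2^-1 * energy Omega z <= K z.
Proof.
have [C1 C10 H1] := J1_bound; have [C2 C20 H2] := J2_bound.
have kq0 : 0 <= kappa * q by rewrite mulr_ge0 ?ltW.
pose D := C1 + kappa * q * C2 + 1.
have D0 : 0 < D by rewrite ltr_wpDl// addr_ge0// mulr_ge0.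
have small r : 2 < r -> exists2 rho : R, 0 < rho & forall P, 0 <= P -> P <= rho ->
    D * P `^ r <= 4^-1 * P ^+ 2.
  move=> r2; have r20 : 0 < r - 2 by rewrite subr_gt0.
  have d0 : 0 < (4 * D)^-1 by rewrite invr_gt0 mulr_gt0.
  exists ((4 * D)^-1 `^ (r - 2)^-1); first by rewrite powR_gt0.
  move=> P P0 PD; have -> : P `^ r = P ^+ 2 * P `^ (r - 2).
    by rewrite -powR_mulrn// -pos_powRD subrKC// (lt_trans _ r2).
  have := le_powRl (ltW r20) P0 PD.
  rewrite -powRrM mulVf ?gt_eqF// powRr1 ?(ltW d0)// => H.
  rewrite mulrCA mulrC ler_wpM2r ?sqr_ge0//.
  have := ler_wpM2l (ltW D0) H.
  have -> : D * (4 * D)^-1 = 4^-1 by field; rewrite gt_eqF.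
  by [].
have [r1 r10 S1] := small p p2; have [r2 r20 S2] := small q q2.
exists (Num.min r1 r2) => [|z Dz]; first by rewrite lt_min r10.
rewrite -pnorm_sq => zr; have P0 := pnorm_ge0 Omega z.
have m0 : 0 <= Num.min r1 r2 by rewrite le_min !ltW.
move: zr; rewrite ler_sqr ?nnegrE// le_min => /andP[/(S1 _ P0) {}S1 /(S2 _ P0) {}S2].
rewrite /K -pnorm_sq.
have {}H1 := H1 z Dz; have {}H2 := H2 z Dz.
have {}H2 := ler_wpM2l kq0 H2.
move: H1 H2 S1 S2; move: (pnorm Omega z `^ p) (powR_ge0 (pnorm Omega z) p)
  (pnorm Omega z `^ q) (powR_ge0 (pnorm Omega z) q) (pnorm Omega z ^+ 2) (J1 z) (J2 z).
move=> a a0 b b0 e j1 j2 h1 h2 s1 s2.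
have d1 : C1 * a <= D * a.
  rewrite ler_wpM2r// /D -addrA lerDl addr_ge0// mulr_ge0//.
have d2 : kappa * q * C2 * b <= D * b.
  by rewrite ler_wpM2r// /D; lra.
rewrite mulrA in h2; lra.
Qed.

(** As [p] and [q] exceed 2, both nonlinear terms weigh at least as much in
    [K] as in [2 F]. *)
Lemma F_neg_K z : DxD Omega z -> F z < 0 -> K z < 0.
Proof.
move=> Dz; rewrite /F /K; have j1 := J1_ge0 z; have j2 := J2_ge0 z.
have a1 : p^-1 * J1 z <= 2^-1 * J1 z by rewrite ler_wpM2r// lef_pV2 ?posrE// ltW.
have a2 : 2 * (kappa * J2 z) <= q * (kappa * J2 z).
  by rewrite ler_wpM2r ?(ltW q2)// mulr_ge0// ltW.
rewrite -(mulrA kappa q) (mulrCA kappa q).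
have aux (x e j c d : R) : x <= 2^-1 * j -> 2 * c <= d -> 2^-1 * e - x - c < 0 ->
  e - j - d < 0 by lra.
exact: aux a1 a2.
Qed.

(** The continuous function [max (K, rho^2 - energy)] changes sign along an
    admissible path, and it vanishes only at points of the Nehari set. *)
Lemma path_meets_nehari gamma : mp_paths Omega F gamma ->
  exists2 t, t \in `[0, 1] & nehari Omega F (gamma t).
Proof.
move=> [Dg cg g0 g1]; have [rho rho0 Hrho] := K_pos_near0.
have cont (G : @D12pair R N -> R) :
   (forall z, DxD Omega z -> exists L, is_frechet_derivative Omega G z L) ->
   {within `[0, 1], continuous (fun t => G (gamma t))}.
  move=> dG; apply/subspace_continuousP => t tI.
  have {}tI : t \in `[0, 1] by [].
  have [L HL] := dG _ (Dg t tI).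
  apply/cvgrPdist_lt => e e0; have [d d0 H] := frechet_continuous HL e0.
  have [d' d'0 H'] := cg t tI d d0.
  rewrite /within /=; apply/nbhs_ballP; exists d' => //= s; rewrite /ball/= => ts sI.
  have {}sI : s \in `[0, 1] by [].
  have := H (gamma s - gamma t) (DxD_sub oOmega (Dg s sI) (Dg t tI)).
  have E (V : zmodType) (x y : V) : x + (y - x) = y by rewrite addrC subrK.
  rewrite (E _ (gamma t) (gamma s)) distrC; apply.
  by apply: H' => //; rewrite distrC.
pose h t := Num.max (K (gamma t)) (rho ^+ 2 - energy Omega (gamma t)).
have ch : {within `[0, 1], continuous h}.
  move=> t; have c1 := cont K K_frechet t.
  have c3 := cont (fun z => - 1 * energy Omega z + rho ^+ 2) (fun z Dz => ex_intro _ _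
    (frechet_linear (- 1) (frechet_energy oOmega Dz) (frechet_cst (rho ^+ 2) z))) t.
  have -> : h = (fun t => K (gamma t)) \max
      (fun t => - 1 * energy Omega (gamma t) + rho ^+ 2).
    by apply/funext => s; rewrite /h /= mulN1r addrC.
  exact: (@continuous_max _ (subspace `[(0 : R), 1]%classic) (fun t => K (gamma t)) _ t c1 c3).
have I0 : (0 : R) \in `[0, 1] by rewrite in_itv/= lexx ler01.
have I1 : (1 : R) \in `[0, 1] by rewrite in_itv/= lexx ler01.
have K1 := F_neg_K (Dg 1 I1) g1.
have e0 : energy Omega (gamma 0) = 0 by rewrite -pnorm_sq g0 expr0n.
have h0 : 0 < h 0 by rewrite /h e0 subr0 lt_max exprn_gt0// orbT.
have h1 : h 1 < 0.
  rewrite /h gt_max K1/= subr_lt0 ltNge; apply/negP => e1.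
  have := Hrho _ (Dg 1 I1) e1; rewrite leNgt => /negP; apply.
  by rewrite (lt_le_trans K1)// mulr_ge0// energy_ge0.
have [|t tI ht] := @IVT R h 0 1 0 ler01 ch.
  by rewrite (min_idPr _) ?(max_idPl _)// ?ltW// (lt_trans h1).
exists t => //; have Dt := Dg t tI.
have [Kle Ele] : K (gamma t) <= 0 /\ rho ^+ 2 <= energy Omega (gamma t).
  have : h t <= 0 by rewrite ht.
  by rewrite /h ge_max => /andP[Ka Ea]; split => //; rewrite -subr_le0.
have Et : 0 < energy Omega (gamma t) by rewrite (lt_le_trans _ Ele)// exprn_gt0.
apply: K_nehari => //; apply/eqP; rewrite eq_le Kle leNgt; apply/negP => Kn.
have En : energy Omega (gamma t) = rho ^+ 2.
  apply/eqP; rewrite eq_le Ele andbT leNgt; apply/negP => En.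
  by move: ht; apply/eqP; rewrite lt_eqF// /h gt_max Kn subr_lt0.
have := Hrho _ Dt; rewrite En lexx => /(_ isT); rewrite leNgt => /negP; apply.
by rewrite (lt_le_trans Kn)// mulr_ge0// sqr_ge0.
Qed.

(** The maximum on a path is at least the value at a point of the Nehari set
    on it, and the maximum on the ray through such a point is the value there. *)
Theorem nehari_eq_mountain_pass : nehari_level Omega F = mp_level Omega F.
Proof.
apply/eqP; rewrite eq_le; apply/andP; split.
  apply: le_ereal_inf_tmp => _ [gamma Hg <-].
  have [t tI nt] := path_meets_nehari Hg.
  apply: (@le_trans _ _ (F (gamma t))%:E).
    by apply: ereal_inf_lbound; exists (gamma t).
  by apply: ereal_sup_ubound; exists t.
apply: le_ereal_inf_tmp => _ [z nz <-].
have [gamma Hg [<- _]] := nehari_ray nz.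
by apply: ereal_inf_lbound; exists gamma.
Qed.

Theorem ground_state_mountain_pass z : ground_state Omega F z ->
  mountain_pass_solution Omega F z.
Proof.
move=> [[Dz cz] zn0 Fz]; have nz : nehari Omega F z by split => //; exists (fun=> 0).
split => //; first by rewrite Fz nehari_eq_mountain_pass.
have [gamma Hg [pm Ht]] := nehari_ray nz; exists gamma => //; split => //.
by rewrite pm Fz nehari_eq_mountain_pass.
Qed.

End mountain_pass.

(** * The functional of the system *)

Section application.
Context {R : realType}.

Lemma crit_exp_gt2 n (s : R) : s < 2 -> 2 < crit_exp n.+3 s.
Proof.
move=> s2; rewrite crit_expE ltr_pdivlMr ?ltr0n// ltr_pM2l//.
by rewrite ltrBrDr -ltrBrDl -[n.+3]addn2 natrD addrAC subrr add0r.
Qed.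

Lemma weight_ge0 n (s eps : R) (x : 'rV[R]_n) : 0 <= weight s eps x.
Proof. by rewrite /weight; case: ifP => _; exact: powR_ge0. Qed.

(** The exponent is smaller than [s] for [|x| < 1] and larger for
    [|x| >= 1]. *)
Lemma weight_le n (s eps : R) (x : 'rV[R]_n) : 0 < eps < s ->
  weight s eps x <= (enorm x `^ s)^-1.
Proof.
move=> /andP[e0 es]; rewrite -powRN /weight.
have x0 : 0 <= enorm x by exact: sqrtr_ge0.
case: ltP => x1; last by rewrite ler_powR// lerN2 lerDl ltW.
have [->|xn0] := eqVneq (enorm x) 0.
  have h1 : - (s - eps) != 0 by rewrite oppr_eq0 subr_eq0 gt_eqF.
  have h2 : - s != 0 by rewrite oppr_eq0 gt_eqF// (lt_trans e0).
  by rewrite !powR0.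
by rewrite ger_powR// ?lt_def ?xn0 ?x0 ?(ltW x1)// lerN2 lerBlDr lerDl ltW.
Qed.

Lemma measurable_weight n (s eps : R) :
  measurable_fun setT (@weight R n s eps).
Proof.
have me := @measurable_enorm R n.
apply: measurable_fun_ifT.
- exact: measurable_fun_ltr.
- exact: (measurableT_comp (measurable_powR _)).
- exact: (measurableT_comp (measurable_powR _)).
Qed.

Lemma invpow_ge0 n (s : R) (x : 'rV[R]_n) : 0 <= (enorm x `^ s)^-1.
Proof. by rewrite invr_ge0 powR_ge0. Qed.

(** A weight dominated by [|x|^-s] is controlled by the Hardy-Sobolev
    inequality. *)
Lemma hardy_sobolev_weight n (Omega : set 'rV[R]_n.+3) (s : R)
    (W : 'rV[R]_n.+3 -> R) : open Omega -> 0 < s < 2 ->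
  measurable_fun setT W -> (forall x, 0 <= W x) ->
  (forall x, W x <= (enorm x `^ s)^-1) ->
  exists2 K : R, 0 <= K & forall w, D012 Omega w ->
  (\int[lebesgue_rV n.+3]_(x in Omega) (W x * `|w.1 x| `^ crit_exp n.+3 s)%:E
    <= (K * dnorm2 Omega w `^ (crit_exp n.+3 s / 2))%:E)%E.
Proof.
move=> oO s02 mW W0 Ws; have [C C0 HS] := hardy_sobolev oO s02.
exists C => // w Dw; apply: le_trans (HS w Dw).
have [mw _ _] := Dw; have mO := measurable_open oO.
have mp : measurable_fun Omega (fun x => `|w.1 x| `^ crit_exp n.+3 s).
  by apply: (measurableT_comp (measurable_powR _)); exact: measurableT_comp.
apply: ge0_le_integral => //.
- by move=> x _; rewrite lee_fin mulr_ge0 ?powR_ge0.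
- by apply/measurable_EFinP; apply: measurable_funM => //; exact: measurable_funTS.
- apply/measurable_EFinP; apply: measurable_funM => //.
  apply: measurable_funTS; exact: measurable_invpow.
- by move=> x _; rewrite lee_fin mulrC ler_wpM2l ?powR_ge0.
Qed.

Lemma nemytskii_hom n (Omega : set 'rV[R]_n) (W : 'rV[R]_n -> R) (q t : R)
    (f : R -> R -> R) z : open Omega ->
  (lebesgue_rV n).-integrable Omega (EFin \o (fun x => W x * f (z.1.1 x) (z.2.1 x))) ->
  (forall a b, f (t * a) (t * b) = t `^ q * f a b) ->
  nemytskii Omega W f (t *: z) = t `^ q * nemytskii Omega W f z.
Proof.
move=> oO iz fh; rewrite /nemytskii -RintegralZl//; last exact: measurable_open.
apply: eq_Rintegral => x _.
have -> : (t *: z).1.1 x = t * z.1.1 x := erefl.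
have -> : (t *: z).2.1 x = t * z.2.1 x := erefl.
by rewrite fh mulrCA.
Qed.

Lemma nemytskii_ge0 n (Omega : set 'rV[R]_n) (W : 'rV[R]_n -> R)
    (f : R -> R -> R) z : (forall x, 0 <= W x) -> (forall a b, 0 <= f a b) ->
  0 <= nemytskii Omega W f z.
Proof. by move=> W0 f0; apply: Rintegral_ge0 => x _; rewrite mulr_ge0. Qed.

End application.

Theorem theorem13 (R : realType) (N : nat) (Omega : set 'rV[R]_N)
    (s1 s2 lambda mu kappa alpha beta eps : R) (U : @D12fun R N)
    (hN : (3 <= N)%N) (hOmega : is_cone Omega)
    (hs1 : 0 < s1 < 2) (hs2 : 0 < s2 < 2) (hs12 : s1 != s2)
    (hlambda : 0 < lambda) (hmu : 0 < mu) (hkappa : 0 < kappa)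
    (halpha : 1 < alpha) (hbeta : 1 < beta)
    (hab : alpha + beta = crit_exp N s2)
    (heps : 0 < eps < s2)
    (hU : limit_ground_state Omega s1 U) :
  let Ulambda := rescaled Omega s1 U lambda in
  let Umu := rescaled Omega s1 U mu in
  let eta1 := eta Omega s2 eps Ulambda in
  let eta2 := eta Omega s2 eps Umu in
  let F := Phi Omega s1 s2 lambda mu kappa alpha beta eps in
  [\/ mu < lambda /\ (1 < beta < 2 \/ beta = 2 /\ (eta1 < kappa%:E)%E),
      lambda = mu /\ (Num.min alpha beta < 2 \/
        [/\ Num.min alpha beta = 2, eta1 = eta2 & (eta1 < kappa%:E)%E]) |
      lambda < mu /\ (1 < alpha < 2 \/ alpha = 2 /\ (eta2 < kappa%:E)%E)] ->
  nehari_level Omega F = mp_level Omega F /\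
  forall z : @D12pair R N, ground_state Omega F z -> positive_pair Omega z ->
    mountain_pass_solution Omega F z.
Proof.
move=> Ulambda Umu eta1 eta2 F _; rewrite {}/F {Ulambda Umu eta1 eta2 hU U hs12}.
case: N => [|[|[|n]]] // in Omega hN hOmega hab *.
have [oO _ _ _ _] := hOmega.
have /andP[s10 s12] := hs1; have /andP[s20 s22] := hs2.
set p := crit_exp n.+3 s1; set q := crit_exp n.+3 s2 in hab.
have p2 : 2 < p by exact: crit_exp_gt2.
have q2 : 2 < q by exact: crit_exp_gt2.
pose f1 (a b : R) := lambda * `|a| `^ p + mu * `|b| `^ p.
pose f2 (a b : R) := `|a| `^ alpha * `|b| `^ beta.
pose W1 (x : 'rV[R]_n.+3) := (enorm x `^ s1)^-1.
pose W2 := @weight R n.+3 s2 eps.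
have g1 := c1_growth_sum (lt_trans (ltr1n _ 2) p2) (ltW hlambda) (ltW hmu).
have g2 := c1_growth_prod halpha hbeta; rewrite hab in g2.
have mW1 : measurable_fun setT W1 by exact: measurable_invpow.
have mW2 : measurable_fun setT W2 by exact: measurable_weight.
have W10 x : 0 <= W1 x by exact: invpow_ge0.
have W20 x : 0 <= W2 x by exact: weight_ge0.
have [K1 K10 H1] := hardy_sobolev_weight oO hs1 mW1 W10 (fun=> lexx _).
have [K2 K20 H2] := hardy_sobolev_weight oO hs2 mW2 W20 (fun x => weight_le x heps).
pose J1 := nemytskii Omega W1 f1; pose J2 := nemytskii Omega W2 f2.
have mW1O : measurable_fun Omega W1 by exact: measurable_funTS.
have mW2O : measurable_fun Omega W2 by exact: measurable_funTS.
have [C1 C10 B1] := nemytskii_integrable oO p2 mW1O W10 K10 H1 g1.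
have [C2 C20 B2] := nemytskii_integrable oO q2 mW2O W20 K20 H2 g2.
have f10 a b : 0 <= f1 a b.
  by rewrite addr_ge0// mulr_ge0 ?powR_ge0// ltW.
have f20 a b : 0 <= f2 a b by rewrite mulr_ge0 ?powR_ge0.
have J10 z : 0 <= J1 z by exact: nemytskii_ge0.
have J20 z : 0 <= J2 z by exact: nemytskii_ge0.
have J1h (t : R) z : DxD Omega z -> 0 <= t -> J1 (t *: z) = t `^ p * J1 z.
  move=> Dz t0; apply: nemytskii_hom => //; first by have [] := B1 z Dz.
  by move=> a b; rewrite /f1 !normrM (ger0_norm t0) !powRM//; ring.
have J2h (t : R) z : DxD Omega z -> 0 <= t -> J2 (t *: z) = t `^ q * J2 z.
  move=> Dz t0; apply: nemytskii_hom => //; first by have [] := B2 z Dz.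
  move=> a b; rewrite /f2 !normrM (ger0_norm t0) !powRM// mulrACA.
  by rewrite -pos_powRD hab// (lt_trans _ q2).
have J1F z : DxD Omega z -> exists L, is_frechet_derivative Omega J1 z L.
  by move=> Dz; eexists; exact: (frechet_nemytskii oO p2 mW1O W10 K10 H1 g1 Dz).
have J2F z : DxD Omega z -> exists L, is_frechet_derivative Omega J2 z L.
  by move=> Dz; eexists; exact: (frechet_nemytskii oO q2 mW2O W20 K20 H2 g2 Dz).
have J1B : exists2 C, 0 <= C & forall z, DxD Omega z -> J1 z <= C * pnorm Omega z `^ p.
  by exists C1 => // z Dz; have [_ /(le_trans (ler_norm _))] := B1 z Dz.
have J2B : exists2 C, 0 <= C & forall z, DxD Omega z -> J2 z <= C * pnorm Omega z `^ q.
  by exists C2 => // z Dz; have [_ /(le_trans (ler_norm _))] := B2 z Dz.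
have -> : Phi Omega s1 s2 lambda mu kappa alpha beta eps =
    (fun z => 2^-1 * energy Omega z - p^-1 * J1 z - kappa * J2 z).
  apply/funext => z; rewrite /Phi /J1 /J2 /nemytskii; congr (_ - _ * _ - _ * _).
    by apply: eq_Rintegral => x _; rewrite /f1 /W1 -/p; ring.
  by apply: eq_Rintegral => x _; rewrite mulrA.
split; first exact: (nehari_eq_mountain_pass oO p2 q2 hkappa J10 J20 J1h J2h J1F J2F J1B J2B).
move=> z gz _.
exact: (ground_state_mountain_pass oO p2 q2 hkappa J10 J20 J1h J2h J1F J2F J1B J2B gz).
Qed.
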